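(* For every real $q$ with $0<q<1$, $$V(q)=\frac{1}{\sqrt[3]{-1+9\exp\left(\displaystyle\int_q^1\varphi^2(-t)\,\varphi^2(-t^3)\,\frac{dt}{t}\right)}} =\frac12\sqrt[3]{1-\exp\left(-8\displaystyle\int_0^q\psi^2(t)\,\psi^2(t^3)\,dt\right)},$$ where the cube roots are real cube roots.
   Context: For $|q|<1$, Ramanujan's theta functions are $\varphi(q)=\sum_{n=-\infty}^{\infty}q^{n^2}$ and $\psi(q)=\sum_{n=0}^{\infty}q^{n(n+1)/2}$. Ramanujan's cubic continued fraction is $$V(q)=\cfrac{q^{1/3}}{1+\cfrac{q+q^2}{1+\cfrac{q^2+q^4}{1+\cdots}}},\qquad |q|<1,$$ that is, $V(q)=\dfrac{q^{1/3}}{1}\,\dfrac{q+q^2}{+1}\,\dfrac{q^2+q^4}{+1}\,\dfrac{q^3+q^6}{+1}\cdots$ (the $n$-th partial numerator after the first being $q^n+q^{2n}$), where $q^{1/3}$ denotes the real cube root of $q$. *)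

(* Defs.v *)
From Stdlib Require Import Reals Lra Lia.
From Coquelicot Require Import Coquelicot.
Open Scope R_scope.

(* Ramanujan's phi(q) = sum_{n in Z} q^(n^2) = 2 * sum_{n>=0} q^(n^2) - 1 *)
Definition rphi (q : R) : R := 2 * Series (fun n : nat => q ^ (n * n)) - 1.

Definition rpsi (q : R) : R := Series (fun n : nat => q ^ (Nat.div (n * (n + 1)) 2)).

Definition cbrt (x : R) : R :=
  if Rlt_dec 0 x then Rpower x (1/3)
  else if Rlt_dec x 0 then - Rpower (- x) (1/3) else 0.

Fixpoint cf_tail (q : R) (m k : nat) : R :=
  match m with
  | O => 1
  | S m' => 1 + (q ^ k + q ^ (2 * k)) / cf_tail q m' (S k)
  end.

(* n-th convergent of Ramanujan's cubic continued fraction: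
   q^(1/3) / (1 + (q+q^2)/(1 + ... + (q^n+q^(2n))/1)) *)
Definition cubic_cf_convergent (q : R) (n : nat) : R :=
  cbrt q / cf_tail q n 1.

(* Main.v *)
(* Write D = x d/dx and let v(s) be the theta quotient s f(-s^3,-s^15) / phi(-s^9), which is the
   value V(s^3) of the continued fraction: its tails satisfy a three-term recurrence solved by two
   q-series, and two Bailey pairs turn these series into theta series.
   Splitting phi and psi by residues mod 3 gives
     phi(-s) / phi(-s^9) = 1 - 2 v(s),   psi(s) / (s psi(s^9)) = 1 + 1 / v(s).
   On the other hand
     D log (phi(-s) / phi(-s^3)) = - 2 s psi(s)^2 psi(s^3)^2,
     D log (psi(s) / psi(s^3)) = (1 - phi(-s)^2 phi(-s^3)^2) / 4:
   the Wronskians are sums over m^2 + 3 n^2, and a rotation of order 3 of this lattice turns them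
   into products of two series sum (-1)^n (2n+1) q^(n(n+1)/2), i.e. of cubes of Euler products.
   Adding the formulas at s and at s^3 differentiates log (1 - 2 v) and log (1 + 1 / v), and the
   factorisations (1 - 2v)((1 + v)^2 + 3 v^2) = 1 - 8 v^3 and
   (1 + v)((1 - 2v)^2 + 3) = 4 (1 + v^3) turn the result into
     D log (1 - 8 V^3) = - 8 q psi(q)^2 psi(q^3)^2,   D log (1 + 1 / V^3) = - phi(-q)^2 phi(-q^3)^2.
   It remains to integrate, with V(0) = 0 and V(1-) = 1/2. *)

Require Import Defs.
From Stdlib Require Import Reals Lra Lia ZArith List Permutation.
From Stdlib Require Import Classical ClassicalEpsilon FunctionalExtensionality.
From Coquelicot Require Import Coquelicot.
Import ListNotations.
Open Scope R_scope.

(** * Unconditional sums *)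

(** Most identities below rearrange a series over Z or Z x Z, by shifts, reflections, residue
    classes, lattice rotations or exchanges of summation. Sums are therefore unordered, so that
    bijections of the index set act freely, and nearly all convergence questions reduce to one
    criterion: a weight of at most exponential growth times a Gaussian. No modular transformation is
    used. The triple product and its derivative at z = -1 are limits of finite identities; the
    q-series recurrences follow from certificates that telescope; the limit of V at 1, usually read
    off from theta inversion, comes from comparing Euler products factor by factor. The quadratic
    factors (1 + v)^2 + 3 v^2 and (1 - 2v)^2 + 3 have a simple origin. A logarithmic derivative at s
    brings in a theta value at s that the result does not contain; the other dissection rewrites it
    through v and the value at s^9, while the formula at s^3 supplies the remaining 3. Both
    dissections concern the same v because of a product identity between f(-q,-q^5) and f(q,q^2). *)

Definition lsum {T : Type} (f : T -> R) (s : list T) : R :=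
  fold_right (fun t acc => f t + acc) 0 s.

(** Net convergence over the finite subsets of [T], encoded as duplicate-free lists: no enumeration
    of [T] enters, so reindexing costs nothing. *)
Definition has_sum {T : Type} (f : T -> R) (l : R) : Prop :=
  forall eps : R, 0 < eps -> exists s : list T, NoDup s /\
    forall s' : list T, NoDup s' -> incl s s' -> Rabs (lsum f s' - l) < eps.

Definition summable {T : Type} (f : T -> R) : Prop :=
  exists M : R, forall s : list T, NoDup s -> lsum (fun t => Rabs (f t)) s <= M.

(** Choice gives every family a value, so that sums can be nested and rewritten freely; summability
    is only asked for where a rule needs it. *)
Definition tsum {T : Type} (f : T -> R) : R := epsilon (inhabits 0) (has_sum f).

Definition dec_eq {T : Type} (x y : T) : {x = y} + {x <> y} :=
  excluded_middle_informative (x = y).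

Lemma lsum_app {T} (f : T -> R) s s' : lsum f (s ++ s') = lsum f s + lsum f s'.
Proof. induction s as [|a s IH]; simpl; [lra | rewrite IH; lra]. Qed.

Lemma lsum_perm {T} (f : T -> R) s s' : Permutation s s' -> lsum f s = lsum f s'.
Proof. induction 1; simpl; lra. Qed.

Lemma lsum_map {T U} (f : T -> R) (g : U -> T) s :
  lsum f (map g s) = lsum (fun u => f (g u)) s.
Proof. induction s; simpl; [easy | now rewrite IHs]. Qed.

Lemma lsum_ext_in {T} (f g : T -> R) s :
  (forall t, In t s -> f t = g t) -> lsum f s = lsum g s.
Proof.
  induction s; intros H; simpl; [easy|].
  rewrite H by now left. rewrite IHs; [easy|]. intros; apply H; now right.
Qed.

Lemma lsum_plus {T} (f g : T -> R) s : lsum (fun t => f t + g t) s = lsum f s + lsum g s.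
Proof. induction s; simpl; [lra | rewrite IHs; lra]. Qed.

Lemma lsum_scal {T} (c : R) (f : T -> R) s : lsum (fun t => c * f t) s = c * lsum f s.
Proof. induction s; simpl; [lra | rewrite IHs; lra]. Qed.

Lemma lsum_le {T} (f g : T -> R) s : (forall t, In t s -> f t <= g t) -> lsum f s <= lsum g s.
Proof.
  induction s; intros H; simpl; [lra|].
  assert (f a <= g a) by (apply H; now left).
  assert (lsum f s <= lsum g s) by (apply IHs; intros; apply H; now right). lra.
Qed.

Lemma lsum_zero {T} (f : T -> R) s : (forall t, In t s -> f t = 0) -> lsum f s = 0.
Proof.
  induction s; intros H; simpl; [lra|].
  rewrite H by now left. rewrite IHs; [lra|]. intros; apply H; now right.
Qed.

Lemma lsum_pos {T} (f : T -> R) s : (forall t, 0 <= f t) -> 0 <= lsum f s.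
Proof. intros H; induction s; simpl; [lra|]. specialize (H a); lra. Qed.

Lemma lsum_abs {T} (f : T -> R) s : Rabs (lsum f s) <= lsum (fun t => Rabs (f t)) s.
Proof.
  induction s; simpl; [rewrite Rabs_R0; lra|].
  eapply Rle_trans; [apply Rabs_triang|lra].
Qed.

Lemma lsum_filter {T} (f : T -> R) (p : T -> bool) s :
  lsum f s = lsum f (filter p s) + lsum f (filter (fun t => negb (p t)) s).
Proof. induction s; simpl; [lra|]. destruct (p a); simpl; lra. Qed.

Lemma list_union {T} (s s' : list T) :
  exists u, NoDup u /\ incl s u /\ incl s' u.
Proof.
  exists (nodup dec_eq (s ++ s')). split; [apply NoDup_nodup|].
  split; intros x Hx; apply nodup_In; apply in_or_app; tauto.
Qed.

Lemma superlist_split {T} (s s' : list T) : NoDup s -> NoDup s' -> incl s s' ->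
  exists r, NoDup r /\ (forall t, In t r <-> In t s' /\ ~ In t s) /\ Permutation s' (s ++ r).
Proof.
  intros Ns Ns' Hi.
  set (r := filter (fun t => if in_dec dec_eq t s then false else true) s').
  assert (Hr : forall t, In t r <-> In t s' /\ ~ In t s).
  { intros t; unfold r; rewrite filter_In. destruct (in_dec dec_eq t s); intuition congruence. }
  assert (Nr : NoDup r) by now apply NoDup_filter.
  exists r. repeat split; try apply Hr; try assumption.
  apply NoDup_Permutation; [assumption| |].
  - apply NoDup_app; try assumption. intros a Ha Hb. apply Hr in Hb. tauto.
  - intros t. rewrite in_app_iff, Hr. destruct (in_dec dec_eq t s); intuition.
Qed.

Lemma lsum_incl_le {T} (f : T -> R) s s' : (forall t, 0 <= f t) ->
  NoDup s -> NoDup s' -> incl s s' -> lsum f s <= lsum f s'.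
Proof.
  intros Hf Ns Ns' Hi. destruct (superlist_split s s' Ns Ns' Hi) as (r & _ & _ & Hp).
  rewrite (lsum_perm f _ _ Hp), lsum_app. pose proof (lsum_pos f r Hf). lra.
Qed.

Lemma has_sum_unique {T} (f : T -> R) l l' : has_sum f l -> has_sum f l' -> l = l'.
Proof.
  intros H H'. apply Rminus_diag_uniq. apply NNPP; intros Hn.
  assert (He : 0 < Rabs (l - l') / 2) by (pose proof (Rabs_pos_lt _ Hn); lra).
  destruct (H _ He) as (s & _ & Hs). destruct (H' _ He) as (s' & _ & Hs').
  destruct (list_union s s') as (u & Nu & Hu & Hu').
  specialize (Hs u Nu Hu). specialize (Hs' u Nu Hu').
  assert (Rabs (l - l') <= Rabs (lsum f u - l) + Rabs (lsum f u - l')).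
  { replace (l - l') with ((lsum f u - l') + - (lsum f u - l)) by ring.
    eapply Rle_trans; [apply Rabs_triang|]. rewrite Rabs_Ropp; lra. }
  lra.
Qed.

Lemma tsum_eq {T} (f : T -> R) l : has_sum f l -> tsum f = l.
Proof.
  intros H. apply (has_sum_unique f); [|assumption].
  unfold tsum. apply epsilon_spec. now exists l.
Qed.

Lemma has_sum_ext {T} (f g : T -> R) l : (forall t, f t = g t) -> has_sum f l -> has_sum g l.
Proof. intros H. replace g with f; [easy|]. now apply functional_extensionality. Qed.

Lemma tsum_ext {T} (f g : T -> R) : (forall t, f t = g t) -> tsum f = tsum g.
Proof. intros H. f_equal. now apply functional_extensionality. Qed.

Lemma summable_ext {T} (f g : T -> R) : (forall t, f t = g t) -> summable f -> summable g.
Proof. intros H. replace g with f; [easy|]. now apply functional_extensionality. Qed.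

Lemma has_sum_plus {T} (f g : T -> R) a b :
  has_sum f a -> has_sum g b -> has_sum (fun t => f t + g t) (a + b).
Proof.
  intros Hf Hg eps He.
  destruct (Hf (eps / 2) ltac:(lra)) as (s & _ & Hs).
  destruct (Hg (eps / 2) ltac:(lra)) as (s' & _ & Hs').
  destruct (list_union s s') as (u & Nu & Hu & Hu').
  exists u; split; [easy|]. intros v Nv Hv.
  assert (incl s v) by (eapply incl_tran; eassumption).
  assert (incl s' v) by (eapply incl_tran; eassumption).
  specialize (Hs v Nv H). specialize (Hs' v Nv H0).
  rewrite lsum_plus.
  replace (lsum f v + lsum g v - (a + b)) with ((lsum f v - a) + (lsum g v - b)) by ring.
  eapply Rle_lt_trans; [apply Rabs_triang|]. lra.
Qed.

Lemma has_sum_scal {T} (c : R) (f : T -> R) a :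
  has_sum f a -> has_sum (fun t => c * f t) (c * a).
Proof.
  intros Hf eps He.
  assert (Hc : 0 < Rabs c + 1) by (pose proof (Rabs_pos c); lra).
  destruct (Hf (eps / (Rabs c + 1))) as (s & Ns & Hs); [now apply Rdiv_lt_0_compat|].
  exists s; split; [easy|]. intros v Nv Hv. specialize (Hs v Nv Hv).
  rewrite lsum_scal, <- Rmult_minus_distr_l, Rabs_mult.
  apply Rle_lt_trans with ((Rabs c) * (eps / (Rabs c + 1))).
  - apply Rmult_le_compat_l; [apply Rabs_pos | lra].
  - apply Rmult_lt_reg_r with (Rabs c + 1); [easy|].
    field_simplify; [|lra]. pose proof (Rabs_pos c). nra.
Qed.

Lemma has_sum_nonneg {T} (f : T -> R) M : (forall t, 0 <= f t) ->
  (forall s, NoDup s -> lsum f s <= M) -> exists l, has_sum f l.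
Proof.
  intros Hf HM.
  destruct (completeness (fun x => exists s, NoDup s /\ x = lsum f s)) as [l [Hu Hl]].
  - exists M. intros x (s & Ns & ->). now apply HM.
  - exists 0. exists nil. split; [constructor | easy].
  - exists l. intros eps He.
    assert (Hex : exists s, NoDup s /\ l - eps < lsum f s).
    { apply NNPP; intros Hn.
      assert (l <= l - eps); [|lra]. apply Hl. intros x (s & Ns & ->).
      apply Rnot_lt_le. intros Hlt. apply Hn. now exists s. }
    destruct Hex as (s & Ns & Hs). exists s; split; [easy|]. intros v Nv Hv.
    assert (lsum f s <= lsum f v) by now apply lsum_incl_le.
    assert (lsum f v <= l) by (apply Hu; now exists v).
    apply Rabs_def1; lra.
Qed.

Lemma summable_dom {T} (f b : T -> R) : (forall t, Rabs (f t) <= b t) -> summable b -> summable f.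
Proof.
  intros H (M & HM). exists M. intros s Ns. eapply Rle_trans; [|exact (HM s Ns)].
  apply lsum_le. intros t _. eapply Rle_trans; [apply H|]. apply Rle_abs.
Qed.

Lemma summable_has_sum {T} (f : T -> R) : summable f -> has_sum f (tsum f).
Proof.
  intros (M & HM). unfold tsum. apply epsilon_spec.
  (* Reduction to nonnegative families, where a supremum gives the sum: [f] is the difference of |f|
     + f and |f|. *)
  destruct (has_sum_nonneg (fun t => Rabs (f t) + f t) (2 * M)) as [a Ha].
  - intros t. pose proof (Rabs_maj2 (f t)). lra.
  - intros s Ns. specialize (HM s Ns). rewrite lsum_plus.
    pose proof (lsum_abs f s). pose proof (Rle_abs (lsum f s)). lra.
  - destruct (has_sum_nonneg (fun t => Rabs (f t)) M) as [b Hb].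
    + intros t; apply Rabs_pos.
    + easy.
    + exists (a + -1 * b). eapply has_sum_ext.
      2: apply has_sum_plus; [apply Ha | apply has_sum_scal, Hb].
      intros t; simpl; ring.
Qed.

Lemma summable_plus {T} (f g : T -> R) : summable f -> summable g -> summable (fun t => f t + g t).
Proof.
  intros (M & HM) (M' & HM'). exists (M + M'). intros s Ns.
  specialize (HM s Ns). specialize (HM' s Ns).
  eapply Rle_trans; [|apply Rplus_le_compat; eassumption].
  rewrite <- lsum_plus. apply lsum_le. intros; apply Rabs_triang.
Qed.

Lemma summable_scal {T} (c : R) (f : T -> R) : summable f -> summable (fun t => c * f t).
Proof.
  intros (M & HM). exists (Rabs c * M). intros s Ns. specialize (HM s Ns).
  rewrite (lsum_ext_in _ (fun t => Rabs c * Rabs (f t))) by (intros; apply Rabs_mult).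
  rewrite lsum_scal. apply Rmult_le_compat_l; [apply Rabs_pos | easy].
Qed.

Lemma tsum_plus {T} (f g : T -> R) : summable f -> summable g ->
  tsum (fun t => f t + g t) = tsum f + tsum g.
Proof. intros; apply tsum_eq, has_sum_plus; now apply summable_has_sum. Qed.

Lemma tsum_scal {T} (c : R) (f : T -> R) : summable f -> tsum (fun t => c * f t) = c * tsum f.
Proof. intros; apply tsum_eq, has_sum_scal; now apply summable_has_sum. Qed.

Lemma list_preimage {T U} (g : U -> T) (s : list T) : (forall u v, g u = g v -> u = v) ->
  NoDup s -> (forall t, In t s -> exists u, g u = t) -> exists s', NoDup s' /\ map g s' = s.
Proof.
  intros Hg. induction s as [|a s IH]; intros Ns H.
  - exists nil; split; [constructor | easy].
  - inversion Ns; subst. destruct IH as (s' & Ns' & E); [easy | intros; apply H; now right|].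
    destruct (H a) as [u Hu]; [now left|]. exists (u :: s'). split.
    + constructor; [|easy]. intros Hi. apply (in_map g) in Hi. rewrite E, Hu in Hi. easy.
    + simpl; now rewrite E, Hu.
Qed.

Lemma NoDup_map_inj {T U} (g : U -> T) s : (forall u v, g u = g v -> u = v) ->
  NoDup s -> NoDup (map g s).
Proof. intros Hg Ns. apply FinFun.Injective_map_NoDup; [exact Hg | easy]. Qed.

Lemma summable_comp {T U} (g : U -> T) (f : T -> R) : (forall u v, g u = g v -> u = v) ->
  summable f -> summable (fun u => f (g u)).
Proof.
  intros Hg (M & HM). exists M. intros s Ns.
  rewrite <- (lsum_map (fun t => Rabs (f t))). now apply HM, NoDup_map_inj.
Qed.

Definition inimg {T U} (g : U -> T) (t : T) : bool :=
  if excluded_middle_informative (exists u, g u = t) then true else false.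

Lemma inimg_true {T U} (g : U -> T) t : inimg g t = true <-> exists u, g u = t.
Proof. unfold inimg. destruct (excluded_middle_informative _); intuition congruence. Qed.

Lemma list_img {T U} (g : U -> T) (s : list T) : (forall u v, g u = g v -> u = v) ->
  NoDup s -> exists s', NoDup s' /\ map g s' = filter (inimg g) s.
Proof.
  intros Hg Ns. apply list_preimage; [easy | now apply NoDup_filter|].
  intros t Ht. apply filter_In in Ht. now apply inimg_true.
Qed.

Lemma lsum_img {T U} (g : U -> T) (f : T -> R) s :
  (forall t, f t <> 0 -> exists u, g u = t) -> lsum f s = lsum f (filter (inimg g) s).
Proof.
  intros Hs. rewrite (lsum_filter f (inimg g)).
  rewrite (lsum_zero f (filter (fun t => negb (inimg g t)) s)); [lra|].
  intros t Ht. apply filter_In in Ht. destruct Ht as [_ Ht].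
  apply NNPP; intros Hn. apply Hs in Hn. apply inimg_true in Hn. now rewrite Hn in Ht.
Qed.

Lemma summable_supp {T U} (g : U -> T) (f : T -> R) : (forall u v, g u = g v -> u = v) ->
  (forall t, f t <> 0 -> exists u, g u = t) -> summable (fun u => f (g u)) -> summable f.
Proof.
  intros Hg Hs (M & HM). exists M. intros s Ns.
  rewrite (lsum_img g). 2: { intros t Ht; apply Hs. intros E; apply Ht. rewrite E; apply Rabs_R0. }
  destruct (list_img g s Hg Ns) as (s' & Ns' & <-). rewrite lsum_map. now apply HM.
Qed.

Lemma has_sum_supp {T U} (g : U -> T) (f : T -> R) l : (forall u v, g u = g v -> u = v) ->
  (forall t, f t <> 0 -> exists u, g u = t) -> has_sum (fun u => f (g u)) l -> has_sum f l.
Proof.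
  intros Hg Hs H eps He. destruct (H eps He) as (s & Ns & Hsum).
  exists (map g s). split; [now apply NoDup_map_inj|]. intros v Nv Hv.
  rewrite (lsum_img g f v Hs). destruct (list_img g v Hg Nv) as (s' & Ns' & E).
  rewrite <- E, lsum_map. apply Hsum; [easy|]. intros u Hu.
  assert (Hi : In (g u) (map g s')).
  { rewrite E. apply filter_In. split; [apply Hv; now apply in_map|]. apply inimg_true; now exists u. }
  apply in_map_iff in Hi. destruct Hi as (u' & Eu & Hu'). apply Hg in Eu. now subst.
Qed.

Lemma tsum_supp {T U} (g : U -> T) (f : T -> R) : (forall u v, g u = g v -> u = v) ->
  (forall t, f t <> 0 -> exists u, g u = t) -> summable f -> tsum f = tsum (fun u => f (g u)).
Proof.
  intros Hg Hs H. apply tsum_eq. apply (has_sum_supp g); try easy.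
  now apply summable_has_sum, (summable_comp g).
Qed.

Lemma tsum_bij {T U} (g : U -> T) (g' : T -> U) (f : T -> R) :
  (forall u, g' (g u) = u) -> (forall t, g (g' t) = t) ->
  summable f -> tsum f = tsum (fun u => f (g u)).
Proof.
  intros H1 H2 H. apply tsum_supp; try easy.
  - intros u v E. now rewrite <- (H1 u), <- (H1 v), E.
  - intros t _. exists (g' t). apply H2.
Qed.

Lemma tail_small {T} (b : T -> R) eps : summable b -> 0 < eps ->
  exists s, NoDup s /\ forall r, NoDup r -> (forall t, In t r -> ~ In t s) ->
    lsum (fun t => Rabs (b t)) r <= eps.
Proof.
  intros Hb He.
  destruct Hb as (M & HM).
  destruct (has_sum_nonneg (fun t => Rabs (b t)) M) as [l Hl]; [intros; apply Rabs_pos|easy|].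
  destruct (Hl (eps / 2) ltac:(lra)) as (s & Ns & Hs). exists s; split; [easy|].
  intros r Nr Hr.
  assert (N : NoDup (s ++ r)).
  { apply NoDup_app; try easy. intros a Ha Hb. now apply (Hr a). }
  pose proof (Hs _ Ns (incl_refl s)) as H1.
  pose proof (Hs _ N (incl_appl _ (incl_refl s))) as H2.
  rewrite lsum_app in H2. apply Rabs_def2 in H1. apply Rabs_def2 in H2. lra.
Qed.

Lemma tsum_tail_le {T} (f b : T -> R) s eps : NoDup s -> (forall t, Rabs (f t) <= b t) ->
  summable b ->
  (forall r, NoDup r -> (forall t, In t r -> ~ In t s) -> lsum (fun t => Rabs (b t)) r <= eps) ->
  Rabs (tsum f - lsum f s) <= eps.
Proof.
  intros Ns Hf Hb Hr. apply Rnot_lt_le. intros Hlt.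
  pose proof (summable_has_sum f (summable_dom f b Hf Hb)) as HS.
  destruct (HS (Rabs (tsum f - lsum f s) - eps) ltac:(lra)) as (u & Nu & Hu).
  destruct (list_union u s) as (v & Nv & Iu & Is).
  specialize (Hu v Nv Iu).
  destruct (superlist_split s v Ns Nv Is) as (r & Nr & Ir & Hp).
  rewrite (lsum_perm f _ _ Hp), lsum_app in Hu.
  assert (lsum (fun t => Rabs (b t)) r <= eps) by (apply Hr; [easy | intros t Ht; now apply Ir]).
  assert (Rabs (lsum f r) <= eps).
  { eapply Rle_trans; [apply lsum_abs|]. eapply Rle_trans; [|eassumption].
    apply lsum_le. intros t _. eapply Rle_trans; [apply Hf | apply Rle_abs]. }
  assert (Rabs (tsum f - lsum f s) <= Rabs (lsum f r) + Rabs (lsum f s + lsum f r - tsum f)).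
  { replace (tsum f - lsum f s) with (lsum f r + - (lsum f s + lsum f r - tsum f)) by ring.
    eapply Rle_trans; [apply Rabs_triang|]. rewrite Rabs_Ropp; lra. }
  lra.
Qed.

Lemma tsum_ge_term {T} (f : T -> R) t : (forall t, 0 <= f t) -> summable f -> f t <= tsum f.
Proof.
  intros Hf H. apply Rnot_lt_le. intros Hlt.
  destruct (summable_has_sum f H (f t - tsum f) ltac:(lra)) as (s & Ns & Hs).
  destruct (list_union s [t]) as (u & Nu & Iu & It). specialize (Hs u Nu Iu).
  assert (f t <= lsum f u).
  { replace (f t) with (lsum f [t]) by (simpl; lra).
    apply lsum_incl_le; try easy. constructor; [easy | constructor]. }
  apply Rabs_def2 in Hs. lra.
Qed.

Lemma lsum_prod {T U} (f : T -> R) (g : U -> R) s s' :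
  lsum (fun x => f (fst x) * g (snd x)) (list_prod s s') = lsum f s * lsum g s'.
Proof.
  induction s; simpl; [lra|]. rewrite lsum_app, IHs, lsum_map. simpl.
  rewrite lsum_scal. lra.
Qed.

Lemma NoDup_prod {T U} (s : list T) (s' : list U) :
  NoDup s -> NoDup s' -> NoDup (list_prod s s').
Proof.
  intros Ns Ns'. induction Ns as [|a s Ha Ns IH]; simpl; [constructor|].
  apply NoDup_app; [|easy|].
  - apply NoDup_map_inj; [|easy]. intros u v E; now injection E.
  - intros [x y] Hx Hy. apply in_map_iff in Hx. destruct Hx as (u & E & _).
    injection E; intros; subst. apply in_prod_iff in Hy. tauto.
Qed.

Lemma summable_prod {T U} (f : T -> R) (g : U -> R) : summable f -> summable g ->
  summable (fun x : T * U => f (fst x) * g (snd x)).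
Proof.
  intros (M & HM) (M' & HM'). exists (M * M'). intros s Ns.
  set (s1 := nodup dec_eq (map fst s)). set (s2 := nodup dec_eq (map snd s)).
  assert (N1 : NoDup s1) by apply NoDup_nodup. assert (N2 : NoDup s2) by apply NoDup_nodup.
  apply Rle_trans with (lsum (fun x : T * U => Rabs (f (fst x)) * Rabs (g (snd x))) (list_prod s1 s2)).
  - rewrite (lsum_ext_in _ (fun x : T * U => Rabs (f (fst x)) * Rabs (g (snd x))))
      by (intros; apply Rabs_mult).
    apply lsum_incl_le; try easy.
    + intros t; apply Rmult_le_pos; apply Rabs_pos.
    + now apply NoDup_prod.
    + intros [x y] H. apply in_prod; apply nodup_In.
      * now apply (in_map fst) in H.
      * now apply (in_map snd) in H.
  - rewrite (lsum_prod (fun t => Rabs (f t)) (fun t => Rabs (g t))).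
    apply Rmult_le_compat; try (apply lsum_pos; intros; apply Rabs_pos); auto.
Qed.

Lemma has_sum_sigma {T U} (F : T * U -> R) (g : T -> R) L :
  has_sum F L -> (forall t, has_sum (fun u => F (t, u)) (g t)) -> has_sum g L.
Proof.
  intros HF Hg eps He. destruct (HF (eps / 2) ltac:(lra)) as (A & NA & HA).
  exists (nodup dec_eq (map fst A)). split; [apply NoDup_nodup|]. intros B NB HB.
  (* approximate each fibre sum over [B] within [d] by a finite sum containing the fibre of [A] *)
  assert (Hlist : forall d, 0 < d -> forall B', NoDup B' -> exists V : list (T * U), NoDup V /\
    (forall x, In x V -> In (fst x) B') /\
    (forall x, In x A -> In (fst x) B' -> In x V) /\
    Rabs (lsum F V - lsum g B') <= INR (length B') * d).
  { intros d Hd. induction B' as [|t B' IH]; intros NB'.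
    - exists nil. repeat split; [constructor|easy|easy|]. simpl. rewrite Rminus_0_r, Rabs_R0. lra.
    - inversion NB'; subst. destruct IH as (V & NV & V1 & V2 & V3); [easy|].
      destruct (Hg t d Hd) as (s & Ns & Hs).
      destruct (list_union s (map snd A)) as (w & Nw & Iw & Iw').
      specialize (Hs w Nw Iw).
      exists (map (fun u => (t, u)) w ++ V). repeat split.
      + apply NoDup_app; [|easy|].
        * apply NoDup_map_inj; [|easy]. intros u v E. now injection E.
        * intros x Hx Hx'. apply in_map_iff in Hx. destruct Hx as (u & <- & _).
          now apply V1 in Hx'.
      + intros x Hx. apply in_app_or in Hx. destruct Hx as [Hx|Hx].
        * apply in_map_iff in Hx. destruct Hx as (u & <- & _). now left.
        * right; now apply V1.
      + intros [x y] Hx Hx'. apply in_or_app. destruct Hx' as [E|Hx'].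
        * left. simpl in E; subst. apply in_map. apply Iw'. now apply (in_map snd) in Hx.
        * right; now apply V2.
      + rewrite lsum_app, lsum_map. cbn [length lsum fold_right].
        change (fold_right (fun t0 acc => g t0 + acc) 0 B') with (lsum g B').
        rewrite S_INR.
        replace (lsum (fun u => F (t, u)) w + lsum F V - (g t + lsum g B')) with
          ((lsum (fun u => F (t, u)) w - g t) + (lsum F V - lsum g B')) by ring.
        eapply Rle_trans; [apply Rabs_triang|]. lra. }
  assert (HB0 : 0 < INR (length B) + 1) by (pose proof (pos_INR (length B)); lra).
  set (d := eps / 4 / (INR (length B) + 1)).
  assert (Hd : 0 < d) by (apply Rdiv_lt_0_compat; lra).
  destruct (Hlist d Hd B NB) as (V & NV & _ & V2 & V3).
  assert (HV : Rabs (lsum F V - L) < eps / 2).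
  { apply HA; [easy|]. intros x Hx. apply V2; [easy|]. apply HB. apply nodup_In.
    now apply in_map. }
  assert (Hle : INR (length B) * d <= eps / 4).
  { replace (eps / 4) with ((INR (length B) + 1) * d) by (unfold d; field; lra). nra. }
  replace (lsum g B - L) with (- (lsum F V - lsum g B) + (lsum F V - L)) by ring.
  eapply Rle_lt_trans; [apply Rabs_triang|]. rewrite Rabs_Ropp. lra.
Qed.

Lemma summable_fibre {T U} (F : T * U -> R) t : summable F -> summable (fun u => F (t, u)).
Proof. intros H. apply (summable_comp (fun u => (t, u)) F); [|easy]. intros u v E; now injection E. Qed.

Lemma tsum_fubini {T U} (F : T * U -> R) : summable F ->
  tsum (fun t => tsum (fun u => F (t, u))) = tsum F.
Proof.
  intros H. apply tsum_eq. apply (has_sum_sigma F); [now apply summable_has_sum|].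
  intros t. now apply summable_has_sum, summable_fibre.
Qed.

Lemma tsum_swap {T U} (F : T -> U -> R) : summable (fun x => F (fst x) (snd x)) ->
  tsum (fun t => tsum (fun u => F t u)) = tsum (fun u => tsum (fun t => F t u)).
Proof.
  intros H. transitivity (tsum (fun x => F (fst x) (snd x))).
  { exact (tsum_fubini (fun x => F (fst x) (snd x)) H). }
  rewrite (tsum_bij (fun x : U * T => (snd x, fst x)) (fun x => (snd x, fst x)));
    try (intros [? ?]; easy); try easy.
  symmetry. apply (tsum_fubini (fun x : U * T => F (snd x) (fst x))).
  apply (summable_comp (fun x : U * T => (snd x, fst x)) (fun x => F (fst x) (snd x))); [|easy].
  intros [? ?] [? ?] E; injection E; intros; now subst.
Qed.

Lemma tsum_prod {T U} (f : T -> R) (g : U -> R) : summable f -> summable g ->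
  tsum (fun x : T * U => f (fst x) * g (snd x)) = tsum f * tsum g.
Proof.
  intros Hf Hg. rewrite <- tsum_fubini by now apply summable_prod. simpl.
  rewrite (tsum_ext _ (fun t => tsum g * f t)).
  - rewrite tsum_scal by easy. ring.
  - intros t. rewrite tsum_scal by easy. ring.
Qed.

(** Dominated convergence for series along an arbitrary proper filter. The generality is used: n
    tends to infinity in the triple product, h tends to 0 in difference quotients, and x tends to t
    in the continuity of [rpsi]. *)
Lemma tannery {T A : Type} (F : (A -> Prop) -> Prop) {FF : ProperFilter F}
  (f : A -> T -> R) (g b : T -> R) : summable b ->
  F (fun a => forall t, Rabs (f a t) <= b t) ->
  (forall t, filterlim (fun a => f a t) F (locally (g t))) ->
  filterlim (fun a => tsum (f a)) F (locally (tsum g)).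
Proof.
  intros Hb Hdom Hlim.
  assert (Hfin : forall s, filterlim (fun a => lsum (f a) s) F (locally (lsum g s))).
  { induction s; simpl; [apply filterlim_const|].
    apply (filterlim_comp_2 (G := locally (g a)) (H := locally (lsum g s))); [apply Hlim | apply IHs|].
    apply (filterlim_plus (K := R_AbsRing) (V := R_NormedModule)). }
  (* The majorant passes to the limit: otherwise some [f a t] that obeys the bound would lie too
     close to [g t]. *)
  assert (Hg : forall t, Rabs (g t) <= b t).
  { intros t. apply Rnot_lt_le. intros Hlt.
    assert (Hb0 : F (fun a => ball (g t) (Rabs (g t) - b t) (f a t))).
    { apply Hlim. assert (He : 0 < Rabs (g t) - b t) by lra. now exists (mkposreal _ He). }
    destruct (filter_ex _ (filter_and _ _ Hdom Hb0)) as (a & H1 & H2).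
    specialize (H1 t). unfold ball in H2; simpl in H2; unfold AbsRing_ball, abs, minus, plus, opp in H2;
    simpl in H2.
    change (Rabs (f a t - g t) < Rabs (g t) - b t) in H2.
    pose proof (Rabs_triang_inv (g t) (f a t)). rewrite Rabs_minus_sym in H2. lra. }
  intros P [eps HP].
  destruct (tail_small b (eps / 4) Hb) as (s & Ns & Hs); [destruct eps; simpl; lra|].
  assert (Hc : F (fun a => ball (lsum g s) (eps / 4) (lsum (f a) s))).
  { apply Hfin. assert (He : 0 < eps / 4) by (destruct eps; simpl; lra). now exists (mkposreal _ He). }
  unfold filtermap.
  apply (filter_imp (fun a => (forall t, Rabs (f a t) <= b t) /\
    ball (lsum g s) (eps / 4) (lsum (f a) s))); [|now apply filter_and].
  intros a [H1 H2]. apply HP.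
  unfold ball in *; simpl in *; unfold AbsRing_ball, abs, minus, plus, opp in *; simpl in *.
  pose proof (tsum_tail_le (f a) b s (eps / 4) Ns H1 Hb Hs) as E1.
  pose proof (tsum_tail_le g b s (eps / 4) Ns Hg Hb Hs) as E2.
  replace (tsum (f a) + - tsum g) with
    ((tsum (f a) - lsum (f a) s) + ((lsum (f a) s + - lsum g s) + - (tsum g - lsum g s))) by ring.
  eapply Rle_lt_trans; [apply Rabs_triang|].
  assert (Rabs (lsum (f a) s + - lsum g s + - (tsum g - lsum g s)) <=
    Rabs (lsum (f a) s + - lsum g s) + Rabs (tsum g - lsum g s)).
  { eapply Rle_trans; [apply Rabs_triang|]. rewrite Rabs_Ropp. lra. }
  destruct eps as [e He]; simpl in *. lra.
Qed.

Lemma lsum_seq (f : nat -> R) n : lsum f (seq 0 (S n)) = sum_n f n.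
Proof.
  induction n.
  - simpl. rewrite sum_O. lra.
  - rewrite seq_S, lsum_app, IHn, sum_Sn. simpl. unfold plus; simpl. lra.
Qed.

Lemma has_sum_is_series (f : nat -> R) l : has_sum f l -> is_series f l.
Proof.
  intros H. apply filterlim_locally. intros eps.
  destruct (H eps (cond_pos eps)) as (s & _ & Hs).
  exists (list_max s). intros n Hn.
  unfold ball; simpl; unfold AbsRing_ball, abs, minus, plus, opp; simpl.
  rewrite <- lsum_seq. apply Hs; [apply seq_NoDup|].
  intros x Hx. apply in_seq.
  assert (x <= list_max s)%nat; [|lia].
  pose proof (proj1 (list_max_le s (list_max s)) (le_n _)) as HF.
  rewrite Forall_forall in HF. now apply HF.
Qed.

Lemma tsum_Series (f : nat -> R) : summable f -> tsum f = Series f.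
Proof. intros H. symmetry. apply is_series_unique, has_sum_is_series. now apply summable_has_sum. Qed.

Lemma summable_ex_series (f : nat -> R) : ex_series (fun n => Rabs (f n)) -> summable f.
Proof.
  intros H. exists (Series (fun n => Rabs (f n))). intros s Ns.
  apply Rle_trans with (lsum (fun n => Rabs (f n)) (seq 0 (S (list_max s)))).
  - apply lsum_incl_le; [intros; apply Rabs_pos | easy | apply seq_NoDup|].
    intros x Hx. apply in_seq.
    pose proof (proj1 (list_max_le s (list_max s)) (le_n _)) as HF.
    rewrite Forall_forall in HF. specialize (HF x Hx). lia.
  - rewrite lsum_seq. apply Series_correct in H.
    apply (is_lim_seq_incr_compare (sum_n (fun n => Rabs (f n)))); [exact H|].
    intros n. rewrite sum_Sn. unfold plus; simpl. pose proof (Rabs_pos (f (S n))). lra.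
Qed.

Lemma tsum_single {T} (f : T -> R) t0 : (forall t, t <> t0 -> f t = 0) -> tsum f = f t0.
Proof.
  intros H. apply tsum_eq. intros eps He.
  assert (N0 : NoDup [t0]) by (constructor; [easy | constructor]).
  exists [t0]. split; [easy|]. intros s Ns Hs.
  destruct (superlist_split [t0] s N0 Ns Hs) as (u & _ & Hu & Hp).
  rewrite (lsum_perm _ _ _ Hp), lsum_app, (lsum_zero f u).
  - simpl. replace (f t0 + 0 + 0 - f t0) with 0 by ring. now rewrite Rabs_R0.
  - intros t Ht. apply H. intros ->. apply Hu in Ht. destruct Ht as [_ Ht]. apply Ht; now left.
Qed.

Definition restrict {T} (p : T -> bool) (f : T -> R) (t : T) : R := if p t then f t else 0.

Lemma summable_restrict {T} (p : T -> bool) (f : T -> R) : summable f -> summable (restrict p f).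
Proof.
  intros (M & HM). exists M. intros s Ns. eapply Rle_trans; [|exact (HM s Ns)].
  apply lsum_le. intros t _. unfold restrict. destruct (p t); [lra|].
  rewrite Rabs_R0. apply Rabs_pos.
Qed.

Lemma tsum_restrict {T} (p : T -> bool) (f : T -> R) : summable f ->
  tsum f = tsum (restrict p f) + tsum (restrict (fun t => negb (p t)) f).
Proof.
  intros H. rewrite <- tsum_plus by now apply summable_restrict. apply tsum_ext.
  intros t. unfold restrict. destruct (p t); simpl; ring.
Qed.

Lemma tsum_restrict_param {T U} (p : T -> bool) (g : U -> T) (f : T -> R) :
  (forall u v, g u = g v -> u = v) -> (forall u, p (g u) = true) ->
  (forall t, p t = true -> exists u, g u = t) -> summable f ->
  tsum (restrict p f) = tsum (fun u => f (g u)).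
Proof.
  intros Hg H1 H2 H. rewrite (tsum_supp g); [|easy| |now apply summable_restrict].
  - apply tsum_ext. intros u. unfold restrict. now rewrite H1.
  - intros t Ht. apply H2. unfold restrict in Ht. now destruct (p t).
Qed.

(** * Sums over the integers and Euler products *)

Notation "x ^^ n" := (powerRZ x n%Z) (at level 29, n at level 28).

Lemma summable_Z (f : Z -> R) :
  summable (fun n : nat => f (Z.of_nat n)) ->
  summable (fun n : nat => f (-1 - Z.of_nat n)%Z) -> summable f.
Proof.
  intros Ha Hb.
  apply summable_ext with (fun n => restrict (Z.leb 0) f n + restrict (fun t => negb (0 <=? t)%Z) f n).
  { intros n. unfold restrict. destruct (0 <=? n)%Z; simpl; lra. }
  apply summable_plus.
  - apply (summable_supp Z.of_nat); [intros; lia | |].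
    + unfold restrict. intros t Ht. destruct (Z.leb_spec 0 t); [exists (Z.to_nat t); lia | easy].
    + eapply summable_ext; [|exact Ha]. intros n. unfold restrict.
      destruct (Z.leb_spec 0 (Z.of_nat n)); [easy | lia].
  - apply (summable_supp (fun n => (-1 - Z.of_nat n)%Z)); [intros; lia | |].
    + unfold restrict. intros t Ht. destruct (Z.leb_spec 0 t); [easy | exists (Z.to_nat (-1 - t)); lia].
    + eapply summable_ext; [|exact Hb]. intros n. unfold restrict.
      destruct (Z.leb_spec 0 (-1 - Z.of_nat n)); [lia | easy].
Qed.

Lemma tsum_Z (f : Z -> R) : summable f ->
  tsum f = tsum (fun n : nat => f (Z.of_nat n)) + tsum (fun n : nat => f (-1 - Z.of_nat n)%Z).
Proof.
  intros H. rewrite (tsum_restrict (Z.leb 0) f H). f_equal.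
  - apply tsum_restrict_param; try easy; [intros; lia | intros; apply Z.leb_le; lia|].
    intros t Ht. apply Z.leb_le in Ht. exists (Z.to_nat t). lia.
  - apply (tsum_restrict_param (fun t => negb (0 <=? t)%Z)); try easy; [intros; lia | |].
    + intros u. destruct (Z.leb_spec 0 (-1 - Z.of_nat u)); [lia | easy].
    + intros t Ht. destruct (Z.leb_spec 0 t); [easy | exists (Z.to_nat (-1 - t)); lia].
Qed.

Lemma tsum_Z_shift (f : Z -> R) k : summable f -> tsum (fun n => f (n + k)%Z) = tsum f.
Proof.
  intros H. symmetry. apply (tsum_bij (fun n => n + k)%Z (fun n => n - k)%Z); try easy; intros; lia.
Qed.

Lemma summable_Z_shift (f : Z -> R) k : summable f -> summable (fun n => f (n + k)%Z).
Proof. intros H. apply (summable_comp (fun n => n + k)%Z); [intros; lia | easy]. Qed.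

Lemma tsum_Z_reflect (f : Z -> R) k : summable f -> tsum (fun n => f (k - n)%Z) = tsum f.
Proof.
  intros H. symmetry. apply (tsum_bij (fun n => k - n)%Z (fun n => k - n)%Z); try easy; intros; lia.
Qed.

Lemma summable_Z_reflect (f : Z -> R) k : summable f -> summable (fun n => f (k - n)%Z).
Proof. intros H. apply (summable_comp (fun n => k - n)%Z); [intros; lia | easy]. Qed.

Lemma tsum_minus {T} (f g : T -> R) : summable f -> summable g ->
  tsum (fun t => f t - g t) = tsum f - tsum g.
Proof.
  intros Hf Hg. rewrite (tsum_ext _ (fun t => f t + -1 * g t)) by (intros; ring).
  rewrite tsum_plus, tsum_scal; try easy; [ring | now apply summable_scal].
Qed.

Lemma summable_minus {T} (f g : T -> R) : summable f -> summable g ->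
  summable (fun t => f t - g t).
Proof.
  intros Hf Hg. apply summable_ext with (fun t => f t + -1 * g t); [intros; ring|].
  apply summable_plus; [easy | now apply summable_scal].
Qed.

(** A sum over Z is invariant under shifts, so a telescoping sum has no boundary terms. The Bailey
    recurrences below are proved by exhibiting a suitable [R0]. *)
Lemma tsum_telescope (f R0 : Z -> R) : summable R0 ->
  (forall n, f n = R0 (n + 1)%Z - R0 n) -> tsum f = 0.
Proof.
  intros H E. rewrite (tsum_ext _ _ E), tsum_minus; [|now apply summable_Z_shift|easy].
  rewrite tsum_Z_shift by easy. ring.
Qed.

(* At most exponential growth with respect to a size function [w]. *)
Definition expb {T : Type} (w : T -> nat) (f : T -> R) : Prop :=
  exists M, 1 <= M /\ forall t, Rabs (f t) <= M ^ S (w t).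

Lemma expb_const {T} (w : T -> nat) c : expb w (fun _ => c).
Proof.
  exists (1 + Rabs c). pose proof (Rabs_pos c). split; [lra|]. intros t.
  apply Rle_trans with ((1 + Rabs c) ^ 1); [simpl; lra|]. apply Rle_pow; [lra | lia].
Qed.

Lemma expb_mult {T} (w : T -> nat) f g : expb w f -> expb w g -> expb w (fun t => f t * g t).
Proof.
  intros (M & HM & Hf) (M' & HM' & Hg). exists (M * M'). split; [nra|]. intros t.
  rewrite Rabs_mult, Rpow_mult_distr. apply Rmult_le_compat; auto using Rabs_pos.
Qed.

Lemma expb_plus {T} (w : T -> nat) f g : expb w f -> expb w g -> expb w (fun t => f t + g t).
Proof.
  intros (M & HM & Hf) (M' & HM' & Hg). exists (M + M'). split; [lra|]. intros t.
  eapply Rle_trans; [apply Rabs_triang|].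
  eapply Rle_trans; [apply Rplus_le_compat; auto|].
  generalize (w t). intros n. induction n; [simpl; lra|].
  rewrite <- !(tech_pow_Rmult _ (S n)).
  assert (0 <= M ^ S n) by (apply pow_le; lra). assert (0 <= M' ^ S n) by (apply pow_le; lra). nra.
Qed.

Lemma expb_ext {T} (w : T -> nat) f g : (forall t, f t = g t) -> expb w f -> expb w g.
Proof. intros H. replace g with f; [easy|]. now apply functional_extensionality. Qed.

Lemma expb_minus {T} (w : T -> nat) f g : expb w f -> expb w g -> expb w (fun t => f t - g t).
Proof.
  intros Hf Hg. apply expb_ext with (fun t => f t + -1 * g t); [intros; ring|].
  apply expb_plus; [easy|]. apply expb_mult; [apply expb_const | easy].
Qed.

Lemma expb_bounded {T} (w : T -> nat) f C : (forall t, Rabs (f t) <= C) -> expb w f.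
Proof.
  intros H. destruct (expb_const w (Rabs C)) as (M & HM & HC). exists M. split; [easy|].
  intros t. specialize (H t). specialize (HC t). rewrite Rabs_Rabsolu in HC.
  pose proof (Rle_abs C). lra.
Qed.

Lemma expb_comp {T U} (w : T -> nat) (w' : U -> nat) (h : U -> T) f (c : nat) :
  (forall u, (w (h u) <= c * S (w' u))%nat) -> expb w f -> expb w' (fun u => f (h u)).
Proof.
  intros Hc (M & HM & Hf). exists (M ^ S c). split; [now apply pow_R1_Rle|].
  intros u. eapply Rle_trans; [apply Hf|]. rewrite <- pow_mult.
  apply Rle_pow; [easy|]. specialize (Hc u). lia.
Qed.

Lemma expb_IZR : expb Z.abs_nat IZR.
Proof.
  exists 2. split; [lra|]. intros n. rewrite <- abs_IZR, <- Zabs2Nat.id_abs, <- INR_IZR_INZ.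
  generalize (Z.abs_nat n). induction n0; [simpl; lra|].
  rewrite S_INR. assert (1 <= 2 ^ S n0) by (apply pow_R1_Rle; lra).
  rewrite <- (tech_pow_Rmult _ (S n0)). lra.
Qed.

Lemma powerRZ_abs_nat_bound z n : z <> 0 -> Rabs (z ^^ n) <= (Rabs z + / Rabs z) ^ Z.abs_nat n.
Proof.
  intros Hz. assert (Hp : 0 < Rabs z) by now apply Rabs_pos_lt.
  assert (Hi : 0 < / Rabs z) by now apply Rinv_0_lt_compat.
  destruct n; simpl.
  - rewrite Rabs_R1; lra.
  - rewrite <- RPow_abs. apply pow_incr. lra.
  - rewrite Rabs_inv, <- RPow_abs, <- pow_inv. apply pow_incr. lra.
Qed.

Lemma expb_powerRZ z : z <> 0 -> expb Z.abs_nat (powerRZ z).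
Proof.
  intros Hz. assert (Hp : 0 < Rabs z) by now apply Rabs_pos_lt.
  assert (Hi : 0 < / Rabs z) by now apply Rinv_0_lt_compat.
  exists (1 + (Rabs z + / Rabs z)). split; [lra|]. intros n.
  eapply Rle_trans; [now apply powerRZ_abs_nat_bound|].
  rewrite <- tech_pow_Rmult.
  assert ((Rabs z + / Rabs z) ^ Z.abs_nat n <= (1 + (Rabs z + / Rabs z)) ^ Z.abs_nat n)
    by (apply pow_incr; lra).
  assert (0 <= (1 + (Rabs z + / Rabs z)) ^ Z.abs_nat n) by (apply pow_le; lra). nra.
Qed.

(** Ratio test: consecutive terms of the majorant have ratio M q (q^2)^n, which tends to 0 for any
    M. *)
Lemma summable_gauss_nat (f : nat -> R) q : 0 < q < 1 -> expb (fun n => n) f ->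
  summable (fun n : nat => f n * q ^ (n * n)).
Proof.
  intros Hq (M & HM & Hf).
  apply summable_dom with (fun n => M ^ S n * q ^ (n * n)).
  { intros n. rewrite Rabs_mult. rewrite (Rabs_pos_eq (q ^ _)) by (apply pow_le; lra).
    apply Rmult_le_compat_r; [apply pow_le; lra | apply Hf]. }
  assert (Hpos : forall n, 0 < M ^ S n * q ^ (n * n)).
  { intros n. apply Rmult_lt_0_compat; apply pow_lt; lra. }
  apply summable_ex_series. apply ex_series_DAlembert with 0; [lra| |].
  - intros n. specialize (Hpos n). lra.
  - apply is_lim_seq_ext with (fun n => (M * q) * (q ^ 2) ^ n).
    + intros n. rewrite Rabs_pos_eq.
      * replace (S n * S n)%nat with (n * n + 1 + 2 * n)%nat by lia.
        rewrite !pow_add, (pow_mult q 2 n), <- (tech_pow_Rmult M (S n)), pow_1.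
        field. split; apply pow_nonzero; lra.
      * apply Rlt_le, Rdiv_lt_0_compat; apply Hpos.
    + replace 0 with (M * q * 0) by ring. apply is_lim_seq_mult'; [apply is_lim_seq_const|].
      apply is_lim_seq_geom. rewrite Rabs_pos_eq; simpl; nra.
Qed.

Lemma powerRZ_of_nat q n : q ^^ (Z.of_nat n) = q ^ n.
Proof. symmetry. apply pow_powerRZ. Qed.

Lemma summable_gauss (f : Z -> R) q : 0 < q < 1 -> expb Z.abs_nat f ->
  summable (fun n => f n * q ^^ (n * n)).
Proof.
  intros Hq Hf. apply summable_Z.
  - apply summable_ext with (fun n => f (Z.of_nat n) * q ^ (n * n)).
    { intros n. rewrite <- Nat2Z.inj_mul, powerRZ_of_nat. easy. }
    apply summable_gauss_nat; [easy|].
    apply (expb_comp Z.abs_nat (fun n => n) Z.of_nat f 1); [intros; lia | easy].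
  - apply summable_ext with (fun n => f (-1 - Z.of_nat n)%Z * q * (q ^ 2) ^ n * q ^ (n * n)).
    { intros n. replace ((-1 - Z.of_nat n) * (-1 - Z.of_nat n))%Z with
        (Z.of_nat (1 + 2 * n + n * n)) by lia.
      rewrite powerRZ_of_nat, !pow_add, <- pow_mult, pow_1. ring. }
    apply summable_gauss_nat; [easy|].
    apply expb_mult; [apply expb_mult; [|apply expb_const]|].
    + apply (expb_comp Z.abs_nat (fun n => n) (fun n => (-1 - Z.of_nat n)%Z) f 1); [intros; lia | easy].
    + apply expb_bounded with 1. intros n. rewrite Rabs_pos_eq by (apply pow_le; nra).
      rewrite <- (pow1 n). apply pow_incr. nra.
Qed.

Definition size2 (x : Z * Z) : nat := (Z.abs_nat (fst x) + Z.abs_nat (snd x))%nat.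

Lemma summable_gauss2 (f : Z * Z -> R) q r : 0 < q < 1 -> 0 < r < 1 -> expb size2 f ->
  summable (fun x => f x * (q ^^ (fst x * fst x) * r ^^ (snd x * snd x))).
Proof.
  intros Hq Hr (M & HM & Hf).
  apply summable_dom with (fun x => (M ^ S (Z.abs_nat (fst x)) * q ^^ (fst x * fst x)) *
    (M ^ S (Z.abs_nat (snd x)) * r ^^ (snd x * snd x))).
  { intros [m n]. specialize (Hf (m, n)). unfold size2 in Hf; simpl fst in *; simpl snd in *.
    assert (H1 : 0 < q ^^ (m * m)) by (apply powerRZ_lt; lra).
    assert (H2 : 0 < r ^^ (n * n)) by (apply powerRZ_lt; lra).
    rewrite !Rabs_mult, (Rabs_pos_eq (q ^^ _)), (Rabs_pos_eq (r ^^ _)) by lra.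
    replace (M ^ S (Z.abs_nat m) * q ^^ (m * m) * (M ^ S (Z.abs_nat n) * r ^^ (n * n)))
      with (M ^ (S (Z.abs_nat m) + S (Z.abs_nat n)) * (q ^^ (m * m) * r ^^ (n * n)))
      by (rewrite pow_add; ring).
    apply Rmult_le_compat_r; [nra|]. eapply Rle_trans; [apply Hf|]. apply Rle_pow; [easy | lia]. }
  assert (HE : expb Z.abs_nat (fun n => M ^ S (Z.abs_nat n))).
  { exists M. split; [easy|]. intros t. rewrite Rabs_pos_eq; [lra | apply pow_le; lra]. }
  apply (summable_prod (fun n => M ^ S (Z.abs_nat n) * q ^^ (n * n))
    (fun n => M ^ S (Z.abs_nat n) * r ^^ (n * n))); now apply summable_gauss.
Qed.

(* [qfac p n = (p;p)_n] *)
Fixpoint qfac (p : R) (n : nat) : R :=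
  match n with O => 1 | S n' => qfac p n' * (1 - p ^ n) end.

Lemma pow_lt1 p n : 0 < p < 1 -> (0 < n)%nat -> 0 < p ^ n < 1.
Proof.
  intros Hp Hn. split; [apply pow_lt; lra|]. destruct n; [lia|].
  apply pow_lt_1_compat; [lra | lia].
Qed.

Lemma pow_S_lt1 p n : 0 < p < 1 -> 0 < p ^ S n < 1.
Proof. intros Hp. apply pow_lt1; [easy | lia]. Qed.

Lemma qfac_pos p n : 0 < p < 1 -> 0 < qfac p n <= 1.
Proof.
  intros Hp. induction n; [simpl; lra|].
  change (qfac p (S n)) with (qfac p n * (1 - p ^ S n)).
  pose proof (pow_S_lt1 p n Hp). nra.
Qed.

Lemma qfac_decr p n m : 0 < p < 1 -> (n <= m)%nat -> qfac p m <= qfac p n.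
Proof.
  intros Hp H. induction H; [lra|].
  change (qfac p (S m)) with (qfac p m * (1 - p ^ S m)).
  pose proof (pow_S_lt1 p m Hp). pose proof (qfac_pos p m Hp). nra.
Qed.

(* Past the index where the geometric tail is at most 1/2, [qfac] loses at most half of its value. *)
Lemma qfac_lower p : 0 < p < 1 -> exists c, 0 < c /\ forall n, c <= qfac p n.
Proof.
  intros Hp.
  assert (HK : exists K, p ^ K / (1 - p) <= / 2).
  { assert (HL : is_lim_seq (fun n => p ^ n) 0) by (apply is_lim_seq_geom; rewrite Rabs_pos_eq; lra).
    apply is_lim_seq_spec in HL. destruct (HL (mkposreal ((1 - p) / 2) ltac:(lra))) as [K HK].
    exists K. specialize (HK K (le_n _)). simpl in HK. rewrite Rminus_0_r in HK.
    rewrite Rabs_pos_eq in HK by (apply pow_le; lra).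
    apply Rmult_le_reg_r with (1 - p); [lra|]. field_simplify; lra. }
  destruct HK as [K HK]. pose proof (qfac_pos p K Hp) as HQ.
  assert (Hk : forall n, qfac p K * (1 - p ^ K * (p - p ^ S n) / (1 - p)) <= qfac p (K + n)).
  { induction n.
    - rewrite Nat.add_0_r, pow_1. right. field. lra.
    - rewrite Nat.add_succ_r. change (qfac p (S (K + n))) with (qfac p (K + n) * (1 - p ^ S (K + n))).
      assert (H1 : 0 < 1 - p ^ S (K + n)) by (pose proof (pow_S_lt1 p (K + n) Hp); lra).
      eapply Rle_trans; [|apply Rmult_le_compat_r; [lra | exact IHn]].
      replace (p ^ S (K + n)) with (p ^ K * p ^ S n) by (rewrite <- pow_add; f_equal; lia).
      rewrite <- (tech_pow_Rmult p (S n)).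
      set (a := p ^ K). set (b := p ^ S n).
      assert (Ha : 0 < a) by (apply pow_lt; lra).
      assert (Hb : 0 < b < 1) by (apply pow_lt1; [easy | lia]).
      assert (Hbp : b <= p) by (unfold b; simpl; pose proof (pow_incr p 1 n ltac:(lra)); rewrite pow1 in *; nra).
      rewrite Rmult_assoc. apply Rmult_le_compat_l; [lra|].
      replace (1 - a * (p - p * b) / (1 - p)) with
        ((1 - a * (p - b) / (1 - p)) - a * b) by (field; lra).
      assert (0 <= a * (p - b) / (1 - p)).
      { apply Rmult_le_pos; [nra|]. apply Rlt_le, Rinv_0_lt_compat. lra. }
      assert (0 < a * b) by now apply Rmult_lt_0_compat. nra. }
  exists (qfac p K / 2). split; [lra|]. intros n.
  apply Rle_trans with (qfac p (K + n)); [|apply qfac_decr; [easy | lia]].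
  eapply Rle_trans; [|apply Hk]. unfold Rdiv at 1. apply Rmult_le_compat_l; [lra|].
  assert (0 < p ^ S n) by (apply pow_lt; lra).
  assert (0 < p ^ K) by (apply pow_lt; lra).
  assert (p ^ K * (p - p ^ S n) / (1 - p) <= p ^ K / (1 - p)).
  { unfold Rdiv. apply Rmult_le_compat_r; [apply Rlt_le, Rinv_0_lt_compat; lra|]. nra. }
  lra.
Qed.

(* [qinf p = (p;p)_oo] *)
Definition qinf (p : R) : R := real (Lim_seq (qfac p)).

Lemma qinf_lim p : 0 < p < 1 -> is_lim_seq (qfac p) (qinf p).
Proof.
  intros Hp. apply Lim_seq_correct'. apply ex_finite_lim_seq_decr with 0.
  - intros n. apply qfac_decr; [easy | lia].
  - intros n. apply Rlt_le, qfac_pos, Hp.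
Qed.

Lemma qinf_pos p : 0 < p < 1 -> 0 < qinf p.
Proof.
  intros Hp. destruct (qfac_lower p Hp) as (c & Hc & H).
  apply Rlt_le_trans with c; [easy|].
  apply (is_lim_seq_le (fun _ => c) (qfac p) c (qinf p)); [easy | apply is_lim_seq_const | now apply qinf_lim].
Qed.

Lemma qinf_le p n : 0 < p < 1 -> qinf p <= qfac p n.
Proof.
  intros Hp. apply (is_lim_seq_decr_compare (qfac p)); [now apply qinf_lim|].
  intros m. apply qfac_decr; [easy | lia].
Qed.

(* [1/(p;p)_m], with the usual convention that it vanishes for [m < 0] *)
Definition iqfac (p : R) (m : Z) : R := if (m <? 0)%Z then 0 else / qfac p (Z.to_nat m).

Lemma iqfac_neg p m : (m < 0)%Z -> iqfac p m = 0.
Proof. intros H. unfold iqfac. destruct (Z.ltb_spec m 0); [easy | lia]. Qed.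

Lemma iqfac_nat p n : iqfac p (Z.of_nat n) = / qfac p n.
Proof. unfold iqfac. destruct (Z.ltb_spec (Z.of_nat n) 0); [lia | now rewrite Nat2Z.id]. Qed.

(** Valid at every integer: at m = 0 the factor 1 - p^0 vanishes in agreement with the convention
    for negative indices. Hence recurrences for bilateral sums need no boundary cases for these
    factors. *)
Lemma iqfac_pred p m : 0 < p < 1 -> iqfac p (m - 1) = (1 - p ^^ m) * iqfac p m.
Proof.
  intros Hp. destruct (Z_lt_le_dec m 1) as [H|H].
  - rewrite (iqfac_neg p (m - 1)) by lia.
    destruct (Z.eq_dec m 0) as [->|H0]; [simpl; ring|]. rewrite iqfac_neg by lia. ring.
  - replace m with (Z.of_nat (S (Z.to_nat (m - 1)))) at 2 3 by lia.
    rewrite powerRZ_of_nat, iqfac_nat.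
    replace (m - 1)%Z with (Z.of_nat (Z.to_nat (m - 1))) at 1 by lia. rewrite iqfac_nat.
    generalize (Z.to_nat (m - 1)). intros n.
    change (qfac p (S n)) with (qfac p n * (1 - p ^ S n)).
    pose proof (qfac_pos p n Hp). pose proof (pow_S_lt1 p n Hp). field. lra.
Qed.

Lemma iqfac_bound p m : 0 < p < 1 -> 0 <= iqfac p m <= / qinf p.
Proof.
  intros Hp. pose proof (qinf_pos p Hp) as H. unfold iqfac. destruct (Z.ltb_spec m 0).
  - split; [lra|]. now apply Rlt_le, Rinv_0_lt_compat.
  - pose proof (qfac_pos p (Z.to_nat m) Hp). split; [apply Rlt_le, Rinv_0_lt_compat; lra|].
    apply Rinv_le_contravar; [easy | now apply qinf_le].
Qed.

Lemma expb_iqfac {T} (w : T -> nat) p (h : T -> Z) : 0 < p < 1 -> expb w (fun t => iqfac p (h t)).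
Proof.
  intros Hp. apply expb_bounded with (/ qinf p). intros t.
  pose proof (iqfac_bound p (h t) Hp). rewrite Rabs_pos_eq; lra.
Qed.

(** * The Jacobi triple product and the cube of the Euler product *)

Lemma powerRZ_1r q : q ^^ 1 = q.
Proof. simpl; ring. Qed.

Lemma powerRZ_powl q k j : (q ^ k) ^^ j = q ^^ j ^ k.
Proof.
  induction k; simpl; [apply powerRZ_R1|]. now rewrite powerRZ_mult, IHk.
Qed.

Lemma powerRZ_m1_sq n : (-1) ^^ n * (-1) ^^ n = 1.
Proof. rewrite <- powerRZ_mult. replace (-1 * -1) with 1 by ring. apply powerRZ_R1. Qed.

Lemma powerRZ_m1_inv n : / (-1) ^^ n = (-1) ^^ n.
Proof.
  pose proof (powerRZ_m1_sq n) as H.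
  assert ((-1) ^^ n <> 0) by (intros E; rewrite E in H; lra).
  apply Rmult_eq_reg_l with ((-1) ^^ n); [|easy]. rewrite H, Rinv_r; easy.
Qed.

Lemma powerRZ_m1_opp n : (-1) ^^ (- n) = (-1) ^^ n.
Proof. rewrite powerRZ_neg'. apply powerRZ_m1_inv. Qed.

Lemma powerRZ_opp z n : (- z) ^^ n = (-1) ^^ n * z ^^ n.
Proof. rewrite <- powerRZ_mult. f_equal. ring. Qed.

Ltac nz := lra || (apply Rgt_not_eq; assumption) || (apply powerRZ_NOR; lra) || (apply pow_nonzero; lra).
(** Exponents are split along sums only, and quadratic ones such as [j * j] remain atoms; an
    identity between theta terms then becomes a rational identity for [field]. *)
Ltac pw_expand q := rewrite ?(powerRZ_add q) by nz; rewrite ?(powerRZ_neg' q), ?(powerRZ_1r q), ?(powerRZ_O q).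
Tactic Notation "pw" constr(q) constr(E) constr(E') :=
  replace (q ^^ E) with (q ^^ E') by (f_equal; ring).

(* Coefficient of [z^j] in the finite form of the Jacobi triple product (base [r^2]). *)
Definition jtc (r : R) (n : nat) (j : Z) : R :=
  qfac (r ^ 2) (2 * n) * iqfac (r ^ 2) (Z.of_nat n + j) * iqfac (r ^ 2) (Z.of_nat n - j).

(** The base p = r^2 turns the usual p^(j(j-1)/2) into an integral power of r; [jtc] is the Gaussian
    binomial of 2n over n + j. *)
Definition jtt (r z : R) (n : nat) (j : Z) : R :=
  jtc r n j * r ^^ (j * j - j) * z ^^ j.

Fixpoint jtp (r z : R) (n : nat) : R :=
  match n with
  | O => 1
  | S n' => jtp r z n' * ((1 + z * (r ^ 2) ^ n') * (1 + (r ^ 2) ^ S n' / z))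
  end.

Lemma sq_lt1 r : 0 < r < 1 -> 0 < r ^ 2 < 1.
Proof. intros H. apply pow_lt1; [easy | lia]. Qed.

Lemma jtc_bound r n j : 0 < r < 1 -> 0 <= jtc r n j <= / qinf (r ^ 2) * / qinf (r ^ 2).
Proof.
  intros Hr. pose proof (sq_lt1 r Hr) as Hp. unfold jtc.
  pose proof (qfac_pos (r ^ 2) (2 * n) Hp) as H0.
  pose proof (iqfac_bound (r ^ 2) (Z.of_nat n + j) Hp) as H1.
  pose proof (iqfac_bound (r ^ 2) (Z.of_nat n - j) Hp) as H2.
  generalize dependent (qfac (r ^ 2) (2 * n)). intros a Ha.
  generalize dependent (iqfac (r ^ 2) (Z.of_nat n + j)). intros b Hb.
  generalize dependent (iqfac (r ^ 2) (Z.of_nat n - j)). intros c Hc.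
  split; [apply Rmult_le_pos; [apply Rmult_le_pos|]; lra|].
  apply Rmult_le_compat; try lra; [apply Rmult_le_pos; lra|]. nra.
Qed.

(* Gaussian majorant, uniform in [n]. *)
Definition jtm (r z : R) (j : Z) : R :=
  (/ qinf (r ^ 2) * / qinf (r ^ 2) * / r ^^ j * Rabs (z ^^ j)) * r ^^ (j * j).

Lemma expb_powerRZ_inv r : r <> 0 -> expb Z.abs_nat (fun j => / r ^^ j).
Proof.
  intros Hr. apply expb_ext with (fun j => (/ r) ^^ j); [intros; apply powerRZ_inv'|].
  apply expb_powerRZ. now apply Rinv_neq_0_compat.
Qed.

Lemma expb_abs {T} (w : T -> nat) f : expb w f -> expb w (fun t => Rabs (f t)).
Proof. intros (M & HM & H). exists M. split; [easy|]. intros; now rewrite Rabs_Rabsolu. Qed.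

Lemma summable_jtm r z (c : Z -> R) : 0 < r < 1 -> z <> 0 -> expb Z.abs_nat c ->
  summable (fun j => c j * jtm r z j).
Proof.
  intros Hr Hz Hc. unfold jtm.
  apply summable_ext with (fun j => (c j * (/ qinf (r ^ 2) * / qinf (r ^ 2) * / r ^^ j *
    Rabs (z ^^ j))) * r ^^ (j * j)); [intros; ring|].
  apply summable_gauss; [easy|].
  apply expb_mult; [easy|]. apply expb_mult; [apply expb_mult; [apply expb_const|]|].
  - apply expb_powerRZ_inv; lra.
  - apply expb_abs, expb_powerRZ; easy.
Qed.

Lemma jtt_bound r z n j : 0 < r < 1 -> Rabs (jtt r z n j) <= jtm r z j.
Proof.
  intros Hr. unfold jtt, jtm. rewrite !Rabs_mult.
  pose proof (jtc_bound r n j Hr) as H.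
  pw r (j * j - j)%Z (j * j + - j)%Z. pw_expand r.
  assert (H1 : 0 < r ^^ j) by (apply powerRZ_lt; lra).
  assert (H2 : 0 < r ^^ (j * j)) by (apply powerRZ_lt; lra).
  assert (H3 : 0 < / r ^^ j) by now apply Rinv_0_lt_compat.
  rewrite (Rabs_pos_eq (jtc r n j)) by lra.
  rewrite Rabs_mult, !Rabs_pos_eq by lra.
  pose proof (Rabs_pos (z ^^ j)).
  replace (jtc r n j * (r ^^ (j * j) * / r ^^ j) * Rabs (z ^^ j)) with
    (jtc r n j * (/ r ^^ j * Rabs (z ^^ j) * r ^^ (j * j))) by ring.
  replace (/ qinf (r ^ 2) * / qinf (r ^ 2) * / r ^^ j * Rabs (z ^^ j) * r ^^ (j * j))
    with (/ qinf (r ^ 2) * / qinf (r ^ 2) * (/ r ^^ j * Rabs (z ^^ j) * r ^^ (j * j)))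
    by ring.
  apply Rmult_le_compat_r; [|lra]. apply Rmult_le_pos; [|lra]. apply Rmult_le_pos; lra.
Qed.

Lemma summable_jtt r z n (c : Z -> R) : 0 < r < 1 -> z <> 0 -> expb Z.abs_nat c ->
  summable (fun j => c j * jtt r z n j).
Proof.
  intros Hr Hz Hc. apply summable_dom with (fun j => Rabs (c j) * jtm r z j).
  - intros j. rewrite Rabs_mult. apply Rmult_le_compat_l; [apply Rabs_pos|]. now apply jtt_bound.
  - apply summable_jtm; try easy. now apply expb_abs.
Qed.

(** Comparison of coefficients after multiplication by the new factors (1 + z p^n)(1 + p^(n+1)/z),
    with p = r^2; the three summands are the powers z^0, z and 1/z of that product. *)
Lemma jtt_rec r z n j : 0 < r < 1 -> z <> 0 ->
  jtt r z (S n) j = (1 + (r ^ 2) ^ n * (r ^ 2) ^ S n) * jtt r z n j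
    + z * (r ^ 2) ^ n * jtt r z n (j + -1) + (r ^ 2) ^ S n / z * jtt r z n (j + 1).
Proof.
  intros Hr Hz. pose proof (sq_lt1 r Hr) as Hp. change (j + -1)%Z with (j - 1)%Z. unfold jtt, jtc.
  set (N := Z.of_nat n). set (p := r ^ 2) in *.
  replace (2 * S n)%nat with (S (S (2 * n))) by lia.
  change (qfac p (S (S (2 * n)))) with (qfac p (2 * n) * (1 - p ^ S (2 * n)) * (1 - p ^ S (S (2 * n)))).
  replace (Z.of_nat (S n)) with (N + 1)%Z by (unfold N; lia).
  replace (N + j)%Z with (N + 1 + j - 1)%Z by ring.
  replace (N - j)%Z with (N + 1 - j - 1)%Z by ring.
  replace (N + (j - 1))%Z with (N + 1 + j - 1 - 1)%Z by ring.
  replace (N - (j + 1))%Z with (N + 1 - j - 1 - 1)%Z by ring.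
  replace (N - (j - 1))%Z with (N + 1 - j)%Z by ring.
  replace (N + (j + 1))%Z with (N + 1 + j)%Z by ring.
  rewrite !(iqfac_pred p) by easy.
  generalize (iqfac p (N + 1 + j)) as a. generalize (iqfac p (N + 1 - j)) as b. intros b a.
  pw p (N + 1 + j - 1)%Z (N + j)%Z. pw p (N + 1 - j - 1)%Z (N + - j)%Z.
  pw p (N + 1 - j)%Z (N + 1 + - j)%Z.
  pw r ((j - 1) * (j - 1) - (j - 1))%Z (j * j - j + - j + - j + 1 + 1)%Z.
  pw r ((j + 1) * (j + 1) - (j + 1))%Z (j * j - j + j + j)%Z.
  pw z (j - 1)%Z (j + - (1))%Z.
  assert (p <> 0) by lra.
  pw_expand p. pw_expand r. pw_expand z.
  assert (Ep : p ^^ j = r ^^ j ^ 2) by apply powerRZ_powl.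
  unfold N. rewrite !powerRZ_of_nat, !Ep.
  replace (p ^ S (2 * n)) with (p * p ^ n * p ^ n).
  2: { replace (S (2 * n)) with (1 + n + n)%nat by lia. rewrite !pow_add. simpl; ring. }
  replace (p ^ S (S (2 * n))) with (p * p * p ^ n * p ^ n).
  2: { replace (S (S (2 * n))) with (1 + 1 + n + n)%nat by lia. rewrite !pow_add. simpl; ring. }
  change (p ^ S n) with (p * p ^ n). generalize (p ^ n) as y. intros y.
  unfold p. assert (r ^^ j <> 0) by nz. field. repeat split; nz.
Qed.

Lemma expb_one : expb Z.abs_nat (fun _ => 1).
Proof. apply expb_const. Qed.

Lemma summable_jtt1 r z n : 0 < r < 1 -> z <> 0 -> summable (jtt r z n).
Proof.
  intros Hr Hz. apply summable_ext with (fun j => 1 * jtt r z n j); [intros; ring|].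
  apply summable_jtt; try easy. apply expb_one.
Qed.

Lemma jtt_0 r z j : 0 < r < 1 -> j <> 0%Z -> jtt r z 0 j = 0.
Proof.
  intros Hr Hj. unfold jtt, jtc. destruct (Z_lt_le_dec j 0).
  - rewrite (iqfac_neg _ (Z.of_nat 0 + j)) by lia. ring.
  - rewrite (iqfac_neg _ (Z.of_nat 0 - j)) by lia. ring.
Qed.

Lemma jtp_finite r z n : 0 < r < 1 -> z <> 0 -> tsum (jtt r z n) = jtp r z n.
Proof.
  intros Hr Hz. induction n.
  - rewrite (tsum_single _ 0%Z) by (intros; now apply jtt_0). unfold jtt, jtc, iqfac; simpl. field.
  - pose proof (summable_jtt1 r z n Hr Hz) as HS.
    rewrite (tsum_ext _ _ (fun j => jtt_rec r z n j Hr Hz)).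
    pose proof (summable_Z_shift _ (-1) HS) as H1. pose proof (summable_Z_shift _ 1 HS) as H2.
    rewrite !tsum_plus, !tsum_scal; try apply summable_plus; try (apply summable_scal); try easy.
    rewrite (tsum_Z_shift (jtt r z n) (-1)), (tsum_Z_shift (jtt r z n) 1) by easy.
    rewrite IHn. change (jtp r z (S n)) with
      (jtp r z n * ((1 + z * (r ^ 2) ^ n) * (1 + (r ^ 2) ^ S n / z))). change ((r ^ 2) ^ S n) with (r ^ 2 * (r ^ 2) ^ n). field. easy.
Qed.

(* The derivative of the finite triple product at [z = -1], where one factor vanishes. *)
Lemma jacobi_finite r n : 0 < r < 1 ->
  tsum (fun j => IZR j * jtt r (-1) (S n) j) = - (qfac (r ^ 2) n * qfac (r ^ 2) (S n)).
Proof.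
  intros Hr. pose proof (sq_lt1 r Hr) as Hp.
  assert (Hm : -1 <> 0) by lra.
  assert (Hrec : forall n, tsum (fun j => IZR j * jtt r (-1) (S n) j) =
    (1 - (r ^ 2) ^ n) * (1 - (r ^ 2) ^ S n) * tsum (fun j => IZR j * jtt r (-1) n j)
    + ((r ^ 2) ^ S n - (r ^ 2) ^ n) * jtp r (-1) n).
  { clear n; intros n. pose proof (summable_jtt1 r (-1) n Hr Hm) as HS.
    pose proof (summable_jtt r (-1) n IZR Hr Hm expb_IZR) as HS1.
    pose proof (summable_Z_shift _ (-1) HS) as H1. pose proof (summable_Z_shift _ 1 HS) as H2.
    pose proof (summable_Z_shift _ (-1) HS1) as H3. pose proof (summable_Z_shift _ 1 HS1) as H4.
    rewrite (tsum_ext _ (fun j =>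
      (1 + (r ^ 2) ^ n * (r ^ 2) ^ S n) * (IZR j * jtt r (-1) n j)
      + (- (r ^ 2) ^ n * (IZR (j + -1) * jtt r (-1) n (j + -1))
      + (- (r ^ 2) ^ n * jtt r (-1) n (j + -1)
      + (- (r ^ 2) ^ S n * (IZR (j + 1) * jtt r (-1) n (j + 1))
      + (r ^ 2) ^ S n * jtt r (-1) n (j + 1)))))).
    2: { intros j. rewrite (jtt_rec r (-1) n j Hr Hm), !plus_IZR.
         field. }
    rewrite !tsum_plus, !tsum_scal;
      repeat (apply summable_plus || apply summable_scal || easy).
    rewrite (tsum_Z_shift (jtt r (-1) n) (-1)), (tsum_Z_shift (jtt r (-1) n) 1) by easy.
    rewrite (tsum_Z_shift (fun j => IZR j * jtt r (-1) n j) (-1)),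
      (tsum_Z_shift (fun j => IZR j * jtt r (-1) n j) 1) by easy.
    rewrite !jtp_finite by easy. ring. }
  induction n.
  - rewrite Hrec, (tsum_single _ 0%Z).
    + simpl; ring.
    + intros j Hj. rewrite jtt_0 by easy. ring.
  - rewrite Hrec, IHn.
    assert (E : jtp r (-1) (S n) = 0).
    { clear. induction n; [simpl; field|]. change (jtp r (-1) (S (S n))) with
        (jtp r (-1) (S n) * ((1 + -1 * (r ^ 2) ^ S n) * (1 + (r ^ 2) ^ S (S n) / -1))).
      rewrite IHn. ring. }
    rewrite E. change (qfac (r ^ 2) (S (S n))) with (qfac (r ^ 2) (S n) * (1 - (r ^ 2) ^ S (S n))).
    change (qfac (r ^ 2) (S n)) with (qfac (r ^ 2) n * (1 - (r ^ 2) ^ S n)). ring.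
Qed.

Lemma iqfac_lim p (h : nat -> Z) : 0 < p < 1 -> (forall K : Z, exists N, forall n, (N <= n)%nat -> (K <= h n)%Z) ->
  is_lim_seq (fun n => iqfac p (h n)) (/ qinf p).
Proof.
  intros Hp Hh. pose proof (qinf_pos p Hp) as HQ.
  assert (H : is_lim_seq (fun n => / qfac p n) (/ qinf p)).
  { apply (is_lim_seq_inv _ (qinf p)); [now apply qinf_lim|]. intros E; injection E; lra. }
  apply is_lim_seq_spec in H. apply is_lim_seq_spec. intros eps. destruct (H eps) as [K HK].
  destruct (Hh (Z.of_nat K)) as [N HN]. exists N. intros n Hn. specialize (HN n Hn).
  replace (h n) with (Z.of_nat (Z.to_nat (h n))) by lia. rewrite iqfac_nat. apply HK. lia.
Qed.

Lemma jtc_lim r j : 0 < r < 1 -> is_lim_seq (fun n => jtc r n j) (/ qinf (r ^ 2)).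
Proof.
  intros Hr. pose proof (sq_lt1 r Hr) as Hp. pose proof (qinf_pos _ Hp) as HQ. unfold jtc.
  replace (/ qinf (r ^ 2)) with (qinf (r ^ 2) * / qinf (r ^ 2) * / qinf (r ^ 2)) by (field; lra).
  apply is_lim_seq_mult'; [apply is_lim_seq_mult'|].
  - apply (is_lim_seq_subseq (qfac (r ^ 2)) _ (fun n => (2 * n)%nat)); [|now apply qinf_lim].
    apply eventually_subseq. intros; lia.
  - apply iqfac_lim; [easy|]. intros K. exists (Z.to_nat (K - j)). lia.
  - apply iqfac_lim; [easy|]. intros K. exists (Z.to_nat (K + j)). lia.
Qed.

(** The weight [c] serves two purposes: c = 1 yields the triple product, and c j = j yields its
    logarithmic derivative z d/dz, hence the cube of the Euler product. *)
Lemma jtt_tannery r z (c : Z -> R) : 0 < r < 1 -> z <> 0 -> expb Z.abs_nat c ->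
  is_lim_seq (fun n => tsum (fun j => c j * jtt r z n j))
    (/ qinf (r ^ 2) * tsum (fun j => c j * (r ^^ (j * j - j) * z ^^ j))).
Proof.
  intros Hr Hz Hc. pose proof (sq_lt1 r Hr) as Hp. pose proof (qinf_pos _ Hp) as HQ.
  rewrite <- tsum_scal.
  2: { apply summable_ext with (fun j => (c j * (/ r ^^ j * z ^^ j)) * r ^^ (j * j)).
       { intros j. pw r (j * j - j)%Z (j * j + - j)%Z. pw_expand r. ring. }
       apply summable_gauss; [easy|]. apply expb_mult; [easy|].
       apply expb_mult; [apply expb_powerRZ_inv; lra | now apply expb_powerRZ]. }
  apply (tannery eventually _ _ (fun j => Rabs (c j) * jtm r z j)).
  - apply summable_jtm; try easy. now apply expb_abs.
  - exists 0%nat. intros n _ j. rewrite Rabs_mult.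
    apply Rmult_le_compat_l; [apply Rabs_pos|]. now apply jtt_bound.
  - intros j. unfold jtt.
    replace (/ qinf (r ^ 2) * (c j * (r ^^ (j * j - j) * z ^^ j))) with
      (c j * (/ qinf (r ^ 2) * r ^^ (j * j - j) * z ^^ j)) by ring.
    change (is_lim_seq (fun n => c j * (jtc r n j * r ^^ (j * j - j) * z ^^ j))
      (c j * (/ qinf (r ^ 2) * r ^^ (j * j - j) * z ^^ j))).
    apply is_lim_seq_mult'; [apply is_lim_seq_const|].
    repeat (apply is_lim_seq_mult'; [|apply is_lim_seq_const]). now apply jtc_lim.
Qed.

Lemma jacobi_triple_product r z : 0 < r < 1 -> z <> 0 ->
  is_lim_seq (jtp r z) (/ qinf (r ^ 2) * tsum (fun j => r ^^ (j * j - j) * z ^^ j)).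
Proof.
  intros Hr Hz. pose proof (jtt_tannery r z (fun _ => 1) Hr Hz expb_one) as H.
  rewrite (tsum_ext (fun j => 1 * _) (fun j => r ^^ (j * j - j) * z ^^ j)) in H
    by (intros; ring).
  revert H. apply is_lim_seq_ext. intros n.
  rewrite (tsum_ext _ (jtt r z n)) by (intros; ring). now apply jtp_finite.
Qed.

Lemma jacobi_cube r : 0 < r < 1 ->
  tsum (fun j => IZR j * (r ^^ (j * j - j) * (-1) ^^ j)) = - qinf (r ^ 2) ^ 3.
Proof.
  intros Hr. pose proof (sq_lt1 r Hr) as Hp. pose proof (qinf_pos _ Hp) as HQ.
  pose proof (jtt_tannery r (-1) IZR Hr ltac:(lra) expb_IZR) as H.
  apply is_lim_seq_incr_1 in H.
  apply is_lim_seq_ext with (v := fun n => - (qfac (r ^ 2) n * qfac (r ^ 2) (S n))) in H;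
    [|intros; now apply jacobi_finite].
  assert (H' : is_lim_seq (fun n => - (qfac (r ^ 2) n * qfac (r ^ 2) (S n)))
    (- (qinf (r ^ 2) * qinf (r ^ 2)))).
  { apply (is_lim_seq_opp _ (qinf (r ^ 2) * qinf (r ^ 2))). apply is_lim_seq_mult'; [now apply qinf_lim|].
    apply (is_lim_seq_incr_1 (qfac (r ^ 2))). now apply qinf_lim. }
  apply is_lim_seq_unique in H. apply is_lim_seq_unique in H'. rewrite H in H'.
  apply (f_equal real) in H'. unfold real in H'. apply Rmult_eq_reg_l with (/ qinf (r ^ 2)); [|apply Rinv_neq_0_compat; lra].
  rewrite H'. field. lra.
Qed.

(** * Product formulas for theta functions *)

(* [phi x] is [rphi (- x)] and [thetaB r] is [2 * rpsi (r ^ 2)]. In Ramanujan's notation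
   [thetaN q = f(-q,-q^5)] and [thetaC w = f(w^2,w^4)]. *)
Definition phi (x : R) : R := tsum (fun n : Z => (-1) ^^ n * x ^^ (n * n)).
Definition thetaB (r : R) : R := tsum (fun n : Z => r ^^ (n * n + n)).
Definition thetaN (q : R) : R := tsum (fun n : Z => (-1) ^^ n * q ^^ (3 * (n * n) + 2 * n)).
Definition thetaC (w : R) : R := tsum (fun n : Z => w ^^ (3 * (n * n) + n)).

Lemma pow_powl (q : R) k n : (q ^ k) ^ n = (q ^ n) ^ k.
Proof. now rewrite <- !pow_mult, Nat.mul_comm. Qed.

Lemma pow_mulr (q : R) k n : q ^ (k * n) = (q ^ n) ^ k.
Proof. now rewrite pow_mult, pow_powl. Qed.

Lemma qfac_S p n : qfac p (S n) = qfac p n * (1 - p * p ^ n).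
Proof. easy. Qed.

(** One factor is peeled off in the shape q^c (q^n)^d, so that in the products below all powers
    become monomials in q and q^n. *)
Lemma qfac_step q a b k n :
  qfac (q ^ a) (S (k + b * n)) = qfac (q ^ a) (k + b * n) * (1 - q ^ (a * S k) * (q ^ n) ^ (a * b)).
Proof.
  change (qfac (q ^ a) (S (k + b * n))) with (qfac (q ^ a) (k + b * n) * (1 - (q ^ a) ^ (S (k + b * n)))).
  do 2 f_equal. rewrite <- !pow_mult, <- pow_add. f_equal. lia.
Qed.

Lemma qfac_pow1 p n : qfac p n = qfac (p ^ 1) n.
Proof. now rewrite pow_1. Qed.

Lemma qfac_lim_mult p k : 0 < p < 1 -> is_lim_seq (fun n => qfac p (S k * n)) (qinf p).
Proof.
  intros Hp. apply (is_lim_seq_subseq (qfac p) _ (fun n => (S k * n)%nat)); [|now apply qinf_lim].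
  apply eventually_subseq. intros; lia.
Qed.

Lemma one_minus_pow p n : 0 < p < 1 -> 0 < 1 - p * p ^ n.
Proof. intros Hp. pose proof (pow_S_lt1 p n Hp) as H. simpl in H. lra. Qed.

Lemma jtp_S r z n : jtp r z (S n) = jtp r z n * ((1 + z * (r ^ 2) ^ n) * (1 + r ^ 2 * (r ^ 2) ^ n / z)).
Proof. easy. Qed.

Lemma tsum_from_jtp r z l : 0 < r < 1 -> z <> 0 -> is_lim_seq (jtp r z) (Finite l) ->
  tsum (fun j => r ^^ (j * j - j) * z ^^ j) = qinf (r ^ 2) * l.
Proof.
  intros Hr Hz H. pose proof (qinf_pos _ (sq_lt1 r Hr)) as HQ.
  pose proof (jacobi_triple_product r z Hr Hz) as H'.
  apply is_lim_seq_unique in H. apply is_lim_seq_unique in H'. rewrite H in H'.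
  apply (f_equal real) in H'. unfold real in H'. rewrite H'. field. lra.
Qed.

Lemma pow_bounds q n : 0 < q < 1 -> 0 < q ^ n <= 1.
Proof. intros H. split; [apply pow_lt; lra|]. rewrite <- (pow1 n). apply pow_incr; lra. Qed.

Lemma is_lim_seq_quot u v (a b : R) : is_lim_seq u a -> is_lim_seq v b -> 0 < b ->
  is_lim_seq (fun n => u n / v n) (a / b).
Proof. intros Hu Hv Hb. apply is_lim_seq_div'; [easy | easy | lra]. Qed.

Lemma pow_mix_lt1 q n a b : 0 < q < 1 -> (0 < a)%nat -> 0 < 1 - q ^ a * (q ^ n) ^ b.
Proof.
  intros Hq Ha. rewrite <- pow_mult, <- pow_add.
  pose proof (pow_lt1 q (a + n * b) Hq ltac:(lia)). lra.
Qed.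

(** Both factors at step k are 1 - x^(2k+1): odd exponents are all exponents up to 2n divided by the
    even ones. *)
Lemma phi_jtp x n : 0 < x < 1 -> jtp x (- x) n = (qfac x (2 * n) / qfac (x ^ 2) n) ^ 2.
Proof.
  intros Hx. pose proof (sq_lt1 x Hx) as Hx2. induction n; [simpl; field|].
  rewrite jtp_S, IHn. clear IHn. replace (2 * S n)%nat with (S (1 + 2 * n)) by lia.
  replace (S n) with (S (0 + 1 * n)) by lia.
  rewrite (qfac_pow1 x (2 * n)), (qfac_pow1 x (S _)), !qfac_step.
  change (1 + 2 * n)%nat with (S (0 + 2 * n)). rewrite qfac_step.
  replace (0 + 2 * n)%nat with (2 * n)%nat by lia. replace (0 + 1 * n)%nat with n by lia.
  rewrite pow_powl. pose proof (qfac_pos _ n Hx2).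
  pose proof (pow_mix_lt1 x n (2 * 1) (2 * 1) Hx ltac:(lia)).
  cbn [Nat.mul Nat.add] in *.
  field. repeat split; try lra.
Qed.

Lemma phi_eta x : 0 < x < 1 -> phi x = qinf x ^ 2 / qinf (x ^ 2).
Proof.
  intros Hx. pose proof (sq_lt1 x Hx) as Hx2. pose proof (qinf_pos _ Hx2) as HQ.
  unfold phi. rewrite (tsum_ext _ (fun j => x ^^ (j * j - j) * (- x) ^^ j)).
  - rewrite (tsum_from_jtp x (- x) ((qinf x / qinf (x ^ 2)) ^ 2)); [field; lra | easy | lra |].
    apply is_lim_seq_ext with (fun n => (qfac x (2 * n) / qfac (x ^ 2) n) * (qfac x (2 * n) / qfac (x ^ 2) n)).
    + intros n. rewrite phi_jtp by easy. ring.
    + replace ((qinf x / qinf (x ^ 2)) ^ 2) with ((qinf x / qinf (x ^ 2)) * (qinf x / qinf (x ^ 2))) by ring.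
      apply is_lim_seq_mult'; apply is_lim_seq_quot; try easy;
        (now apply (qfac_lim_mult x 1)) || now apply qinf_lim.
  - intros j. rewrite powerRZ_opp. pw x (j * j - j)%Z (j * j + - j)%Z. pw_expand x.
    field. nz.
Qed.

(** The factors are 1 + p^(k+1) and 1 + p^k with p = r^2. The second product begins with 1 + 1 and
    stops one factor earlier, whence the 2 and the denominator. *)
Lemma thetaB_jtp r n : 0 < r < 1 ->
  jtp r (r ^ 2) n = 2 * (qfac ((r ^ 2) ^ 2) n / qfac (r ^ 2) n) ^ 2 / (1 + (r ^ 2) ^ n).
Proof.
  intros Hr. pose proof (sq_lt1 r Hr) as Hp. induction n; [simpl; field|].
  rewrite jtp_S, IHn. clear IHn. generalize dependent (r ^ 2). intros p Hp.
  pose proof (sq_lt1 p Hp) as Hp2.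
  rewrite !qfac_S, pow_powl. change (p ^ S n) with (p * p ^ n).
  pose proof (qfac_pos _ n Hp2). pose proof (qfac_pos _ n Hp). pose proof (pow_bounds p n Hp).
  pose proof (one_minus_pow p n Hp).
  assert (0 < 1 + p * p ^ n) by nra.
  field. repeat split; lra.
Qed.

Lemma thetaB_eta r : 0 < r < 1 -> thetaB r = 2 * qinf ((r ^ 2) ^ 2) ^ 2 / qinf (r ^ 2).
Proof.
  intros Hr. pose proof (sq_lt1 r Hr) as Hp. pose proof (sq_lt1 _ Hp) as Hp2.
  pose proof (qinf_pos _ Hp) as HQ. pose proof (qinf_pos _ Hp2) as HQ2.
  unfold thetaB. rewrite (tsum_ext _ (fun j => r ^^ (j * j - j) * (r ^ 2) ^^ j)).
  - rewrite (tsum_from_jtp r (r ^ 2) (2 * (qinf ((r ^ 2) ^ 2) / qinf (r ^ 2)) ^ 2 / (1 + 0)));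
      [field; lra | easy | lra |].
    apply is_lim_seq_ext with (fun n => 2 * ((qfac ((r ^ 2) ^ 2) n / qfac (r ^ 2) n) *
       (qfac ((r ^ 2) ^ 2) n / qfac (r ^ 2) n)) / (1 + (r ^ 2) ^ n)).
    + intros n. rewrite thetaB_jtp by easy. unfold Rdiv; ring.
    + replace ((qinf ((r ^ 2) ^ 2) / qinf (r ^ 2)) ^ 2) with
        ((qinf ((r ^ 2) ^ 2) / qinf (r ^ 2)) * (qinf ((r ^ 2) ^ 2) / qinf (r ^ 2))) by ring.
      apply is_lim_seq_quot; [| |lra].
      * apply is_lim_seq_mult'; [apply is_lim_seq_const|].
        apply is_lim_seq_mult'; apply is_lim_seq_quot; try easy; now apply qinf_lim.
      * apply is_lim_seq_plus'; [apply is_lim_seq_const|].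
        apply is_lim_seq_geom. rewrite Rabs_pos_eq; lra.
  - intros j. rewrite powerRZ_powl. pw r (j * j - j)%Z (j * j + - j)%Z. pw_expand r. field. nz.
Qed.

(** The exponents 6k + 1 and 6k + 5 are the odd numbers not divisible by 3: the odd exponents are
    divided by the odd multiples of 3. *)
Lemma thetaN_jtp q n : 0 < q < 1 -> jtp (q ^ 3) (- q ^ 5) n =
  (qfac q (6 * n) / qfac (q ^ 2) (3 * n)) / (qfac (q ^ 3) (2 * n) / qfac (q ^ 6) n).
Proof.
  intros Hq. pose proof (pow_S_lt1 q 1 Hq) as H2. pose proof (pow_S_lt1 q 2 Hq) as H3.
  pose proof (pow_S_lt1 q 5 Hq) as H6. induction n; [simpl; field|].
  rewrite jtp_S, IHn. clear IHn.
  replace (6 * S n)%nat with (S (5 + 6 * n)) by lia.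
  replace (3 * S n)%nat with (S (2 + 3 * n)) by lia.
  replace (2 * S n)%nat with (S (1 + 2 * n)) by lia.
  replace (S n) with (S (0 + 1 * n)) by lia.
  rewrite (qfac_pow1 q (6 * n)), (qfac_pow1 q (S _)), !qfac_step.
  change (5 + 6 * n)%nat with (S (4 + 6 * n)). rewrite qfac_step.
  change (4 + 6 * n)%nat with (S (3 + 6 * n)). rewrite qfac_step.
  change (3 + 6 * n)%nat with (S (2 + 6 * n)). rewrite qfac_step.
  change (2 + 6 * n)%nat with (S (1 + 6 * n)). rewrite qfac_step.
  change (1 + 6 * n)%nat with (S (0 + 6 * n)). rewrite qfac_step.
  change (2 + 3 * n)%nat with (S (1 + 3 * n)). rewrite qfac_step.
  change (1 + 3 * n)%nat with (S (0 + 3 * n)). rewrite qfac_step.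
  change (1 + 2 * n)%nat with (S (0 + 2 * n)). rewrite qfac_step.
  replace (0 + 6 * n)%nat with (6 * n)%nat by lia. replace (0 + 3 * n)%nat with (3 * n)%nat by lia.
  replace (0 + 2 * n)%nat with (2 * n)%nat by lia. replace (0 + 1 * n)%nat with n by lia.
  rewrite <- (pow_mult q 3 2), (pow_powl q _ n).
  pose proof (qfac_pos _ (3 * n) H2). pose proof (qfac_pos _ (2 * n) H3). pose proof (qfac_pos _ n H6).
  pose proof (fun a => pow_mix_lt1 q n (S a) 6 Hq ltac:(lia)) as HP.
  pose proof (HP 1%nat). pose proof (HP 2%nat). pose proof (HP 3%nat). pose proof (HP 5%nat).
  cbn [Nat.mul Nat.add] in *. clear HP.
  assert (0 < q ^ 5) by (apply pow_lt; lra).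
  field. repeat split; lra.
Qed.

Lemma thetaN_eta q : 0 < q < 1 ->
  thetaN q = qinf (q ^ 6) * ((qinf q / qinf (q ^ 2)) / (qinf (q ^ 3) / qinf (q ^ 6))).
Proof.
  intros Hq. pose proof (pow_S_lt1 q 1 Hq) as H2. pose proof (pow_S_lt1 q 2 Hq) as H3.
  pose proof (pow_S_lt1 q 5 Hq) as H6. pose proof (pow_S_lt1 q 4 Hq) as H5.
  pose proof (qinf_pos _ H2). pose proof (qinf_pos _ H3). pose proof (qinf_pos _ H6).
  unfold thetaN. rewrite (tsum_ext _ (fun j => (q ^ 3) ^^ (j * j - j) * (- q ^ 5) ^^ j)).
  - rewrite (tsum_from_jtp (q ^ 3) (- q ^ 5) ((qinf q / qinf (q ^ 2)) / (qinf (q ^ 3) / qinf (q ^ 6))));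
      [now rewrite <- (pow_mult q 3 2) | easy | lra |].
    apply is_lim_seq_ext with (fun n =>
      (qfac q (6 * n) / qfac (q ^ 2) (3 * n)) / (qfac (q ^ 3) (2 * n) / qfac (q ^ 6) n)).
    + intros n. now rewrite thetaN_jtp.
    + apply is_lim_seq_quot; [apply is_lim_seq_quot| apply is_lim_seq_quot |]; try easy.
      * now apply (qfac_lim_mult q 5).
      * now apply (qfac_lim_mult (q ^ 2) 2).
      * now apply (qfac_lim_mult (q ^ 3) 1).
      * now apply qinf_lim.
      * now apply Rdiv_lt_0_compat.
  - intros j. rewrite powerRZ_opp, !powerRZ_powl.
    pw q (3 * (j * j) + 2 * j)%Z (j * j + j * j + j * j + j + j)%Z. pw q (j * j - j)%Z (j * j + - j)%Z.
    pw_expand q. field. nz.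
Qed.

(** The factors are 1 + w^(2m) with m not divisible by 3, each 1 + x being written as (1 - x^2)/(1 -
    x). *)
Lemma thetaC_jtp w n : 0 < w < 1 -> jtp (w ^ 3) (w ^ 4) n =
  (qfac (w ^ 4) (3 * n) / qfac (w ^ 2) (3 * n)) / (qfac (w ^ 12) n / qfac (w ^ 6) n).
Proof.
  intros Hw. pose proof (pow_S_lt1 w 1 Hw) as H2. pose proof (pow_S_lt1 w 5 Hw) as H6.
  pose proof (pow_S_lt1 w 11 Hw) as H12. induction n; [simpl; field|].
  rewrite jtp_S, IHn. clear IHn.
  replace (3 * S n)%nat with (S (2 + 3 * n)) by lia.
  replace (S n) with (S (0 + 1 * n)) by lia. rewrite !qfac_step.
  change (2 + 3 * n)%nat with (S (1 + 3 * n)). rewrite !qfac_step.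
  change (1 + 3 * n)%nat with (S (0 + 3 * n)). rewrite !qfac_step.
  replace (0 + 3 * n)%nat with (3 * n)%nat by lia. replace (0 + 1 * n)%nat with n by lia.
  rewrite <- (pow_mult w 3 2), (pow_powl w _ n).
  pose proof (qfac_pos _ (3 * n) H2). pose proof (qfac_pos _ n H6). pose proof (qfac_pos _ n H12).
  pose proof (fun a => pow_mix_lt1 w n (S a) 6 Hw ltac:(lia)) as HP.
  pose proof (HP 1%nat). pose proof (HP 3%nat). pose proof (HP 5%nat). clear HP.
  pose proof (pow_mix_lt1 w n 12 12 Hw ltac:(lia)).
  cbn [Nat.mul Nat.add] in *.
  assert (0 < w ^ 4) by (apply pow_lt; lra).
  field. repeat split; lra.
Qed.

Lemma thetaC_eta w : 0 < w < 1 ->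
  thetaC w = qinf (w ^ 6) * ((qinf (w ^ 4) / qinf (w ^ 2)) / (qinf (w ^ 12) / qinf (w ^ 6))).
Proof.
  intros Hw. pose proof (pow_S_lt1 w 1 Hw) as H2. pose proof (pow_S_lt1 w 2 Hw) as H3.
  pose proof (pow_S_lt1 w 3 Hw) as H4. pose proof (pow_S_lt1 w 5 Hw) as H6.
  pose proof (pow_S_lt1 w 11 Hw) as H12.
  pose proof (qinf_pos _ H2). pose proof (qinf_pos _ H12). pose proof (qinf_pos _ H6).
  unfold thetaC. rewrite (tsum_ext _ (fun j => (w ^ 3) ^^ (j * j - j) * (w ^ 4) ^^ j)).
  - rewrite (tsum_from_jtp (w ^ 3) (w ^ 4) ((qinf (w ^ 4) / qinf (w ^ 2)) / (qinf (w ^ 12) / qinf (w ^ 6))));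
      [now rewrite <- (pow_mult w 3 2) | easy | lra |].
    apply is_lim_seq_ext with (fun n =>
      (qfac (w ^ 4) (3 * n) / qfac (w ^ 2) (3 * n)) / (qfac (w ^ 12) n / qfac (w ^ 6) n)).
    + intros n. now rewrite thetaC_jtp.
    + apply is_lim_seq_quot; [apply is_lim_seq_quot| apply is_lim_seq_quot |]; try easy;
        try (now apply (qfac_lim_mult _ 2)); try (now apply qinf_lim).
      now apply Rdiv_lt_0_compat.
  - intros j. rewrite !powerRZ_powl.
    pw w (3 * (j * j) + j)%Z (j * j + j * j + j * j + j)%Z. pw w (j * j - j)%Z (j * j + - j)%Z.
    pw_expand w. field. nz.
Qed.

Lemma phi_pos x : 0 < x < 1 -> 0 < phi x.
Proof.
  intros Hx. pose proof (sq_lt1 x Hx) as H2. pose proof (qinf_pos _ Hx). pose proof (qinf_pos _ H2).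
  rewrite phi_eta by easy. apply Rdiv_lt_0_compat; [now apply pow_lt | easy].
Qed.

Lemma thetaB_pos r : 0 < r < 1 -> 0 < thetaB r.
Proof.
  intros Hr. pose proof (sq_lt1 r Hr) as H2. pose proof (sq_lt1 _ H2) as H4.
  pose proof (qinf_pos _ H2). pose proof (qinf_pos _ H4). rewrite thetaB_eta by easy.
  apply Rdiv_lt_0_compat; [|easy]. apply Rmult_lt_0_compat; [lra | now apply pow_lt].
Qed.

(** This ties the dissection of phi to that of psi: it turns the quotient f(q,q^2)/psi(q^3), with q
    = w^2, into phi(-q^3)/f(-q,-q^5), so that the same v governs both. *)
Lemma thetaN_thetaC w : 0 < w < 1 -> 2 * thetaN (w ^ 2) * thetaC w = phi ((w ^ 2) ^ 3) * thetaB (w ^ 3).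
Proof.
  intros Hw. pose proof (pow_S_lt1 w 1 Hw) as H2. pose proof (pow_S_lt1 w 2 Hw) as H3.
  pose proof (pow_S_lt1 w 3 Hw) as H4. pose proof (pow_S_lt1 w 5 Hw) as H6.
  pose proof (pow_S_lt1 w 11 Hw) as H12.
  pose proof (qinf_pos _ H2). pose proof (qinf_pos _ H4). pose proof (qinf_pos _ H12).
  pose proof (qinf_pos _ H6).
  rewrite thetaN_eta, thetaC_eta, thetaB_eta, phi_eta; try easy; [|now rewrite <- pow_mult].
  rewrite <- !pow_mult. cbn [Nat.mul Nat.add]. field. lra.
Qed.

(** In classical terms (q;q)^3 = phi(-q)^2 psi(q), and next (q^2;q^2)^3 = phi(-q) psi(q)^2, both
    infinite products. They convert the cubes produced by the Wronskians into phi and psi. *)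
Lemma qinf_cube q r : 0 < r < 1 -> q = r ^ 2 -> 2 * qinf q ^ 3 = phi q ^ 2 * thetaB r.
Proof.
  intros Hr ->. pose proof (sq_lt1 r Hr) as H2. pose proof (sq_lt1 _ H2) as H4.
  pose proof (qinf_pos _ H2). pose proof (qinf_pos _ H4).
  rewrite phi_eta, thetaB_eta by easy. field. lra.
Qed.

Lemma qinf_sq_cube q r : 0 < r < 1 -> q = r ^ 2 -> 4 * qinf (q ^ 2) ^ 3 = phi q * thetaB r ^ 2.
Proof.
  intros Hr ->. pose proof (sq_lt1 r Hr) as H2. pose proof (sq_lt1 _ H2) as H4.
  pose proof (qinf_pos _ H2). pose proof (qinf_pos _ H4).
  rewrite phi_eta, thetaB_eta by easy. field. lra.
Qed.

(** * Cubic dissections and sums over lattices *)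

(** The third class is written -1 - 3m because this is the mirror image of 3m + 1 under n -> -n, the
    symmetry of [phi], and of 3m under n -> -1 - n, the symmetry of [thetaB]. *)
Lemma tsum_mod3 (f : Z -> R) : summable f ->
  tsum f = tsum (fun m => f (3 * m)%Z) + tsum (fun m => f (3 * m + 1)%Z)
         + tsum (fun m => f (-1 - 3 * m)%Z).
Proof.
  intros H. set (f' := restrict (fun n => negb (n mod 3 =? 0)%Z) f).
  assert (H' : summable f') by now apply summable_restrict.
  rewrite (tsum_restrict (fun n => n mod 3 =? 0)%Z f H).
  fold f'. rewrite (tsum_restrict (fun n => n mod 3 =? 1)%Z f' H').
  rewrite Rplus_assoc. f_equal; [|f_equal].
  - apply tsum_restrict_param; try easy; [intros; lia | |].
    + intros u. apply Z.eqb_eq. rewrite Z.mul_comm. apply Z_mod_mult.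
    + intros t Ht. apply Z.eqb_eq in Ht. exists (t / 3)%Z. pose proof (Z_div_mod_eq_full t 3). lia.
  - rewrite (tsum_restrict_param _ (fun m => 3 * m + 1)%Z); [|intros; lia | | |easy].
    + apply tsum_ext. intros m. unfold f', restrict.
      replace ((3 * m + 1) mod 3)%Z with 1%Z; [easy|]. apply Z.mod_unique with m; lia.
    + intros m. apply Z.eqb_eq. symmetry. apply Z.mod_unique with m; lia.
    + intros t Ht. apply Z.eqb_eq in Ht. exists (t / 3)%Z. pose proof (Z_div_mod_eq_full t 3). lia.
  - rewrite (tsum_supp (fun m => -1 - 3 * m)%Z); [|intros; lia | |now apply summable_restrict].
    + apply tsum_ext. intros m. unfold f', restrict.
      replace ((-1 - 3 * m) mod 3)%Z with 2%Z; [easy|]. apply Z.mod_unique with (- m - 1)%Z; lia.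
    + intros t Ht. exists (- (t / 3) - 1)%Z. unfold f', restrict in Ht.
      pose proof (Z_div_mod_eq_full t 3). pose proof (Z.mod_pos_bound t 3 ltac:(lia)).
      destruct (Z.eqb_spec (t mod 3) 0); destruct (Z.eqb_spec (t mod 3) 1); simpl in Ht; try easy; lia.
Qed.

Lemma powerRZ_powerRZ q m n : 0 < q -> q ^^ (m * n) = (q ^^ m) ^^ n.
Proof.
  intros Hq. rewrite !powerRZ_Rpower; [|easy|now apply powerRZ_lt|easy].
  now rewrite Rpower_mult, mult_IZR.
Qed.

Lemma summable_gauss_lin (c : Z -> R) q (a : nat) b : 0 < q < 1 -> expb Z.abs_nat c -> (0 < a)%nat ->
  summable (fun n => c n * q ^^ (Z.of_nat a * (n * n) + b * n)).
Proof.
  intros Hq Hc Ha.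
  apply summable_ext with (fun n => (c n * (q ^^ b) ^^ n) * (q ^ a) ^^ (n * n)).
  - intros n. rewrite powerRZ_add, (powerRZ_powerRZ q (Z.of_nat a)), (powerRZ_powerRZ q b), powerRZ_of_nat by lra.
    ring.
  - apply summable_gauss; [now apply pow_lt1|]. apply expb_mult; [easy|].
    apply expb_powerRZ. apply powerRZ_NOR. lra.
Qed.

Lemma summable_phi x (c : Z -> R) : 0 < x < 1 -> expb Z.abs_nat c ->
  summable (fun n => c n * x ^^ (n * n)).
Proof. apply summable_gauss. Qed.

Lemma summable_thetaB x (c : Z -> R) : 0 < x < 1 -> expb Z.abs_nat c ->
  summable (fun n => c n * x ^^ (n * n + n)).
Proof.
  intros Hx Hc. eapply summable_ext; [|apply (summable_gauss_lin c x 1 1 Hx Hc); lia].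
  intros n. cbv beta. do 2 f_equal. lia.
Qed.

Lemma expb_sgn : expb Z.abs_nat (powerRZ (-1)).
Proof. apply expb_powerRZ; lra. Qed.

Lemma powerRZ_3 q (m : Z) : q <> 0 -> q ^^ (3 * m) = q ^^ m ^ 3.
Proof. intros Hq. pw q (3 * m)%Z (m + m + m)%Z. rewrite !powerRZ_add by easy. ring. Qed.

Lemma sgn_cases m : (-1) ^^ m = 1 \/ (-1) ^^ m = -1.
Proof. pose proof (powerRZ_m1_sq m). assert (((-1) ^^ m - 1) * ((-1) ^^ m + 1) = 0) by lra.
  apply Rmult_integral in H0. lra. Qed.

Lemma sgn_3 m : (-1) ^^ (3 * m) = (-1) ^^ m.
Proof. rewrite powerRZ_3 by lra. destruct (sgn_cases m) as [-> | ->]; ring. Qed.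

Lemma phi_dissection s : 0 < s < 1 -> phi s = phi ((s ^ 3) ^ 3) - 2 * s * thetaN (s ^ 3).
Proof.
  intros Hs. pose proof (pow_S_lt1 s 2 Hs) as H3.
  unfold phi at 1. rewrite tsum_mod3 by (apply summable_phi; [easy | apply expb_sgn]).
  rewrite (tsum_ext (fun m => (-1) ^^ (3 * m) * _)
    (fun m => (-1) ^^ m * ((s ^ 3) ^ 3) ^^ (m * m))).
  2: { intros m. rewrite sgn_3, !powerRZ_powl. f_equal.
       pw s (3 * m * (3 * m))%Z (3 * (3 * (m * m)))%Z. now rewrite !powerRZ_3 by lra. }
  assert (E : summable (fun m => (-1) ^^ m * (s ^ 3) ^^ (3 * (m * m) + 2 * m))).
  { apply (summable_gauss_lin _ (s ^ 3) 3 2 H3 expb_sgn). lia. }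
  rewrite (tsum_ext (fun m => (-1) ^^ (3 * m + 1) * _)
    (fun m => - s * ((-1) ^^ m * (s ^ 3) ^^ (3 * (m * m) + 2 * m)))).
  2: { intros m. rewrite powerRZ_add, sgn_3, powerRZ_1r, !powerRZ_powl by lra.
       pw s ((3 * m + 1) * (3 * m + 1))%Z (3 * (3 * (m * m) + 2 * m) + 1)%Z.
       rewrite (powerRZ_add s), (powerRZ_3 s (3 * (m * m) + 2 * m)), powerRZ_1r by lra. ring. }
  rewrite (tsum_ext (fun m => (-1) ^^ (-1 - 3 * m) * _)
    (fun m => - s * ((-1) ^^ m * (s ^ 3) ^^ (3 * (m * m) + 2 * m)))).
  2: { intros m. pw (-1) (-1 - 3 * m)%Z (- (3 * m + 1))%Z.
       rewrite powerRZ_m1_opp, powerRZ_add, sgn_3, powerRZ_1r, !powerRZ_powl by lra.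
       pw s ((-1 - 3 * m) * (-1 - 3 * m))%Z (3 * (3 * (m * m) + 2 * m) + 1)%Z.
       rewrite (powerRZ_add s), (powerRZ_3 s (3 * (m * m) + 2 * m)), powerRZ_1r by lra. ring. }
  rewrite tsum_scal by easy. fold (phi ((s ^ 3) ^ 3)). fold (thetaN (s ^ 3)). ring.
Qed.

Lemma thetaB_dissection u : 0 < u < 1 -> thetaB u = u ^ 2 * thetaB ((u ^ 3) ^ 3) + 2 * thetaC (u ^ 3).
Proof.
  intros Hu. pose proof (pow_S_lt1 u 2 Hu) as H3. pose proof (pow_S_lt1 _ 2 H3) as H9.
  assert (HS : forall x, 0 < x < 1 -> summable (fun n => x ^^ (n * n + n))).
  { intros x Hx. apply summable_ext with (fun n => 1 * x ^^ (n * n + n)); [intros; ring|].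
    apply summable_thetaB; [easy | apply expb_one]. }
  unfold thetaB at 1. rewrite tsum_mod3 by now apply HS.
  assert (E : (fun m => u ^^ (3 * m * (3 * m) + 3 * m)) = (fun m => (u ^ 3) ^^ (3 * (m * m) + m))).
  { apply functional_extensionality. intros m. rewrite powerRZ_powl, <- powerRZ_3 by lra. f_equal. ring. }
  rewrite E.
  rewrite (tsum_ext (fun m => u ^^ ((-1 - 3 * m) * (-1 - 3 * m) + (-1 - 3 * m)))
    (fun m => (u ^ 3) ^^ (3 * (m * m) + m))).
  2: { intros m. rewrite <- (f_equal (fun f => f m) E). f_equal. ring. }
  rewrite (tsum_ext (fun m => u ^^ ((3 * m + 1) * (3 * m + 1) + (3 * m + 1)))
    (fun m => u ^ 2 * ((u ^ 3) ^ 3) ^^ (m * m + m))).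
  2: { intros m. rewrite !powerRZ_powl, <- !powerRZ_3 by nz.
       rewrite <- (powerRZ_of_nat u 2), <- powerRZ_add by lra. f_equal. lia. }
  rewrite tsum_scal by now apply HS. fold (thetaC (u ^ 3)). fold (thetaB ((u ^ 3) ^ 3)). ring.
Qed.

Definition thetaJ (r : R) : R := tsum (fun n : Z => (2 * IZR n + 1) * (-1) ^^ n * r ^^ (n * n + n)).

Lemma thetaJ_eta r : 0 < r < 1 -> thetaJ r = 2 * qinf (r ^ 2) ^ 3.
Proof.
  intros Hr. set (f := fun j => IZR j * (r ^^ (j * j - j) * (-1) ^^ j)).
  assert (Hf : summable f).
  { apply summable_ext with (fun j => (IZR j * (-1) ^^ j) * r ^^ (Z.of_nat 1 * (j * j) + -1 * j)).
    - intros j. unfold f. pw r (Z.of_nat 1 * (j * j) + -1 * j)%Z (j * j - j)%Z. ring.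
    - apply summable_gauss_lin; [easy | apply expb_mult; [apply expb_IZR | apply expb_sgn] | lia]. }
  pose proof (jacobi_cube r Hr) as HJ. fold f in HJ.
  pose proof (tsum_Z_shift f 1 Hf) as H1. pose proof (tsum_Z_reflect f 0 Hf) as H2.
  rewrite HJ in H1, H2. unfold thetaJ.
  (* Splitting 2n + 1 = (n + 1) + n gives one shifted and one reflected copy of the series of
     [jacobi_cube], which is why the total is twice the cube. *)
  rewrite (tsum_ext _ (fun n => -1 * f (n + 1)%Z + -1 * f (0 - n)%Z)).
  - rewrite tsum_plus, !tsum_scal; try apply summable_scal.
    + rewrite H1, H2. ring.
    + now apply summable_Z_reflect.
    + now apply summable_Z_shift.
    + now apply summable_Z_shift.
    + now apply summable_Z_reflect.
  - intros n. unfold f. pw r ((n + 1) * (n + 1) - (n + 1))%Z (n * n + n)%Z.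
    pw r ((0 - n) * (0 - n) - (0 - n))%Z (n * n + n)%Z.
    pw (-1) (0 - n)%Z (- n)%Z. rewrite powerRZ_m1_opp, (powerRZ_add (-1)), powerRZ_1r, plus_IZR, minus_IZR by lra.
    ring.
Qed.

(** The image of [phi] under x d/dx, term by term. This operator maps phi(x^3) to 3 dphi(x^3), the
    source of the factors 3 in the Wronskians. *)
Definition dphi (x : R) : R := tsum (fun n : Z => IZR n ^ 2 * (-1) ^^ n * x ^^ (n * n)).
Definition dthetaB (r : R) : R := tsum (fun n : Z => (IZR n ^ 2 + IZR n) * r ^^ (n * n + n)).

Lemma summable_lattice (f : Z * Z -> R) q : 0 < q < 1 -> expb size2 f ->
  summable (fun x => f x * q ^^ (fst x * fst x + 3 * (snd x * snd x))).
Proof.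
  intros Hq Hf. eapply summable_ext; [|apply (summable_gauss2 f q (q ^ 3) Hq (pow_S_lt1 q 2 Hq) Hf)].
  intros [m n]. simpl fst; simpl snd. rewrite powerRZ_powl, <- powerRZ_3, <- powerRZ_add by lra. easy.
Qed.

Lemma summable_lattice2 (f : Z * Z -> R) q : 0 < q < 1 -> expb size2 f ->
  summable (fun x => f x * q ^^ (fst x * fst x + fst x + 3 * (snd x * snd x + snd x) + 1)).
Proof.
  intros Hq Hf.
  apply summable_ext with (fun x => (f x * (q ^^ (fst x) * (q ^ 3) ^^ (snd x) * q)) *
    q ^^ (fst x * fst x + 3 * (snd x * snd x))).
  - intros [m n]. simpl fst; simpl snd.
    rewrite powerRZ_powl, <- powerRZ_3 by lra.
    pw q (m * m + m + 3 * (n * n + n) + 1)%Z (m * m + 3 * (n * n) + m + 3 * n + 1)%Z.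
    rewrite (powerRZ_add q (m * m + 3 * (n * n) + m + 3 * n)), (powerRZ_add q (m * m + 3 * (n * n) + m)),
      (powerRZ_add q (m * m + 3 * (n * n))), powerRZ_1r by lra. ring.
  - apply summable_lattice; [easy|]. apply expb_mult; [easy|].
    apply expb_mult; [apply expb_mult|apply expb_const].
    + apply (expb_comp Z.abs_nat size2 fst _ 1); [intros [? ?]; unfold size2; simpl; lia|].
      apply expb_powerRZ; lra.
    + apply (expb_comp Z.abs_nat size2 snd _ 1); [intros [? ?]; unfold size2; simpl; lia|].
      apply expb_powerRZ. apply pow_nonzero; lra.
Qed.

Lemma expb_fst (c : Z -> R) : expb Z.abs_nat c -> expb size2 (fun x => c (fst x)).
Proof. apply (expb_comp Z.abs_nat size2 fst c 1). intros [? ?]; unfold size2; simpl; lia. Qed.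

Lemma expb_snd (c : Z -> R) : expb Z.abs_nat c -> expb size2 (fun x => c (snd x)).
Proof. apply (expb_comp Z.abs_nat size2 snd c 1). intros [? ?]; unfold size2; simpl; lia. Qed.

Ltac expb_tac := repeat (apply expb_mult || apply expb_minus || apply expb_plus || apply expb_const
  || apply expb_IZR || apply expb_sgn || (apply (expb_fst IZR)) || (apply (expb_snd IZR))
  || (apply (expb_fst (powerRZ (-1)))) || (apply (expb_snd (powerRZ (-1))))).

Lemma tsum_parity (F : Z * Z -> R) (g1 g2 : Z * Z -> Z * Z) :
  (forall u v, g1 u = g1 v -> u = v) -> (forall u v, g2 u = g2 v -> u = v) ->
  (forall u, Z.even (fst (g1 u) + snd (g1 u)) = true) ->
  (forall u, Z.even (fst (g2 u) + snd (g2 u)) = false) ->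
  (forall t, Z.even (fst t + snd t) = true -> exists u, g1 u = t) ->
  (forall t, Z.even (fst t + snd t) = false -> exists u, g2 u = t) ->
  summable F -> tsum F = tsum (fun u => F (g1 u)) + tsum (fun u => F (g2 u)).
Proof.
  intros I1 I2 P1 P2 S1 S2 H.
  rewrite (tsum_restrict (fun t => Z.even (fst t + snd t)) F H). f_equal.
  - now apply tsum_restrict_param.
  - apply tsum_restrict_param; try easy.
    + intros u. now rewrite P2.
    + intros t Ht. apply S2. now destruct (Z.even _).
Qed.

Lemma even_lin (a b c : Z) : (a = 2 * c + b)%Z -> Z.even a = Z.even b.
Proof. intros ->. rewrite Z.even_add, Z.even_mul. simpl. now destruct (Z.even b). Qed.

(** * Two Wronskians *)

(** Coordinates in the ring Z[w] with w = (-1 + sqrt(-3))/2. An index (m, n) of [theta2] stands for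
    m + n sqrt(-3), one of [theta2'] for ((2m+1) + (2n+1) sqrt(-3))/2, and the exponent is the norm.
    On the latter, [evmap] lists the elements beta with 2m + 1 congruent to 2n + 1 mod 4, and
    [odmap] lists their conjugates. Multiplication by w sends beta to -(u + n) + n sqrt(-3): this is
    [rotmap], and it reaches exactly the elements m + n sqrt(-3) with m + n odd. *)
Definition evmap (x : Z * Z) : Z * Z := (snd x + 2 * fst x, snd x)%Z.
Definition odmap (x : Z * Z) : Z * Z := (snd x + 2 * fst x, -1 - snd x)%Z.
Definition rotmap (x : Z * Z) : Z * Z := (- (2 * snd x + 1) - fst x, fst x)%Z.

(* [q ^ (|beta|^2)] where [beta = ((u + 4 n) + u sqrt(-3)) / 2], [u = 2 l + 1]. *)
Definition kap (q : R) (x : Z * Z) : R :=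
  q ^^ (let u := (2 * snd x + 1)%Z in let n := fst x in u * u + 2 * u * n + 4 * (n * n))%Z.

Definition theta2 (q : R) (x : Z * Z) : R := q ^^ (fst x * fst x + 3 * (snd x * snd x)).
Definition theta2' (q : R) (x : Z * Z) : R :=
  q ^^ (fst x * fst x + fst x + 3 * (snd x * snd x + snd x) + 1).

Lemma evmap_inj u v : evmap u = evmap v -> u = v.
Proof. destruct u, v; unfold evmap; cbn [fst snd]; intros E; apply pair_equal_spec in E; f_equal; lia. Qed.
Lemma odmap_inj u v : odmap u = odmap v -> u = v.
Proof. destruct u, v; unfold odmap; cbn [fst snd]; intros E; apply pair_equal_spec in E; f_equal; lia. Qed.
Lemma rotmap_inj u v : rotmap u = rotmap v -> u = v.
Proof. destruct u, v; unfold rotmap; cbn [fst snd]; intros E; apply pair_equal_spec in E; f_equal; lia. Qed.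

Lemma evmap_even u : Z.even (fst (evmap u) + snd (evmap u)) = true.
Proof. destruct u as [n l]; unfold evmap; cbn [fst snd]. rewrite (even_lin _ 0 (l + n)) by lia. easy. Qed.
Lemma odmap_odd u : Z.even (fst (odmap u) + snd (odmap u)) = false.
Proof. destruct u as [n l]; unfold odmap; cbn [fst snd]. rewrite (even_lin _ (-1) n) by lia. easy. Qed.
Lemma rotmap_odd u : Z.even (fst (rotmap u) + snd (rotmap u)) = false.
Proof. destruct u as [n l]; unfold rotmap; cbn [fst snd]. rewrite (even_lin _ (-1) (- l)) by lia. easy. Qed.

Lemma evmap_surj t : Z.even (fst t + snd t) = true -> exists u, evmap u = t.
Proof.
  destruct t as [k l]; cbn [fst snd]. intros H. apply Z.even_spec in H. destruct H as [c Hc].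
  exists (c - l, l)%Z. unfold evmap; cbn [fst snd]. f_equal; lia.
Qed.

Lemma odd_ex z : Z.even z = false -> exists c, (z = 2 * c + 1)%Z.
Proof.
  intros H. rewrite <- Z.negb_odd in H. apply Z.odd_spec.
  now destruct (Z.odd z).
Qed.

Lemma odmap_surj t : Z.even (fst t + snd t) = false -> exists u, odmap u = t.
Proof.
  destruct t as [k l]; cbn [fst snd]. intros H. apply odd_ex in H. destruct H as [c Hc].
  exists (c + 1, -1 - l)%Z. unfold odmap; cbn [fst snd]. f_equal; lia.
Qed.

Lemma rotmap_surj t : Z.even (fst t + snd t) = false -> exists u, rotmap u = t.
Proof.
  destruct t as [k l]; cbn [fst snd]. intros H. apply odd_ex in H. destruct H as [c Hc].
  exists (l, - c - 1)%Z. unfold rotmap; cbn [fst snd]. f_equal; lia.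
Qed.

Lemma tsum_evod (F : Z * Z -> R) : summable F ->
  tsum F = tsum (fun u => F (evmap u)) + tsum (fun u => F (odmap u)).
Proof.
  apply tsum_parity; auto using evmap_inj, odmap_inj, evmap_even, odmap_odd, evmap_surj, odmap_surj.
Qed.

Lemma tsum_evrot (F : Z * Z -> R) : summable F ->
  tsum F = tsum (fun u => F (evmap u)) + tsum (fun u => F (rotmap u)).
Proof.
  apply tsum_parity; auto using evmap_inj, rotmap_inj, evmap_even, rotmap_odd, evmap_surj, rotmap_surj.
Qed.

Lemma theta2'_ev q x : theta2' q (evmap x) = kap q x.
Proof. destruct x as [n l]. unfold theta2', kap, evmap. cbn [fst snd]. f_equal. ring. Qed.
Lemma theta2'_od q x : theta2' q (odmap x) = kap q x.
Proof. destruct x as [n l]. unfold theta2', kap, odmap. cbn [fst snd]. f_equal. ring. Qed.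
Lemma theta2_rot q x : theta2 q (rotmap x) = kap q x.
Proof. destruct x as [n l]. unfold theta2, kap, rotmap. cbn [fst snd]. f_equal. ring. Qed.

Lemma summable_kap (F : Z * Z -> R) q : 0 < q < 1 -> expb size2 F ->
  summable (fun x => F (evmap x) * kap q x).
Proof.
  intros Hq HF. pose proof (summable_lattice2 F q Hq HF) as H.
  apply (summable_comp evmap) in H; [|apply evmap_inj].
  eapply summable_ext; [|exact H]. intros x. cbv beta.
  now rewrite <- theta2'_ev.
Qed.

Definition rN (x : Z * Z) : R := IZR (fst x).
Definition rU (x : Z * Z) : R := 2 * IZR (snd x) + 1.

Lemma summable_kap_poly q (a b c : R) : 0 < q < 1 ->
  summable (fun x => (a * rU x ^ 2 + b * (rU x * rN x) + c * rN x ^ 2) * kap q x).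
Proof.
  intros Hq. set (U := fun x : Z * Z => 2 * IZR (snd x) + 1).
  (* Growth is measured on the image point, whose coordinates are l + 2n and l; n is recovered as
     half their difference. *)
  set (W := fun x : Z * Z => (IZR (fst x) - IZR (snd x)) * / 2).
  eapply summable_ext; [|apply (summable_kap
    (fun x => a * (U x * U x) + b * (U x * W x) + c * (W x * W x)) q Hq)].
  - intros [n l]. unfold U, W, rU, rN, evmap; cbn [fst snd].
    rewrite plus_IZR, mult_IZR. f_equal. field.
  - unfold U, W. expb_tac.
Qed.

(* [n (u + n)] changes sign under the reflection [(m, n) -> (m, - n)] of [m + n sqrt(-3)]. *)
Lemma kap_antisym q : 0 < q < 1 -> tsum (fun x => (rU x * rN x + rN x ^ 2) * kap q x) = 0.
Proof.
  intros Hq.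
  assert (HS : summable (fun x => (rU x * rN x + rN x ^ 2) * kap q x)).
  { eapply summable_ext; [|apply (summable_kap_poly q 0 1 1 Hq)]. intros x; simpl; ring. }
  pose proof (tsum_bij (fun x : Z * Z => (- fst x, snd x + fst x)%Z)
    (fun x : Z * Z => (- fst x, snd x + fst x)%Z) _
    ltac:(intros [? ?]; simpl; f_equal; lia) ltac:(intros [? ?]; simpl; f_equal; lia) HS) as H.
  cbv beta in H.
  rewrite (tsum_ext (fun u : Z * Z => _ * kap q (- fst u, snd u + fst u)%Z)
    (fun x => -1 * ((rU x * rN x + rN x ^ 2) * kap q x))) in H.
  - rewrite tsum_scal in H by easy. lra.
  - intros [n l]. unfold rU, rN, kap; cbn [fst snd].
    replace ((2 * (l + n) + 1) * (2 * (l + n) + 1) + 2 * (2 * (l + n) + 1) * - n + 4 * (- n * - n))%Z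
      with ((2 * l + 1) * (2 * l + 1) + 2 * (2 * l + 1) * n + 4 * (n * n))%Z by ring.
    rewrite plus_IZR, opp_IZR. ring.
Qed.

(** Second moments of the norm form in the coordinates (u, n). The Wronskians and the product of two
    [thetaJ] are combinations of the three, and the single relation [kap_rel] makes them
    proportional. *)
Definition kU2 (q : R) : R := tsum (fun x => rU x ^ 2 * kap q x).
Definition kUN (q : R) : R := tsum (fun x => rU x * rN x * kap q x).
Definition kN2 (q : R) : R := tsum (fun x => rN x ^ 2 * kap q x).

Lemma tsum_kap_poly q (a b c : R) (f : Z * Z -> R) : 0 < q < 1 ->
  (forall x, f x = a * rU x ^ 2 + b * (rU x * rN x) + c * rN x ^ 2) ->
  tsum (fun x => f x * kap q x) = a * kU2 q + b * kUN q + c * kN2 q.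
Proof.
  intros Hq Hf.
  assert (H1 : summable (fun x => rU x ^ 2 * kap q x)).
  { eapply summable_ext; [|apply (summable_kap_poly q 1 0 0 Hq)]. intros x; simpl; ring. }
  assert (H2 : summable (fun x => rU x * rN x * kap q x)).
  { eapply summable_ext; [|apply (summable_kap_poly q 0 1 0 Hq)]. intros x; simpl; ring. }
  assert (H3 : summable (fun x => rN x ^ 2 * kap q x)).
  { eapply summable_ext; [|apply (summable_kap_poly q 0 0 1 Hq)]. intros x; simpl; ring. }
  rewrite (tsum_ext _ (fun x => a * (rU x ^ 2 * kap q x) + (b * (rU x * rN x * kap q x) +
    c * (rN x ^ 2 * kap q x)))) by (intros x; rewrite Hf; ring).
  rewrite !tsum_plus, !tsum_scal; try (apply summable_plus); try (apply summable_scal); try easy.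
  unfold kU2, kUN, kN2. ring.
Qed.

Lemma kap_rel q : 0 < q < 1 -> kN2 q = - kUN q.
Proof.
  intros Hq. pose proof (kap_antisym q Hq) as H.
  rewrite (tsum_kap_poly q 0 1 1) in H by (easy || intros; ring). lra.
Qed.

(* The form [n^2 + a n + a^2] is invariant under an order 3 rotation, whose orbits have weight 0. *)
Lemma theta2_even_zero q : 0 < q < 1 ->
  tsum (fun x => (fun x => IZR (fst x) ^ 2 - 3 * IZR (snd x) ^ 2) (evmap x) * theta2 q (evmap x)) = 0.
Proof.
  intros Hq.
  set (f := fun x : Z * Z => _).
  assert (HS : summable f).
  { apply (summable_comp evmap (fun x => (IZR (fst x) ^ 2 - 3 * IZR (snd x) ^ 2) * theta2 q x));
      [apply evmap_inj|].
    eapply summable_ext; [|apply (summable_lattice (fun x => IZR (fst x) * IZR (fst x) -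
      3 * (IZR (snd x) * IZR (snd x))) q Hq)].
    - intros x. unfold theta2. f_equal. ring.
    - expb_tac. }
  set (T := fun x : Z * Z => (- snd x - fst x, fst x)%Z).
  set (T' := fun x : Z * Z => (snd x, - snd x - fst x)%Z).
  assert (H1 : tsum f = tsum (fun x => f (T x))).
  { apply (tsum_bij T T'); [| |easy]; intros [? ?]; unfold T, T'; cbn [fst snd]; f_equal; lia. }
  assert (H2 : tsum f = tsum (fun x => f (T' x))).
  { apply (tsum_bij T' T); [| |easy]; intros [? ?]; unfold T, T'; cbn [fst snd]; f_equal; lia. }
  assert (S1 : summable (fun x => f (T x))).
  { apply (summable_comp T f); [|easy]. intros [? ?] [? ?]; unfold T; cbn [fst snd]; intros E; apply pair_equal_spec in E; f_equal; lia. }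
  assert (S2 : summable (fun x => f (T' x))).
  { apply (summable_comp T' f); [|easy]. intros [? ?] [? ?]; unfold T'; cbn [fst snd]; intros E; apply pair_equal_spec in E; f_equal; lia. }
  assert (H : tsum (fun x => f x + (f (T x) + f (T' x))) = 0).
  { rewrite (tsum_ext _ (fun _ => 0 * 0)).
    - rewrite tsum_scal; [ring|]. exists 0. intros s _.
      rewrite lsum_zero; [lra|]. intros; apply Rabs_R0.
    - intros [a n]. unfold f, T, T', evmap, theta2; cbn [fst snd].
      set (e := (4 * (n * n) + 4 * (a * n) + 4 * (a * a))%Z).
      replace ((n + 2 * a) * (n + 2 * a) + 3 * (n * n))%Z with e by (unfold e; ring).
      replace ((a + 2 * (- n - a)) * (a + 2 * (- n - a)) + 3 * (a * a))%Z with e by (unfold e; ring).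
      replace ((- n - a + 2 * n) * (- n - a + 2 * n) + 3 * ((- n - a) * (- n - a)))%Z with e by (unfold e; ring).
      rewrite !plus_IZR, !mult_IZR, !minus_IZR, !opp_IZR. ring. }
  rewrite !tsum_plus, <- H1, <- H2 in H; try easy; [lra | now apply summable_plus].
Qed.

Lemma wronskian_phi_sum q : 0 < q < 1 ->
  phi (q ^ 3) * dphi q - 3 * phi q * dphi (q ^ 3) =
  tsum (fun x => ((-1) ^^ (fst x) * (-1) ^^ (snd x) *
    (IZR (fst x) ^ 2 - 3 * IZR (snd x) ^ 2)) * theta2 q x).
Proof.
  intros Hq. pose proof (pow_S_lt1 q 2 Hq) as H3.
  assert (S1 : forall p, 0 < p < 1 -> summable (fun n => (-1) ^^ n * p ^^ (n * n))).
  { intros p Hp. apply summable_phi; [easy | apply expb_sgn]. }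
  assert (S2 : forall p, 0 < p < 1 -> summable (fun n => IZR n ^ 2 * (-1) ^^ n * p ^^ (n * n))).
  { intros p Hp. apply summable_phi; [easy|]. apply expb_mult; [|apply expb_sgn].
    apply expb_ext with (fun n => IZR n * IZR n); [intros; ring|]. expb_tac. }
  replace (phi (q ^ 3) * dphi q) with (dphi q * phi (q ^ 3)) by ring. rewrite Rmult_assoc.
  unfold phi, dphi. rewrite <- !tsum_prod by (apply S1 || apply S2; easy).
  rewrite <- tsum_scal, <- tsum_minus.
  - apply tsum_ext. intros [m n]. unfold theta2; cbn [fst snd].
    rewrite powerRZ_add, powerRZ_3, !powerRZ_powl by lra. ring.
  - apply (summable_prod (fun n => IZR n ^ 2 * (-1) ^^ n * q ^^ (n * n))
      (fun n => (-1) ^^ n * (q ^ 3) ^^ (n * n))); auto.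
  - apply summable_scal, (summable_prod (fun n => (-1) ^^ n * q ^^ (n * n))
      (fun n => IZR n ^ 2 * (-1) ^^ n * (q ^ 3) ^^ (n * n))); auto.
  - apply (summable_prod (fun n => (-1) ^^ n * q ^^ (n * n))
      (fun n => IZR n ^ 2 * (-1) ^^ n * (q ^ 3) ^^ (n * n))); auto.
Qed.

(** The extra q completes the exponent to ((2m+1)^2 + 3(2n+1)^2)/4. Conjugation changes both the
    sign of 2n + 1 and that of (-1)^(m+n), so the two halves contribute the same weight u(u +
    4n). *)
Lemma thetaJ_prod_sum q : 0 < q < 1 ->
  q * thetaJ q * thetaJ (q ^ 3) = 2 * kU2 q + 8 * kUN q.
Proof.
  intros Hq. pose proof (pow_S_lt1 q 2 Hq) as H3.
  assert (S1 : forall p, 0 < p < 1 ->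
    summable (fun n => (2 * IZR n + 1) * (-1) ^^ n * p ^^ (n * n + n))).
  { intros p Hp. apply summable_thetaB; [easy|]. expb_tac. }
  rewrite Rmult_assoc. unfold thetaJ. rewrite <- tsum_prod by now apply S1.
  rewrite <- tsum_scal by (apply (summable_prod
    (fun n => (2 * IZR n + 1) * (-1) ^^ n * q ^^ (n * n + n))
    (fun n => (2 * IZR n + 1) * (-1) ^^ n * (q ^ 3) ^^ (n * n + n))); auto).
  set (c := fun x : Z * Z => (2 * IZR (fst x) + 1) * (2 * IZR (snd x) + 1) *
    ((-1) ^^ (fst x) * (-1) ^^ (snd x))).
  rewrite (tsum_ext _ (fun x => c x * theta2' q x)).
  2: { intros [m n]. unfold c, theta2'; cbn [fst snd].
       rewrite powerRZ_powl, <- powerRZ_3 by lra.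
       rewrite (powerRZ_add q (m * m + m + 3 * (n * n + n))), (powerRZ_add q (m * m + m)), powerRZ_1r by lra.
       ring. }
  rewrite tsum_evod.
  - rewrite (tsum_ext (fun u => c (evmap u) * _) (fun x => (rU x ^ 2 + 4 * (rU x * rN x)) * kap q x)).
    + rewrite (tsum_ext (fun u => c (odmap u) * _) (fun x => (rU x ^ 2 + 4 * (rU x * rN x)) * kap q x)).
      * rewrite !(tsum_kap_poly q 1 4 0) by (easy || intros; ring). ring.
      * intros x. rewrite theta2'_od. f_equal. destruct x as [n l].
        unfold c, odmap, rU, rN; cbn [fst snd].
        pw (-1) (l + 2 * n)%Z (l + n + n)%Z. pw (-1) (-1 - l)%Z (- (l + 1))%Z.
        rewrite powerRZ_m1_opp, !(powerRZ_add (-1)), powerRZ_1r, plus_IZR, minus_IZR, mult_IZR by lra.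
        destruct (sgn_cases l) as [-> | ->]; destruct (sgn_cases n) as [-> | ->]; ring.
    + intros x. rewrite theta2'_ev. f_equal. destruct x as [n l].
      unfold c, evmap, rU, rN; cbn [fst snd].
      pw (-1) (l + 2 * n)%Z (l + n + n)%Z.
      rewrite !(powerRZ_add (-1)), plus_IZR, mult_IZR by lra.
      destruct (sgn_cases l) as [-> | ->]; destruct (sgn_cases n) as [-> | ->]; ring.
  - apply summable_lattice2; [easy|]. unfold c. expb_tac.
Qed.

(** The sign (-1)^(m+n) separates the lattice by parity. The even half cancels by its rotation of
    order 3; the odd half is carried by [rotmap] to the half-integral elements, where the product of
    two [thetaJ] lives. *)
Lemma wronskian_phi q : 0 < q < 1 ->
  phi (q ^ 3) * dphi q - 3 * phi q * dphi (q ^ 3) = - (q * thetaJ q * thetaJ (q ^ 3)) / 2.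
Proof.
  intros Hq. rewrite wronskian_phi_sum, thetaJ_prod_sum by easy.
  set (w := fun x : Z * Z => IZR (fst x) ^ 2 - 3 * IZR (snd x) ^ 2).
  rewrite tsum_evrot.
  - rewrite (tsum_ext (fun u => _ * theta2 q (evmap u)) (fun x => w (evmap x) * theta2 q (evmap x))).
    + unfold w at 1. rewrite theta2_even_zero by easy.
      rewrite (tsum_ext _ (fun x => (- rU x ^ 2 - 2 * (rU x * rN x) + 2 * rN x ^ 2) * kap q x)).
      * rewrite (tsum_kap_poly q (-1) (-2) 2) by (easy || intros; ring).
        rewrite (kap_rel q Hq). field.
      * intros x. rewrite theta2_rot. f_equal. destruct x as [n l].
        unfold rotmap, rU, rN; cbn [fst snd].
        pw (-1) (- (2 * l + 1) - n)%Z (- (l + l + 1 + n))%Z.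
        rewrite powerRZ_m1_opp, !(powerRZ_add (-1)), powerRZ_1r, minus_IZR, opp_IZR, plus_IZR, mult_IZR by lra.
        destruct (sgn_cases l) as [-> | ->]; destruct (sgn_cases n) as [-> | ->]; ring.
    + intros [n l]. f_equal. unfold w, evmap; cbn [fst snd].
      pw (-1) (l + 2 * n)%Z (l + n + n)%Z. rewrite !(powerRZ_add (-1)) by lra.
      destruct (sgn_cases l) as [-> | ->]; destruct (sgn_cases n) as [-> | ->]; ring.
  - eapply summable_ext; [|apply (summable_lattice (fun x => (-1) ^^ (fst x) * (-1) ^^ (snd x) *
      (IZR (fst x) * IZR (fst x) - 3 * (IZR (snd x) * IZR (snd x)))) q Hq)].
    + intros x. unfold theta2. f_equal. ring.
    + expb_tac.
Qed.

(** Since 4(m^2 + m) = (2m+1)^2 - 1, the subtracted product is what completes the weight to (2m+1)^2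
    - 3(2n+1)^2. Multiplication by r then makes the exponent a norm. *)
Lemma wronskian_thetaB r : 0 < r < 1 ->
  4 * (thetaB (r ^ 3) * dthetaB r - 3 * thetaB r * dthetaB (r ^ 3)) - 2 * thetaB r * thetaB (r ^ 3)
  = - 2 * thetaJ r * thetaJ (r ^ 3).
Proof.
  intros Hr. pose proof (pow_S_lt1 r 2 Hr) as H3.
  assert (S1 : forall p, 0 < p < 1 -> summable (fun n => p ^^ (n * n + n))).
  { intros p Hp. apply summable_ext with (fun n => 1 * p ^^ (n * n + n)); [intros; ring|].
    apply summable_thetaB; [easy | apply expb_one]. }
  assert (S2 : forall p, 0 < p < 1 -> summable (fun n => (IZR n ^ 2 + IZR n) * p ^^ (n * n + n))).
  { intros p Hp. apply summable_thetaB; [easy|].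
    apply expb_ext with (fun n => IZR n * IZR n + IZR n); [intros; ring|]. expb_tac. }
  apply Rmult_eq_reg_l with r; [|lra].
  replace (r * (-2 * thetaJ r * thetaJ (r ^ 3))) with (-2 * (r * thetaJ r * thetaJ (r ^ 3))) by ring.
  rewrite thetaJ_prod_sum by easy.
  set (c := fun x : Z * Z => (2 * IZR (fst x) + 1) * (2 * IZR (fst x) + 1) -
    3 * ((2 * IZR (snd x) + 1) * (2 * IZR (snd x) + 1))).
  assert (P1 : summable (fun x : Z * Z => ((IZR (fst x) ^ 2 + IZR (fst x)) * r ^^ (fst x * fst x + fst x))
     * (r ^ 3) ^^ (snd x * snd x + snd x))).
  { apply (summable_prod (fun n => (IZR n ^ 2 + IZR n) * r ^^ (n * n + n))
      (fun n => (r ^ 3) ^^ (n * n + n))); auto. }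
  assert (P2 : summable (fun x : Z * Z => r ^^ (fst x * fst x + fst x) *
     ((IZR (snd x) ^ 2 + IZR (snd x)) * (r ^ 3) ^^ (snd x * snd x + snd x)))).
  { apply (summable_prod (fun n => r ^^ (n * n + n))
      (fun n => (IZR n ^ 2 + IZR n) * (r ^ 3) ^^ (n * n + n))); auto. }
  assert (P3 : summable (fun x : Z * Z => r ^^ (fst x * fst x + fst x) *
     (r ^ 3) ^^ (snd x * snd x + snd x))).
  { apply (summable_prod (fun n => r ^^ (n * n + n)) (fun n => (r ^ 3) ^^ (n * n + n))); auto. }
  replace (r * (4 * (thetaB (r ^ 3) * dthetaB r - 3 * thetaB r * dthetaB (r ^ 3)) - 2 * thetaB r * thetaB (r ^ 3)))
    with (4 * r * (dthetaB r * thetaB (r ^ 3)) + (-12 * r * (thetaB r * dthetaB (r ^ 3)) +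
      - 2 * r * (thetaB r * thetaB (r ^ 3)))) by ring.
  unfold thetaB, dthetaB. rewrite <- !tsum_prod by auto.
  rewrite <- !tsum_scal, <- !tsum_plus by
    (repeat (apply summable_plus || apply summable_scal); assumption).
  rewrite (tsum_ext _ (fun x => c x * theta2' r x)).
  2: { intros [m n]. unfold c, theta2'; cbn [fst snd].
       rewrite powerRZ_powl, <- powerRZ_3 by lra.
       rewrite (powerRZ_add r (m * m + m + 3 * (n * n + n))), (powerRZ_add r (m * m + m)), powerRZ_1r by lra.
       ring. }
  rewrite tsum_evod.
  - rewrite (tsum_ext (fun u => c (evmap u) * _)
      (fun x => (- 2 * rU x ^ 2 + 8 * (rU x * rN x) + 16 * rN x ^ 2) * kap r x)).
    + rewrite (tsum_ext (fun u => c (odmap u) * _)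
        (fun x => (- 2 * rU x ^ 2 + 8 * (rU x * rN x) + 16 * rN x ^ 2) * kap r x)).
      * rewrite !(tsum_kap_poly r (-2) 8 16) by (easy || intros; ring). rewrite (kap_rel r Hr). ring.
      * intros x. rewrite theta2'_od. f_equal. destruct x as [n l].
        unfold c, odmap, rU, rN; cbn [fst snd].
        rewrite plus_IZR, minus_IZR, mult_IZR. ring.
    + intros x. rewrite theta2'_ev. f_equal. destruct x as [n l].
      unfold c, evmap, rU, rN; cbn [fst snd]. rewrite plus_IZR, mult_IZR. ring.
  - apply summable_lattice2; [easy|]. unfold c. expb_tac.
Qed.

(** * Differentiation of theta functions *)

Ltac unball H := unfold ball in H; simpl in H;
  unfold AbsRing_ball, abs, minus, plus, opp in H; simpl in H.

(** The filter form of the derivative, to which [tannery] applies. *)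
Lemma is_derive_quotient (f : R -> R) (x l : R) :
  is_derive f x l <-> filterlim (fun h => (f (x + h) - f x) / h) (Rbar_locally' 0) (locally l).
Proof.
  rewrite is_derive_Reals. split.
  - intros H P [eps HP]. destruct (H eps (cond_pos eps)) as [d Hd].
    exists d. intros h Hh Hn. apply HP. unfold ball in *; simpl in *.
    unfold AbsRing_ball, abs, minus, plus, opp in *; simpl in *.
    apply (Hd h Hn). now replace (h + - 0) with h in Hh by ring.
  - intros H eps He.
    destruct (H (fun y => Rabs (y - l) < eps)) as [d Hd].
    { exists (mkposreal eps He). intros y Hy. exact Hy. }
    exists d. intros h Hn Hh. apply Hd; [|easy].
    unfold ball; simpl; unfold AbsRing_ball, abs, minus, plus, opp; simpl.
    now replace (h + - 0) with h by ring.
Qed.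

Lemma pow_diff_bound (a b rho : R) n : Rabs a <= rho -> Rabs b <= rho ->
  Rabs (a ^ n - b ^ n) <= INR n * rho ^ pred n * Rabs (a - b).
Proof.
  intros Ha Hb. pose proof (Rabs_pos a). induction n as [|n IH].
  - simpl. rewrite Rminus_diag, Rabs_R0. lra.
  - replace (a ^ S n - b ^ S n) with (a * (a ^ n - b ^ n) + (a - b) * b ^ n) by (simpl; ring).
    eapply Rle_trans; [apply Rabs_triang|]. rewrite !Rabs_mult, <- RPow_abs.
    assert (Rabs b ^ n <= rho ^ n) by (apply pow_incr; split; [apply Rabs_pos | easy]).
    assert (Hr : rho * (INR n * rho ^ pred n * Rabs (a - b)) = INR n * rho ^ n * Rabs (a - b)).
    { destruct n; [simpl; ring|]. simpl pred. rewrite <- tech_pow_Rmult. ring. }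
    assert (Rabs a * Rabs (a ^ n - b ^ n) <= rho * (INR n * rho ^ pred n * Rabs (a - b))).
    { apply Rmult_le_compat; auto using Rabs_pos. }
    rewrite S_INR. simpl pred. pose proof (Rabs_pos (a - b)).
    assert (Rabs (a - b) * Rabs b ^ n <= Rabs (a - b) * rho ^ n) by now apply Rmult_le_compat_l.
    rewrite Hr in H1. lra.
Qed.

(** Dominated convergence for the difference quotients. For points below rho = (1 + x)/2 the n-th
    quotient is at most e rho^(e-1) with e = [e n], so the differentiated series at rho is the
    majorant. *)
Lemma is_derive_tsum (c : Z -> R) (e : Z -> nat) (x : R) : 0 < x < 1 ->
  (forall rho, 0 < rho < 1 -> summable (fun n => c n * rho ^ e n)) ->
  (forall rho, 0 < rho < 1 -> summable (fun n => c n * INR (e n) * rho ^ e n)) ->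
  is_derive (fun y => tsum (fun n => c n * y ^ e n)) x
    (tsum (fun n => c n * INR (e n) * x ^ e n) / x).
Proof.
  intros Hx S0 S1. apply is_derive_quotient.
  set (rho := (1 + x) / 2). assert (Hr : 0 < rho < 1) by (unfold rho; lra).
  assert (Hxr : x < rho) by (unfold rho; lra).
  replace (tsum (fun n => c n * INR (e n) * x ^ e n) / x) with
    (tsum (fun n => c n * (INR (e n) * x ^ pred (e n)))).
  2: { replace (tsum (fun n => c n * INR (e n) * x ^ e n) / x) with
         (/ x * tsum (fun n => c n * INR (e n) * x ^ e n)) by (unfold Rdiv; ring).
       rewrite <- tsum_scal by now apply S1. apply tsum_ext. intros n.
       destruct (e n); [simpl; ring|]. simpl pred. rewrite <- tech_pow_Rmult. field. lra. }
  assert (Hd : 0 < Rmin (rho - x) x) by (apply Rmin_glb_lt; lra).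
  assert (Hloc : Rbar_locally' 0 (fun h => 0 < x + h < rho /\ h <> 0)).
  { exists (mkposreal _ Hd). intros h Hh Hn. split; [|easy].
    unball Hh.
    rewrite Ropp_0, Rplus_0_r in Hh. apply Rabs_def2 in Hh.
    pose proof (Rmin_l (rho - x) x). pose proof (Rmin_r (rho - x) x). lra. }
  apply filterlim_ext_loc with (fun h => tsum (fun n => c n * (((x + h) ^ e n - x ^ e n) / h))).
  { revert Hloc. apply filter_imp. intros h [Hh Hn].
    rewrite <- tsum_minus by (apply S0; lra).
    unfold Rdiv. rewrite Rmult_comm, <- tsum_scal.
    - apply tsum_ext. intros n. ring.
    - apply summable_minus; apply S0; lra. }
  apply (tannery (Rbar_locally' 0) _ _ (fun n => / rho * Rabs (c n * INR (e n) * rho ^ e n))).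
  - apply summable_scal. destruct (S1 rho Hr) as (M & HM). exists M. intros s Ns.
    specialize (HM s Ns). erewrite lsum_ext_in; [exact HM|]. intros; apply Rabs_Rabsolu.
  - revert Hloc. apply filter_imp. intros h [Hh Hn] n.
    rewrite !Rabs_mult, (Rabs_pos_eq (INR (e n))) by apply pos_INR.
    rewrite (Rabs_pos_eq (rho ^ e n)) by (apply pow_le; lra).
    replace (/ rho * (Rabs (c n) * INR (e n) * rho ^ e n)) with
      (Rabs (c n) * (INR (e n) * rho ^ pred (e n))).
    2: { destruct (e n); [simpl; ring|]. simpl pred. rewrite <- tech_pow_Rmult. field. lra. }
    apply Rmult_le_compat_l; [apply Rabs_pos|].
    unfold Rdiv. rewrite Rabs_mult, Rabs_inv.
    assert (Hp : 0 < Rabs h) by now apply Rabs_pos_lt.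
    apply Rmult_le_reg_r with (Rabs h); [easy|].
    rewrite Rmult_assoc, Rinv_l, Rmult_1_r by lra.
    replace h with (x + h - x) at 2 by ring.
    apply pow_diff_bound; rewrite Rabs_pos_eq; lra.
  - intros n. apply (filterlim_comp _ _ _ _ (fun y => c n * y) _ (locally (INR (e n) * x ^ pred (e n)))).
    + apply (proj1 (is_derive_quotient (fun y => y ^ e n) x _)).
      apply is_derive_Reals. apply derivable_pt_lim_pow.
    + apply (filterlim_scal_r (K := R_AbsRing) (V := R_NormedModule) (c n)).
Qed.

Lemma powerRZ_to_nat x z : (0 <= z)%Z -> x ^^ z = x ^ Z.to_nat z.
Proof. intros H. rewrite <- powerRZ_of_nat. now rewrite Z2Nat.id. Qed.

Lemma INR_to_nat z : (0 <= z)%Z -> INR (Z.to_nat z) = IZR z.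
Proof. intros H. rewrite INR_IZR_INZ. now rewrite Z2Nat.id. Qed.

Lemma nn_pos n : (0 <= n * n + n)%Z.
Proof. nia. Qed.

Lemma is_derive_phi x : 0 < x < 1 -> is_derive phi x (dphi x / x).
Proof.
  intros Hx. set (e := fun n => Z.to_nat (n * n)).
  assert (E : phi = fun y => tsum (fun n => (-1) ^^ n * y ^ e n)).
  { apply functional_extensionality. intros y. apply tsum_ext. intros n. f_equal.
    apply powerRZ_to_nat. nia. }
  rewrite E. unfold dphi.
  rewrite (tsum_ext _ (fun n => (-1) ^^ n * INR (e n) * x ^ e n)).
  2: { intros n. unfold e. rewrite <- powerRZ_to_nat, INR_to_nat, mult_IZR by nia. ring. }
  apply is_derive_tsum; [easy| |].
  - intros rho Hr. apply summable_ext with (fun n => (-1) ^^ n * rho ^^ (n * n)).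
    { intros n. unfold e. rewrite <- powerRZ_to_nat by nia. easy. }
    apply summable_phi; [easy | apply expb_sgn].
  - intros rho Hr. apply summable_ext with (fun n => (-1) ^^ n * (IZR n * IZR n) * rho ^^ (n * n)).
    { intros n. unfold e. rewrite <- powerRZ_to_nat, INR_to_nat, mult_IZR by nia. easy. }
    apply summable_phi; [easy | expb_tac].
Qed.

Lemma is_derive_thetaB x : 0 < x < 1 -> is_derive thetaB x (dthetaB x / x).
Proof.
  intros Hx. set (e := fun n => Z.to_nat (n * n + n)).
  assert (E : thetaB = fun y => tsum (fun n => 1 * y ^ e n)).
  { apply functional_extensionality. intros y. apply tsum_ext. intros n. rewrite Rmult_1_l.
    apply powerRZ_to_nat, nn_pos. }
  rewrite E. unfold dthetaB.
  rewrite (tsum_ext _ (fun n => 1 * INR (e n) * x ^ e n)).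
  2: { intros n. unfold e. rewrite <- powerRZ_to_nat, INR_to_nat, plus_IZR, mult_IZR by apply nn_pos. ring. }
  apply is_derive_tsum; [easy| |].
  - intros rho Hr. apply summable_ext with (fun n => 1 * rho ^^ (n * n + n)).
    { intros n. unfold e. rewrite <- powerRZ_to_nat by apply nn_pos. easy. }
    apply summable_thetaB; [easy | apply expb_one].
  - intros rho Hr. apply summable_ext with (fun n => (IZR n * IZR n + IZR n) * rho ^^ (n * n + n)).
    { intros n. unfold e. rewrite <- powerRZ_to_nat, INR_to_nat, plus_IZR, mult_IZR by apply nn_pos. ring. }
    apply summable_thetaB; [easy | expb_tac].
Qed.

(* [r^2 = q] throughout; the right-hand sides use [psi(q) = thetaB r / 2]. *)
Lemma dlog_phi r q : 0 < r < 1 -> q = r ^ 2 ->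
  dphi q / phi q - 3 * (dphi (q ^ 3) / phi (q ^ 3)) = - q * thetaB r ^ 2 * thetaB (r ^ 3) ^ 2 / 8.
Proof.
  intros Hr Eq. assert (Hq : 0 < q < 1) by (subst; now apply sq_lt1).
  pose proof (pow_S_lt1 q 2 Hq) as H3. pose proof (pow_S_lt1 r 2 Hr) as R3.
  pose proof (phi_pos q Hq). pose proof (phi_pos _ H3).
  pose proof (wronskian_phi q Hq) as HW.
  rewrite !thetaJ_eta in HW by easy.
  pose proof (qinf_sq_cube q r Hr Eq) as C1.
  assert (C2 : 4 * qinf ((q ^ 3) ^ 2) ^ 3 = phi (q ^ 3) * thetaB (r ^ 3) ^ 2).
  { apply qinf_sq_cube; [easy|]. subst q. ring. }
  apply Rmult_eq_reg_r with (phi q * phi (q ^ 3)); [|apply Rmult_integral_contrapositive; lra].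
  transitivity (phi (q ^ 3) * dphi q - 3 * phi q * dphi (q ^ 3)); [field; lra|].
  rewrite HW.
  replace (- (q * (2 * qinf (q ^ 2) ^ 3) * (2 * qinf ((q ^ 3) ^ 2) ^ 3)) / 2) with
    (- (q * (4 * qinf (q ^ 2) ^ 3) * (4 * qinf ((q ^ 3) ^ 2) ^ 3)) / 8) by field.
  rewrite C1, C2. field.
Qed.

Lemma dlog_thetaB r q : 0 < r < 1 -> q = r ^ 2 ->
  dthetaB r / thetaB r - 3 * (dthetaB (r ^ 3) / thetaB (r ^ 3)) = / 2 - phi q ^ 2 * phi (q ^ 3) ^ 2 / 2.
Proof.
  intros Hr Eq. assert (Hq : 0 < q < 1) by (subst; now apply sq_lt1).
  pose proof (pow_S_lt1 q 2 Hq) as H3. pose proof (pow_S_lt1 r 2 Hr) as R3.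
  pose proof (thetaB_pos r Hr). pose proof (thetaB_pos _ R3).
  pose proof (wronskian_thetaB r Hr) as HW.
  rewrite !thetaJ_eta, <- Eq in HW by easy.
  pose proof (qinf_cube q r Hr Eq) as C1.
  assert (E3 : (r ^ 3) ^ 2 = q ^ 3) by (subst q; ring). rewrite E3 in HW.
  pose proof (qinf_cube (q ^ 3) (r ^ 3) R3 (eq_sym E3)) as C2.
  rewrite C1, C2 in HW.
  apply Rmult_eq_reg_r with (thetaB r * thetaB (r ^ 3)); [|apply Rmult_integral_contrapositive; lra].
  transitivity (thetaB (r ^ 3) * dthetaB r - 3 * thetaB r * dthetaB (r ^ 3)); [field; lra|]. lra.
Qed.

(** * The continued fraction *)

(* [oddp q m = (-q;q^2)_m] and [evenp q m = (-q^2;q^2)_m] *)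
Fixpoint oddp (q : R) (m : nat) : R :=
  match m with O => 1 | S m' => oddp q m' * (1 + q * (q ^ m') ^ 2) end.
Fixpoint evenp (q : R) (m : nat) : R :=
  match m with O => 1 | S m' => evenp q m' * (1 + q ^ 2 * (q ^ m') ^ 2) end.

Lemma oddp_S q m : oddp q (S m) = oddp q m * (1 + q * (q ^ m) ^ 2).
Proof. easy. Qed.
Lemma evenp_S q m : evenp q (S m) = evenp q m * (1 + q ^ 2 * (q ^ m) ^ 2).
Proof. easy. Qed.

Lemma pow_mix_bounds q a m b : 0 < q < 1 -> 0 < q ^ a * (q ^ m) ^ b <= 1.
Proof. intros Hq. rewrite <- pow_mult, <- pow_add. now apply pow_bounds. Qed.

Lemma odd_factor q m : 0 < q < 1 -> 0 < q * (q ^ m) ^ 2 <= 1.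
Proof. intros Hq. pose proof (pow_mix_bounds q 1 m 2 Hq). now rewrite pow_1 in H. Qed.

Lemma oddp_bounds q m : 0 < q < 1 -> 1 <= oddp q m <= 2 ^ m.
Proof.
  intros Hq. induction m; [simpl; lra|]. rewrite oddp_S, <- (tech_pow_Rmult 2).
  pose proof (odd_factor q m Hq) as H.
  generalize dependent (q * (q ^ m) ^ 2). generalize dependent (oddp q m). generalize (2 ^ m).
  intros M o Ho f Hf. assert (0 <= o * f) by nra. assert (0 <= o * (1 - f)) by nra. lra.
Qed.

Lemma evenp_ge1 q m : 0 < q < 1 -> 1 <= evenp q m.
Proof.
  intros Hq. induction m; [simpl; lra|]. rewrite evenp_S.
  pose proof (pow_mix_bounds q 2 m 2 Hq) as H.
  generalize dependent (q ^ 2 * (q ^ m) ^ 2). intros; nra.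
Qed.

(** In Pochhammer notation (-q^(2i+1);q^2)_n / ((q^2;q^2)_n (-q^2;q^2)_(n+i)). *)
Definition cfc (q : R) (i n : nat) : R :=
  oddp q (n + i) / oddp q i / (qfac (q ^ 2) n * evenp q (n + i)).

(* Solutions of the three-term recurrence of the continued fraction: [cfe q i] and [cfo q i] sit at
   the positions [2 i] and [2 i + 1]. They are the two kinds of q-series in Ramanujan's
   [G(aq,lambda q;b,q) / G(a,lambda;b,q)] continued fraction, at base [q^2]. *)
Definition cfe (q : R) (i : nat) : R := tsum (fun n : nat => (q ^ (2 * i * n) * cfc q i n) * q ^ (n * n)).
Definition cfo (q : R) (i : nat) : R := tsum (fun n : nat => (q ^ (2 * S i * n) * cfc q i n) * q ^ (n * n)).

Lemma cfc_pos q i n : 0 < q < 1 -> 0 < cfc q i n.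
Proof.
  intros Hq. pose proof (oddp_bounds q (n + i) Hq). pose proof (oddp_bounds q i Hq).
  pose proof (evenp_ge1 q (n + i) Hq). pose proof (qfac_pos _ n (sq_lt1 q Hq)).
  unfold cfc. repeat apply Rdiv_lt_0_compat; try lra. apply Rmult_lt_0_compat; lra.
Qed.

Lemma cfc_bound q i n : 0 < q < 1 -> cfc q i n <= 2 ^ (n + i) * / qinf (q ^ 2).
Proof.
  intros Hq. pose proof (oddp_bounds q (n + i) Hq) as H1. pose proof (oddp_bounds q i Hq) as H2.
  pose proof (evenp_ge1 q (n + i) Hq) as H3. pose proof (sq_lt1 q Hq) as Hp.
  pose proof (qfac_pos _ n Hp) as H4. pose proof (qinf_pos _ Hp) as H5. pose proof (qinf_le _ n Hp) as H6.
  unfold cfc, Rdiv. assert (/ oddp q i <= 1) by (rewrite <- Rinv_1; apply Rinv_le_contravar; lra).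
  assert (0 < / oddp q i) by (apply Rinv_0_lt_compat; lra).
  apply Rmult_le_compat.
  - nra.
  - apply Rlt_le, Rinv_0_lt_compat. nra.
  - nra.
  - apply Rinv_le_contravar; [easy | nra].
Qed.

Lemma expb_cf q i k : 0 < q < 1 -> expb (fun n => n) (fun n => q ^ (k * n) * cfc q i n).
Proof.
  intros Hq. apply expb_mult.
  - apply expb_bounded with 1. intros n. pose proof (pow_bounds q (k * n) Hq). rewrite Rabs_pos_eq; lra.
  - destruct (expb_mult (fun n : nat => n) (fun n => 2 ^ n) (fun n => 2 ^ i * / qinf (q ^ 2))) as (M & HM & H).
    + exists 2. split; [lra|]. intros t. rewrite Rabs_pos_eq by (apply pow_le; lra).
      apply Rle_pow; [lra | lia].
    + apply expb_const.
    + exists M. split; [easy|]. intros n. eapply Rle_trans; [|apply H].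
      pose proof (cfc_pos q i n Hq). rewrite Rabs_pos_eq by lra.
      eapply Rle_trans; [|apply Rle_abs]. rewrite <- Rmult_assoc, <- pow_add. now apply cfc_bound.
Qed.

Lemma summable_cf q i k : 0 < q < 1 -> summable (fun n => (q ^ (k * n) * cfc q i n) * q ^ (n * n)).
Proof. intros Hq. apply summable_gauss_nat; [easy | now apply expb_cf]. Qed.

Lemma tsum_nat_S (f : nat -> R) : summable f -> tsum f = f 0%nat + tsum (fun n => f (S n)).
Proof.
  intros H. rewrite tsum_Series by easy. rewrite tsum_Series.
  - apply Series_incr_1. exists (tsum f). now apply has_sum_is_series, summable_has_sum.
  - apply (summable_comp S); [intros; lia | easy].
Qed.

Lemma cf_term_pos q i k n : 0 < q < 1 -> 0 < (q ^ (k * n) * cfc q i n) * q ^ (n * n).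
Proof.
  intros Hq. pose proof (cfc_pos q i n Hq). pose proof (pow_bounds q (k * n) Hq).
  pose proof (pow_bounds q (n * n) Hq). apply Rmult_lt_0_compat; [apply Rmult_lt_0_compat|]; lra.
Qed.

Lemma cf_sum_pos q i k : 0 < q < 1 -> 0 < tsum (fun n => (q ^ (k * n) * cfc q i n) * q ^ (n * n)).
Proof.
  intros Hq. eapply Rlt_le_trans; [apply (cf_term_pos q i k 0 Hq)|].
  apply (tsum_ge_term (fun n => (q ^ (k * n) * cfc q i n) * q ^ (n * n)) 0%nat).
  - intros n. apply Rlt_le, cf_term_pos, Hq.
  - now apply summable_cf.
Qed.

(** The n-th terms of [cfe q i] and [cfo q i] differ by the factor 1 - q^(2n), which removes the
    last factor of (q^2;q^2)_n; lowering the index by one then gives level i + 1, with 1 + q^(2i+1)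
    left over from the numerator. *)
Lemma cfe_term q i n : 0 < q < 1 ->
  (q ^ (2 * i * S n) * cfc q i (S n)) * q ^ (S n * S n) - (q ^ (2 * S i * S n) * cfc q i (S n)) * q ^ (S n * S n)
  = (q ^ S (2 * i) + q ^ (2 * S (2 * i))) * ((q ^ (2 * S i * n) * cfc q (S i) n) * q ^ (n * n)).
Proof.
  intros Hq. pose proof (sq_lt1 q Hq) as Hp. unfold cfc.
  replace (n + S i)%nat with (S n + i)%nat by lia.
  rewrite qfac_S, (oddp_S q i), pow_powl.
  pose proof (oddp_bounds q (S n + i) Hq). pose proof (oddp_bounds q i Hq).
  pose proof (evenp_ge1 q (S n + i) Hq). pose proof (qfac_pos _ n Hp).
  pose proof (pow_bounds q i Hq) as Hi. pose proof (pow_bounds q n Hq) as Hn.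
  pose proof (odd_factor q i Hq).
  replace (2 * i * S n)%nat with (2 * (i * n) + 2 * i)%nat by lia.
  replace (2 * S i * S n)%nat with (2 * (i * n) + 2 * i + 2 * n + 2)%nat by lia.
  replace (2 * S i * n)%nat with (2 * (i * n) + 2 * n)%nat by lia.
  replace (S n * S n)%nat with (n * n + 2 * n + 1)%nat by lia.
  replace (2 * S (2 * i))%nat with (2 * i + 2 * i + 2)%nat by lia.
  replace (S (2 * i)) with (2 * i + 1)%nat by lia.
  rewrite !pow_add, !(pow_mulr q 2).
  pose proof (pow_mix_lt1 q n 2 2 Hq ltac:(lia)).
  field. repeat split; lra.
Qed.

Lemma cfe_rec q i : 0 < q < 1 ->
  cfe q i = cfo q i + (q ^ S (2 * i) + q ^ (2 * S (2 * i))) * cfe q (S i).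
Proof.
  intros Hq.
  pose proof (summable_cf q i (2 * i) Hq) as H1. pose proof (summable_cf q i (2 * S i) Hq) as H2.
  pose proof (summable_cf q (S i) (2 * S i) Hq) as H3.
  unfold cfe, cfo. rewrite <- tsum_scal by easy.
  rewrite <- (tsum_ext _ _ (fun n => cfe_term q i n Hq)).
  set (f := fun n => (q ^ (2 * i * n) * cfc q i n) * q ^ (n * n) - (q ^ (2 * S i * n) * cfc q i n) * q ^ (n * n)).
  assert (E : tsum f = tsum (fun n => f (S n))).
  { rewrite tsum_nat_S by now apply summable_minus. unfold f at 1.
    rewrite !Nat.mul_0_r. ring. }
  unfold f in E at 1. rewrite tsum_minus in E by easy. fold f. unfold f in E.
  unfold f. lra.
Qed.

(** Certificate for the second recurrence: the defect of the n-th terms is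
    [cfW q i n - cfW q i (S n)], and the factor 1 - q^(2n) makes the boundary term at n = 0
    vanish. *)
Definition cfW (q : R) (i n : nat) : R :=
  q ^ S (2 * i) / (1 + q * (q ^ i) ^ 2) * (1 - (q ^ 2) ^ n) *
    ((q ^ (2 * S i * n) * cfc q i n) * q ^ (n * n)).

Lemma cfo_term q i n : 0 < q < 1 ->
  (q ^ (2 * S i * n) * cfc q i n) * q ^ (n * n) - (q ^ (2 * S i * n) * cfc q (S i) n) * q ^ (n * n)
  - (q ^ S (S (2 * i)) + q ^ (2 * S (S (2 * i)))) * ((q ^ (2 * S (S i) * n) * cfc q (S i) n) * q ^ (n * n))
  = cfW q i n - cfW q i (S n).
Proof.
  intros Hq. pose proof (sq_lt1 q Hq) as Hp. unfold cfW, cfc.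
  replace (n + S i)%nat with (S (n + i)) by lia. replace (S n + i)%nat with (S (n + i)) by lia.
  change ((q ^ 2) ^ S n) with (q ^ 2 * (q ^ 2) ^ n).
  rewrite !oddp_S, !evenp_S, !qfac_S, !(pow_powl q 2 n).
  pose proof (oddp_bounds q (n + i) Hq). pose proof (oddp_bounds q i Hq).
  pose proof (evenp_ge1 q (n + i) Hq). pose proof (qfac_pos _ n Hp). pose proof (odd_factor q i Hq).
  pose proof (pow_bounds q i Hq) as Hi. pose proof (pow_bounds q n Hq) as Hn.
  replace (2 * S i * S n)%nat with (2 * (i * n) + 2 * i + 2 * n + 2)%nat by lia.
  replace (2 * S (S i) * n)%nat with (2 * (i * n) + 4 * n)%nat by lia.
  replace (2 * S i * n)%nat with (2 * (i * n) + 2 * n)%nat by lia.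
  replace (S n * S n)%nat with (n * n + 2 * n + 1)%nat by lia.
  replace (2 * S (S (2 * i)))%nat with (4 * i + 4)%nat by lia.
  replace (S (S (2 * i)))%nat with (2 * i + 2)%nat by lia.
  replace (S (2 * i)) with (2 * i + 1)%nat by lia.
  pose proof (pow_mix_lt1 q n 2 2 Hq ltac:(lia)). pose proof (pow_mix_bounds q 2 (n + i) 2 Hq).
  rewrite pow_add in *. rewrite !pow_add, !(pow_mulr q 2), !(pow_mulr q 4).
  field. repeat split; lra.
Qed.

Lemma summable_cfW q i : 0 < q < 1 -> summable (cfW q i).
Proof.
  intros Hq. pose proof (odd_factor q i Hq). pose proof (pow_bounds q (S (2 * i)) Hq).
  apply summable_dom with (fun n => q ^ S (2 * i) / (1 + q * (q ^ i) ^ 2) *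
    ((q ^ (2 * S i * n) * cfc q i n) * q ^ (n * n))).
  - intros n. unfold cfW. pose proof (cf_term_pos q i (2 * S i) n Hq) as HT.
    pose proof (pow_bounds _ n (sq_lt1 q Hq)).
    assert (Hc : 0 < q ^ S (2 * i) / (1 + q * (q ^ i) ^ 2)) by (apply Rdiv_lt_0_compat; lra).
    revert HT Hc. generalize (q ^ S (2 * i) / (1 + q * (q ^ i) ^ 2)).
    generalize ((q ^ (2 * S i * n) * cfc q i n) * q ^ (n * n)). intros t c Ht Hc.
    assert (0 < c * t) by nra. rewrite Rabs_pos_eq; nra.
  - apply summable_scal. now apply summable_cf.
Qed.

Lemma cfo_rec q i : 0 < q < 1 ->
  cfo q i = cfe q (S i) + (q ^ S (S (2 * i)) + q ^ (2 * S (S (2 * i)))) * cfo q (S i).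
Proof.
  intros Hq.
  pose proof (summable_cf q i (2 * S i) Hq) as H1. pose proof (summable_cf q (S i) (2 * S i) Hq) as H2.
  pose proof (summable_cf q (S i) (2 * S (S i)) Hq) as H3. pose proof (summable_cfW q i Hq) as HW.
  assert (E : tsum (fun n => cfW q i n - cfW q i (S n)) = 0).
  { rewrite tsum_minus; [|easy|now apply (summable_comp S); [intros; lia|]].
    rewrite (tsum_nat_S (cfW q i)) by easy. unfold cfW. simpl; ring. }
  rewrite <- (tsum_ext _ _ (fun n => cfo_term q i n Hq)) in E.
  rewrite !tsum_minus, tsum_scal in E; try apply summable_minus; try apply summable_scal; try easy.
  fold (cfe q (S i)) in E. fold (cfo q i) in E. fold (cfo q (S i)) in E. lra.
Qed.

Definition cfs (q : R) (k : nat) : R := if Nat.even k then cfe q (Nat.div2 k) else cfo q (Nat.div2 k).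

Lemma cfs_pos q k : 0 < q < 1 -> 0 < cfs q k.
Proof. intros Hq. unfold cfs, cfe, cfo. destruct (Nat.even k); now apply cf_sum_pos. Qed.

Lemma cfs_rec q k : 0 < q < 1 ->
  cfs q k = cfs q (S k) + (q ^ S k + q ^ (2 * S k)) * cfs q (S (S k)).
Proof.
  intros Hq. destruct (Nat.Even_or_Odd k) as [[i ->]|[i ->]].
  - replace (cfs q (2 * i)) with (cfe q i).
    2: { unfold cfs. rewrite Nat.even_even, Nat.div2_double. easy. }
    replace (cfs q (S (2 * i))) with (cfo q i).
    2: { unfold cfs. rewrite Nat.div2_succ_double.
         replace (S (2 * i)) with (2 * i + 1)%nat by lia. now rewrite Nat.even_odd. }
    replace (S (S (2 * i))) with (2 * S i)%nat by lia.
    replace (cfs q (2 * S i)) with (cfe q (S i)).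
    2: { unfold cfs. rewrite Nat.even_even, Nat.div2_double. easy. }
    now apply cfe_rec.
  - replace (2 * i + 1)%nat with (S (2 * i)) by lia.
    replace (cfs q (S (2 * i))) with (cfo q i).
    2: { unfold cfs. rewrite Nat.div2_succ_double.
         replace (S (2 * i)) with (2 * i + 1)%nat by lia. now rewrite Nat.even_odd. }
    rewrite cfo_rec by easy.
    replace (cfs q (S (S (2 * i)))) with (cfe q (S i)).
    2: { replace (S (S (2 * i))) with (2 * S i)%nat by lia. unfold cfs.
         rewrite Nat.even_even, Nat.div2_double. easy. }
    replace (cfs q (S (S (S (2 * i))))) with (cfo q (S i)); [easy|].
    unfold cfs. replace (S (S (S (2 * i)))) with (S (2 * S i)) by lia.
    rewrite Nat.div2_succ_double.
    replace (S (2 * S i)) with (2 * S i + 1)%nat by lia. now rewrite Nat.even_odd.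
Qed.

Lemma cf_tail_ge1 q m k : 0 < q -> 1 <= cf_tail q m k.
Proof.
  intros Hq. revert k. induction m; intros k; simpl; [lra|].
  specialize (IHm (S k)). pose proof (pow_lt q k Hq). pose proof (pow_lt q (k + (k + 0)) Hq).
  assert (0 < (q ^ k + q ^ (k + (k + 0))) / cf_tail q m (S k)); [|lra].
  apply Rdiv_lt_0_compat; lra.
Qed.

Lemma cf_tail_S q m k : cf_tail q (S m) k = 1 + (q ^ k + q ^ (2 * k)) / cf_tail q m (S k).
Proof. easy. Qed.

(* The map [x -> 1 + a / x] contracts by [a] on [x >= 1], and the partial numerators tend to 0. *)
Lemma cf_tail_limit q : 0 < q < 1 -> is_lim_seq (fun n => cf_tail q n 1) (cfs q 0 / cfs q 1).
Proof.
  intros Hq. set (T := fun k => cfs q k / cfs q (S k)).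
  assert (HT : forall k, T k = 1 + (q ^ S k + q ^ (2 * S k)) / T (S k)).
  { intros k. unfold T. rewrite (cfs_rec q k Hq).
    pose proof (cfs_pos q (S k) Hq). pose proof (cfs_pos q (S (S k)) Hq). field. lra. }
  assert (HTp : forall k, 0 < T k) by (intros; apply Rdiv_lt_0_compat; now apply cfs_pos).
  assert (HT1 : forall k, 1 <= T k).
  { intros k. rewrite HT. pose proof (pow_bounds q (S k) Hq). pose proof (pow_bounds q (2 * S k) Hq).
    assert (0 < (q ^ S k + q ^ (2 * S k)) / T (S k)); [|lra]. apply Rdiv_lt_0_compat; [lra | apply HTp]. }
  assert (Ha : forall k, 0 < q ^ k + q ^ (2 * k) <= 2 * q ^ k).
  { intros k. rewrite pow_mulr. pose proof (pow_bounds q k Hq). simpl; nra. }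
  assert (HT3 : forall k, T k <= 3).
  { intros k. rewrite HT. pose proof (Ha (S k)). pose proof (HT1 (S k)). pose proof (pow_bounds q (S k) Hq).
    assert ((q ^ S k + q ^ (2 * S k)) / T (S k) <= 2); [|lra].
    apply Rmult_le_reg_r with (T (S k)); [lra|]. unfold Rdiv. rewrite Rmult_assoc, Rinv_l, Rmult_1_r by lra. lra. }
  (* The initial error is at most 2 because 1 <= T <= 3, and step j contributes a factor 2
     q^(k+1+j). A single factor may exceed 1; the triangular exponent is what forces convergence. *)
  assert (Herr : forall m k, Rabs (cf_tail q m (S k) - T k) <= 2 * (2 * q ^ S k) ^ m * q ^ (m * (m - 1) / 2)).
  { induction m; intros k.
    - simpl. pose proof (HT1 k). pose proof (HT3 k). apply Rabs_le. lra.
    - rewrite cf_tail_S, HT. specialize (IHm (S k)).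
      pose proof (cf_tail_ge1 q m (S (S k)) ltac:(lra)) as H1. pose proof (HT1 (S k)) as H2.
      set (x := cf_tail q m (S (S k))) in *. set (y := T (S k)) in *.
      pose proof (Ha (S k)) as H3. set (a := q ^ S k + q ^ (2 * S k)) in *.
      replace (1 + a / x - (1 + a / y)) with (a * (/ (x * y)) * - (x - y)) by (field; lra).
      rewrite !Rabs_mult, Rabs_Ropp, (Rabs_pos_eq a), (Rabs_pos_eq (/ _)) by
        (try lra; apply Rlt_le, Rinv_0_lt_compat; nra).
      assert (/ (x * y) <= 1) by (rewrite <- Rinv_1; apply Rinv_le_contravar; nra).
      assert (0 < / (x * y)) by (apply Rinv_0_lt_compat; nra).
      pose proof (Rabs_pos (x - y)).
      apply Rle_trans with (2 * q ^ S k * Rabs (x - y)).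
      + apply Rmult_le_compat_r; [easy|]. nra.
      + apply Rle_trans with (2 * q ^ S k * (2 * (2 * q ^ S (S k)) ^ m * q ^ (m * (m - 1) / 2))).
        * apply Rmult_le_compat_l; [lra | easy].
        * right.
          assert (E : (S m * (S m - 1) / 2 = m + m * (m - 1) / 2)%nat).
          { replace (S m * (S m - 1))%nat with (m * (m - 1) + m * 2)%nat by (destruct m; simpl; lia).
            rewrite Nat.div_add by lia. lia. }
          rewrite E, pow_add, <- (tech_pow_Rmult q (S k)). generalize (q ^ S k). intros z.
          rewrite !Rpow_mult_distr, <- (tech_pow_Rmult 2 m), <- (tech_pow_Rmult z m). ring. }
  assert (H0 : is_lim_seq (fun m => cf_tail q m 1 - T 0%nat) 0).
  { apply is_lim_seq_abs_0.
    apply is_lim_seq_le_le with (u := fun _ => 0)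
      (w := fun m => 2 * ((2 * q ^ 1) ^ m * q ^ (m * (m - 1) / 2))).
    - intros m. split; [apply Rabs_pos|]. rewrite <- Rmult_assoc. apply Herr.
    - apply is_lim_seq_const.
    - replace (Finite 0) with (Finite (2 * 0)) by (f_equal; ring).
      apply is_lim_seq_mult'; [apply is_lim_seq_const|].
      apply ex_series_lim_0, ex_series_Rabs, ex_series_DAlembert with 0; [lra| |].
      + intros n. apply Rgt_not_eq, Rmult_lt_0_compat; apply pow_lt; simpl; lra.
      + apply is_lim_seq_ext with (fun n => 2 * q * q ^ n).
        * intros n.
          assert (E : (S n * (S n - 1) / 2 = n + n * (n - 1) / 2)%nat).
          { replace (S n * (S n - 1))%nat with (n * (n - 1) + n * 2)%nat by (destruct n; simpl; lia).
            rewrite Nat.div_add by lia. lia. }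
          rewrite E, pow_add, pow_1, <- tech_pow_Rmult.
          rewrite Rabs_pos_eq.
          -- field. split; apply pow_nonzero; lra.
          -- apply Rlt_le, Rdiv_lt_0_compat; repeat apply Rmult_lt_0_compat; try apply pow_lt; lra.
        * replace (Finite 0) with (Finite (2 * q * 0)) by (f_equal; ring).
          apply is_lim_seq_mult'; [apply is_lim_seq_const|].
          apply is_lim_seq_geom. rewrite Rabs_pos_eq; lra. }
  apply is_lim_seq_ext with (fun m => (cf_tail q m 1 - T 0%nat) + T 0%nat); [intros; ring|].
  replace (Finite (cfs q 0 / cfs q 1)) with (Finite (0 + T 0%nat)) by (unfold T; f_equal; ring).
  apply is_lim_seq_plus'; [easy | apply is_lim_seq_const].
Qed.

(** * Bailey pairs *)

(** The beta sides of Bailey pairs relative to 1 and to p, with the alpha side unfolded to all of Z.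
    Both are 1/(p^2;p^2)_n, since they satisfy the same first-order recurrence and equal 1 at n =
    0. *)
Definition bailey0 (p : R) (n : Z) : R :=
  tsum (fun j => (-1) ^^ j * (iqfac p (n - j) * iqfac p (n + j)) * p ^^ (j * j)).
Definition bailey1 (p : R) (n : Z) : R :=
  tsum (fun j => (-1) ^^ j * (iqfac p (n - j) * iqfac p (n + j + 1)) * p ^^ (j * j)).

Lemma iqfac_rel p m m' : 0 < p < 1 -> (m' = m - 1)%Z -> iqfac p m' = (1 - p ^^ m) * iqfac p m.
Proof. intros Hp ->. now apply iqfac_pred. Qed.

Ltac expb_ip_tac := repeat (apply expb_mult || apply expb_minus || apply expb_plus || apply expb_const
  || apply expb_IZR || apply expb_sgn || (apply expb_iqfac; assumption) || (apply expb_powerRZ; lra)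
  || (apply expb_powerRZ_inv; lra)).

Lemma bailey0_rec p n : 0 < p < 1 -> bailey0 p (n - 1) = (1 - p ^^ (2 * n)) * bailey0 p n.
Proof.
  intros Hp. unfold bailey0. rewrite <- tsum_scal by (apply summable_gauss; [easy | expb_ip_tac]).
  apply Rminus_diag_uniq. rewrite <- tsum_minus.
  2: apply summable_gauss; [easy | expb_ip_tac].
  2: apply summable_scal, summable_gauss; [easy | expb_ip_tac].
  apply tsum_telescope with (fun j =>
    ((-1) ^^ j * (p ^^ n * / p ^^ j) * (iqfac p (n - j) * iqfac p (n + j - 1))) * p ^^ (j * j)).
  - apply summable_gauss; [easy | expb_ip_tac].
  - intros j.
    rewrite (iqfac_rel p (n - j) (n - 1 - j)), (iqfac_rel p (n + j) (n - 1 + j)), (iqfac_rel p (n - j) (n - (j + 1))),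
      (iqfac_rel p (n + j) (n + j - 1)) by (easy || lia).
    replace (n + (j + 1) - 1)%Z with (n + j)%Z by ring.
    pw p (2 * n)%Z (n + n)%Z. pw p (n - j)%Z (n + - j)%Z.
    pw p ((j + 1) * (j + 1))%Z (j * j + j + j + 1)%Z.
    rewrite (powerRZ_add (-1)), powerRZ_1r by lra. pw_expand p.
    field. repeat split; nz.
Qed.

Lemma bailey1_rec p n : 0 < p < 1 -> bailey1 p (n - 1) = (1 - p ^^ (2 * n)) * bailey1 p n.
Proof.
  intros Hp. unfold bailey1. rewrite <- tsum_scal by (apply summable_gauss; [easy | expb_ip_tac]).
  set (h := fun j => ((-1) ^^ j * p ^^ j * (iqfac p (n - j) * iqfac p (n + j + 1))) * p ^^ (j * j)).
  assert (Hh : summable h) by (apply summable_gauss; [easy | expb_ip_tac]).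
  (* [h] is antisymmetric under [j -> -1 - j] *)
  assert (H0 : tsum h = 0).
  { pose proof (tsum_Z_reflect h (-1) Hh) as H.
    rewrite (tsum_ext _ (fun j => -1 * h j)) in H; [rewrite tsum_scal in H by easy; lra|].
    intros j. unfold h. replace (n - (-1 - j))%Z with (n + j + 1)%Z by ring.
    replace (n + (-1 - j) + 1)%Z with (n - j)%Z by ring.
    pw (-1) (-1 - j)%Z (- (j + 1))%Z. rewrite powerRZ_m1_opp, (powerRZ_add (-1)), powerRZ_1r by lra.
    pw p ((-1 - j) * (-1 - j))%Z (j * j + j + j + 1)%Z. pw p (-1 - j)%Z (- (1) + - j)%Z.
    pw_expand p. field. repeat split; nz. }
  apply Rminus_diag_uniq. rewrite <- tsum_minus.
  2: apply summable_gauss; [easy | expb_ip_tac].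
  2: apply summable_scal, summable_gauss; [easy | expb_ip_tac].
  match goal with |- tsum ?G = 0 => set (g := G) end.
  assert (Hg : summable g).
  { apply summable_minus; [|apply summable_scal]; (apply summable_gauss; [easy | expb_ip_tac]). }
  (* A multiple of the vanishing sum of [h] is added so that the terms telescope with the
     certificate below. *)
  enough (HT : tsum (fun j => g j + p ^^ n * (p - 1) * h j) = 0).
  { rewrite tsum_plus, tsum_scal, H0 in HT by (easy || now apply summable_scal). lra. }
  apply tsum_telescope with (fun j =>
    ((-1) ^^ j * (p ^^ n * / p ^^ j) * (iqfac p (n - j) * iqfac p (n + j))) * p ^^ (j * j)).
  - apply summable_gauss; [easy | expb_ip_tac].
  - intros j. unfold g, h.
    rewrite (iqfac_rel p (n - j) (n - 1 - j)), (iqfac_rel p (n + j + 1) (n - 1 + j + 1)), (iqfac_rel p (n - j) (n - (j + 1))),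
      (iqfac_rel p (n + j + 1) (n + j)) by (easy || lia).
    replace (n + (j + 1))%Z with (n + j + 1)%Z by ring.
    pw p (2 * n)%Z (n + n)%Z. pw p (n - j)%Z (n + - j)%Z.
    pw p ((j + 1) * (j + 1))%Z (j * j + j + j + 1)%Z.
    rewrite (powerRZ_add (-1)), powerRZ_1r by lra. pw_expand p.
    field. repeat split; nz.
Qed.

Lemma bailey_val (b : Z -> R) q : 0 < q < 1 ->
  (forall n, b (n - 1)%Z = (1 - (q ^ 2) ^^ (2 * n)) * b n) -> b 0%Z = 1 ->
  forall n : nat, b (Z.of_nat n) = / (qfac (q ^ 2) n * evenp q n).
Proof.
  intros Hq Hb H0. pose proof (sq_lt1 q Hq) as Hp. induction n.
  - change (b 0%Z = / (1 * 1)). rewrite H0. field.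
  - pose proof (Hb (Z.of_nat (S n))) as H. replace (Z.of_nat (S n) - 1)%Z with (Z.of_nat n) in H by lia.
    rewrite IHn in H. replace (2 * Z.of_nat (S n))%Z with (Z.of_nat (2 * S n)) in H by lia.
    rewrite powerRZ_of_nat, <- pow_mult in H. rewrite qfac_S, evenp_S, (pow_powl q 2 n).
    replace (2 * (2 * S n))%nat with (4 + n * 4)%nat in H by lia.
    rewrite pow_add, pow_mult in H.
    pose proof (qfac_pos _ n Hp). pose proof (evenp_ge1 q n Hq). pose proof (pow_mix_lt1 q n 4 4 Hq ltac:(lia)).
    pose proof (pow_mix_lt1 q n 2 2 Hq ltac:(lia)). pose proof (pow_mix_bounds q 2 n 2 Hq).
    apply Rmult_eq_reg_l with (1 - q ^ 4 * (q ^ n) ^ 4); [|lra]. rewrite <- H.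
    field. repeat split; lra.
Qed.

Lemma bailey0_0 p : 0 < p < 1 -> bailey0 p 0 = 1.
Proof.
  intros Hp. unfold bailey0. rewrite (tsum_single _ 0%Z); [unfold iqfac; simpl; field|].
  intros j Hj. destruct (Z_lt_le_dec j 0).
  - rewrite (iqfac_neg p (0 + j)) by lia. ring.
  - rewrite (iqfac_neg p (0 - j)) by lia. ring.
Qed.

Lemma bailey1_0 p : 0 < p < 1 -> bailey1 p 0 = 1.
Proof.
  intros Hp.
  assert (S1 : summable (fun j => (-1) ^^ j * (iqfac p (0 - j) * iqfac p (0 + j + 1)) * p ^^ (j * j)))
    by (apply summable_gauss; [easy | expb_ip_tac]).
  (* Two indices survive: j = 0 contributes 1/(1 - p) and j = -1 contributes -p/(1 - p). *)
  unfold bailey1. rewrite tsum_Z by easy.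
  rewrite !(tsum_single _ 0%nat).
  - unfold iqfac; simpl. field. lra.
  - intros n Hn. rewrite (iqfac_neg p (0 + (-1 - Z.of_nat n) + 1)) by lia. ring.
  - intros n Hn. rewrite (iqfac_neg p (0 - Z.of_nat n)) by lia. ring.
Qed.

Lemma bailey0_neg p n : (n < 0)%Z -> bailey0 p n = 0.
Proof.
  intros Hn. unfold bailey0. rewrite (tsum_single _ 0%Z).
  - rewrite (iqfac_neg p (n - 0)) by lia. ring.
  - intros j _. destruct (Z_lt_le_dec j 0).
    + rewrite (iqfac_neg p (n + j)) by lia. ring.
    + rewrite (iqfac_neg p (n - j)) by lia. ring.
Qed.

Lemma bailey1_neg p n : (n < 0)%Z -> bailey1 p n = 0.
Proof.
  intros Hn. unfold bailey1. rewrite (tsum_single _ 0%Z).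
  - rewrite (iqfac_neg p (n - 0)) by lia. ring.
  - intros j _. destruct (Z_lt_le_dec j 0).
    + rewrite (iqfac_neg p (n + j + 1)) by lia. ring.
    + rewrite (iqfac_neg p (n - j)) by lia. ring.
Qed.

(** * Conjugate Bailey pairs and the evaluation of the two series *)

Definition oddz (q : R) (n : Z) : R := oddp q (Z.to_nat n).

Lemma oddz_succ q n : 0 < q -> (0 <= n)%Z -> oddz q (n + 1) = oddz q n * (1 + q * q ^^ n ^ 2).
Proof.
  intros Hq Hn. unfold oddz. replace (Z.to_nat (n + 1)) with (S (Z.to_nat n)) by lia.
  rewrite oddp_S. rewrite <- (powerRZ_of_nat q (Z.to_nat n)), Z2Nat.id by easy. easy.
Qed.

Lemma expb_oddz q : 0 < q < 1 -> expb Z.abs_nat (oddz q).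
Proof.
  intros Hq. exists 2. split; [lra|]. intros n. unfold oddz.
  pose proof (oddp_bounds q (Z.to_nat n) Hq). rewrite Rabs_pos_eq by lra.
  apply Rle_trans with (2 ^ Z.to_nat n); [lra|]. apply Rle_pow; [lra | lia].
Qed.

(** The gamma sides for delta_n = (-q;q^2)_n q^(n^2), with an additional q^(2n) in [conj1]. Only the
    dependence on j is determined: the constant [conj0 q 0] cancels in the continued fraction and is
    never evaluated. *)
Definition conj0 (q : R) (j : Z) : R :=
  tsum (fun n => oddz q n * (iqfac (q ^ 2) (n - j) * iqfac (q ^ 2) (n + j)) * q ^^ (n * n)).
Definition conj1 (q : R) (j : Z) : R :=
  tsum (fun n => oddz q n * q ^^ n ^ 2 * (iqfac (q ^ 2) (n - j) * iqfac (q ^ 2) (n + j + 1))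
    * q ^^ (n * n)).

Lemma summable_conj0 q (a b : Z) : 0 < q < 1 ->
  summable (fun n => oddz q n * (iqfac (q ^ 2) (n + a) * iqfac (q ^ 2) (n + b)) * q ^^ (n * n)).
Proof.
  intros Hq. pose proof (sq_lt1 q Hq) as Hp. apply summable_gauss; [easy|].
  apply expb_mult; [now apply expb_oddz | expb_ip_tac].
Qed.

Lemma summable_conj1 q (a b : Z) : 0 < q < 1 ->
  summable (fun n => oddz q n * q ^^ n ^ 2 * (iqfac (q ^ 2) (n + a) * iqfac (q ^ 2) (n + b)) * q ^^ (n * n)).
Proof.
  intros Hq. pose proof (sq_lt1 q Hq) as Hp. apply summable_gauss; [easy|].
  apply expb_mult; [|expb_ip_tac]. apply expb_mult; [now apply expb_oddz|].
  apply expb_ext with (fun n => q ^^ n * q ^^ n); [intros; ring | expb_ip_tac].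
Qed.

Lemma conj0_rec q j : 0 < q < 1 -> (0 <= j)%Z -> conj0 q (j + 1) = q * q ^^ j ^ 2 * conj0 q j.
Proof.
  intros Hq Hj. pose proof (sq_lt1 q Hq) as Hp. unfold conj0.
  assert (S1 := summable_conj0 q (- j) j Hq). assert (S2 := summable_conj0 q (- (j + 1)) (j + 1) Hq).
  change (fun n => oddz q n * (iqfac (q ^ 2) (n + - j) * iqfac (q ^ 2) (n + j)) * q ^^ (n * n)) with
    (fun n => oddz q n * (iqfac (q ^ 2) (n - j) * iqfac (q ^ 2) (n + j)) * q ^^ (n * n)) in S1.
  change (fun n => oddz q n * (iqfac (q ^ 2) (n + - (j + 1)) * iqfac (q ^ 2) (n + (j + 1))) * q ^^ (n * n)) with
    (fun n => oddz q n * (iqfac (q ^ 2) (n - (j + 1)) * iqfac (q ^ 2) (n + (j + 1))) * q ^^ (n * n)) in S2.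
  rewrite <- tsum_scal by easy. apply Rminus_diag_uniq. rewrite <- tsum_minus by (easy || now apply summable_scal).
  apply tsum_telescope with (fun n => - (1 - q * q ^^ j ^ 2) *
    (oddz q n * (iqfac (q ^ 2) (n + (- j - 1)) * iqfac (q ^ 2) (n + j)) * q ^^ (n * n))).
  - now apply summable_scal, summable_conj0.
  (* For n < 0 the value of [oddz] is stuck at 1 and violates its recurrence, but j >= 0 makes a
     reciprocal factorial vanish in every term. *)
  - intros n. destruct (Z_lt_le_dec n 0) as [Hn|Hn].
    + rewrite (iqfac_neg _ (n - (j + 1))), (iqfac_neg _ (n - j)), (iqfac_neg _ (n + 1 + (- j - 1))),
        (iqfac_neg _ (n + (- j - 1))) by lia. ring.
    + rewrite oddz_succ by lra || lia.
      rewrite (iqfac_rel (q ^ 2) (n - j) (n - (j + 1))), (iqfac_rel (q ^ 2) (n + (j + 1)) (n + j)),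
        (iqfac_rel (q ^ 2) (n - j) (n + (- j - 1))) by (easy || lia).
      replace (n + 1 + (- j - 1))%Z with (n - j)%Z by ring.
      replace (n + 1 + j)%Z with (n + (j + 1))%Z by ring.
      rewrite !powerRZ_powl.
      pw q (n - j)%Z (n + - j)%Z. pw q ((n + 1) * (n + 1))%Z (n * n + n + n + 1)%Z. pw_expand q.
      field. repeat split; nz.
Qed.

Lemma conj0_opp q j : conj0 q (- j) = conj0 q j.
Proof.
  unfold conj0. apply tsum_ext. intros n. replace (n - - j)%Z with (n + j)%Z by ring.
  change (n + - j)%Z with (n - j)%Z. ring.
Qed.

Lemma conj0_val q j : 0 < q < 1 -> conj0 q j = q ^^ (j * j) * conj0 q 0.
Proof.
  intros Hq.
  assert (H : forall k : nat, conj0 q (Z.of_nat k) = q ^^ (Z.of_nat k * Z.of_nat k) * conj0 q 0).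
  { induction k; [simpl; ring|]. replace (Z.of_nat (S k)) with (Z.of_nat k + 1)%Z by lia.
    rewrite conj0_rec, IHk by (easy || lia). generalize (Z.of_nat k). intros n.
    pw q ((n + 1) * (n + 1))%Z (n * n + n + n + 1)%Z. pw_expand q. ring. }
  destruct (Z_lt_le_dec j 0).
  - rewrite <- (conj0_opp q j). replace (- j)%Z with (Z.of_nat (Z.to_nat (- j))) by lia. rewrite H.
    rewrite Z2Nat.id by lia. now replace (- j * - j)%Z with (j * j)%Z by ring.
  - replace j with (Z.of_nat (Z.to_nat j)) by lia. apply H.
Qed.

Lemma conj1_rec q j : 0 < q < 1 -> (0 <= j)%Z ->
  (1 + q * q ^^ (j + 1) ^ 2) * conj1 q (j + 1) =
  q ^ 3 * q ^^ j ^ 2 * ((1 + q * q ^^ j ^ 2) * conj1 q j).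
Proof.
  intros Hq Hj. pose proof (sq_lt1 q Hq) as Hp. unfold conj1.
  assert (S1 := summable_conj1 q (- j) (j + 1) Hq). assert (S2 := summable_conj1 q (- (j + 1)) (j + 1 + 1) Hq).
  apply summable_ext with (g := fun n => oddz q n * q ^^ n ^ 2 *
    (iqfac (q ^ 2) (n - j) * iqfac (q ^ 2) (n + j + 1)) * q ^^ (n * n)) in S1;
    [|intros n; now rewrite Z.add_assoc].
  apply summable_ext with (g := fun n => oddz q n * q ^^ n ^ 2 *
    (iqfac (q ^ 2) (n - (j + 1)) * iqfac (q ^ 2) (n + (j + 1) + 1)) * q ^^ (n * n)) in S2;
    [|intros n; now rewrite (Z.add_assoc n (j + 1))].
  rewrite <- !tsum_scal by (easy || now apply summable_scal). apply Rminus_diag_uniq.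
  rewrite <- tsum_minus by (repeat apply summable_scal; easy).
  apply tsum_telescope with (fun n => - (1 - q ^ 4 * q ^^ j ^ 4) *
    (oddz q n * q ^^ n ^ 2 * (iqfac (q ^ 2) (n + (- j - 1)) * iqfac (q ^ 2) (n + (j + 1))) * q ^^ (n * n))).
  - now apply summable_scal, summable_conj1.
  - intros n. destruct (Z_lt_le_dec n 0) as [Hn|Hn].
    + rewrite (iqfac_neg _ (n - (j + 1))), (iqfac_neg _ (n - j)), (iqfac_neg _ (n + 1 + (- j - 1))),
        (iqfac_neg _ (n + (- j - 1))) by lia. ring.
    + rewrite oddz_succ by lra || lia.
      rewrite (iqfac_rel (q ^ 2) (n - j) (n - (j + 1))), (iqfac_rel (q ^ 2) (n + (j + 1) + 1) (n + j + 1)),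
        (iqfac_rel (q ^ 2) (n + (j + 1) + 1) (n + (j + 1))),
        (iqfac_rel (q ^ 2) (n - j) (n + (- j - 1))) by (easy || lia).
      replace (n + 1 + (- j - 1))%Z with (n - j)%Z by ring.
      replace (n + 1 + (j + 1))%Z with (n + (j + 1) + 1)%Z by ring.
      rewrite !powerRZ_powl.
      replace (n + (j + 1) + 1)%Z with (n + j + 1 + 1)%Z by ring.
      pw q (n - j)%Z (n + - j)%Z. pw q ((n + 1) * (n + 1))%Z (n * n + n + n + 1)%Z. pw_expand q.
      field. repeat split; nz.
Qed.

Lemma conj1_refl q j : conj1 q (-1 - j) = conj1 q j.
Proof.
  unfold conj1. apply tsum_ext. intros n. replace (n - (-1 - j))%Z with (n + j + 1)%Z by ring.
  replace (n + (-1 - j) + 1)%Z with (n - j)%Z by ring. ring.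
Qed.

Lemma conj1_val q j : 0 < q < 1 ->
  (1 + q * q ^^ j ^ 2) * conj1 q j = q ^^ (j * j + 2 * j) * ((1 + q) * conj1 q 0).
Proof.
  intros Hq.
  assert (H : forall k : nat, (1 + q * q ^^ (Z.of_nat k) ^ 2) * conj1 q (Z.of_nat k) =
    q ^^ (Z.of_nat k * Z.of_nat k + 2 * Z.of_nat k) * ((1 + q) * conj1 q 0)).
  { induction k; [simpl; ring|]. replace (Z.of_nat (S k)) with (Z.of_nat k + 1)%Z by lia.
    rewrite conj1_rec, IHk by (easy || lia). generalize (Z.of_nat k). intros n.
    pw q ((n + 1) * (n + 1) + 2 * (n + 1))%Z (n * n + 2 * n + n + n + 1 + 1 + 1)%Z. pw_expand q. ring. }
  destruct (Z_lt_le_dec j 0).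
  - specialize (H (Z.to_nat (-1 - j))). rewrite Z2Nat.id in H by lia.
    rewrite conj1_refl in H. revert H.
    pw q ((-1 - j) * (-1 - j) + 2 * (-1 - j))%Z (j * j + - (1))%Z.
    pw q (-1 - j)%Z (- (1) + - j)%Z. pw q (j * j + 2 * j)%Z (j * j + j + j)%Z. pw_expand q.
    intros H.
    assert (Hz : 0 < q ^^ j) by (apply powerRZ_lt; lra).
    apply Rmult_eq_reg_l with (/ (q * q ^^ j ^ 2)); [|apply Rgt_not_eq, Rinv_0_lt_compat, Rmult_lt_0_compat; [lra | now apply pow_lt]].
    transitivity ((1 + q * (/ q * / q ^^ j) ^ 2) * conj1 q j); [field; lra|].
    rewrite H. field. lra.
  - replace j with (Z.of_nat (Z.to_nat j)) by lia. apply H.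
Qed.

(** Relates the undetermined constants of the two families, so that they cancel in the quotient. *)
Lemma conj01 q : 0 < q < 1 -> conj0 q 0 = (1 + q) * conj1 q 0.
Proof.
  intros Hq. pose proof (sq_lt1 q Hq) as Hp. unfold conj0, conj1.
  assert (S1 := summable_conj0 q 0 0 Hq). assert (S2 := summable_conj1 q 0 1 Hq).
  apply summable_ext with (g := fun n => oddz q n *
    (iqfac (q ^ 2) (n - 0) * iqfac (q ^ 2) (n + 0)) * q ^^ (n * n)) in S1;
    [|intros n; now rewrite Z.sub_0_r, Z.add_0_r].
  apply summable_ext with (g := fun n => oddz q n * q ^^ n ^ 2 *
    (iqfac (q ^ 2) (n - 0) * iqfac (q ^ 2) (n + 0 + 1)) * q ^^ (n * n)) in S2;
    [|intros n; now rewrite Z.sub_0_r, Z.add_0_r].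
  rewrite <- !tsum_scal by easy. apply Rminus_diag_uniq.
  rewrite <- tsum_minus by (try apply summable_scal; easy).
  apply tsum_telescope with (fun n => -1 *
    (oddz q n * (iqfac (q ^ 2) (n + -1) * iqfac (q ^ 2) (n + 0)) * q ^^ (n * n))).
  - now apply summable_scal, summable_conj0.
  - intros n. destruct (Z_lt_le_dec n 0) as [Hn|Hn].
    + rewrite (iqfac_neg _ (n - 0)), (iqfac_neg _ (n + 1 + -1)), (iqfac_neg _ (n + -1)) by lia. ring.
    + rewrite oddz_succ by lra || lia.
      rewrite (iqfac_rel (q ^ 2) (n + 0 + 1) (n + 0)), (iqfac_rel (q ^ 2) n (n + -1)) by (easy || lia).
      replace (n + 1 + -1)%Z with n by ring. replace (n + 1 + 0)%Z with (n + 0 + 1)%Z by ring.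
      rewrite !Z.sub_0_r, !Z.add_0_r, !powerRZ_powl.
      pw q ((n + 1) * (n + 1))%Z (n * n + n + n + 1)%Z. pw_expand q. ring.
Qed.

Lemma tsum_nat_Z (f : Z -> R) : summable f -> (forall n, (n < 0)%Z -> f n = 0) ->
  tsum f = tsum (fun n : nat => f (Z.of_nat n)).
Proof.
  intros H Hn. apply tsum_supp; [intros; lia| |easy].
  intros t Ht. exists (Z.to_nat t). destruct (Z_lt_le_dec t 0); [now rewrite Hn in Ht | lia].
Qed.

Lemma bailey_sum (b c : Z -> R) q : 0 < q < 1 -> expb Z.abs_nat c ->
  (forall n, b (n - 1)%Z = (1 - (q ^ 2) ^^ (2 * n)) * b n) -> b 0%Z = 1 ->
  (forall n, (n < 0)%Z -> b n = 0) ->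
  tsum (fun n => c n * q ^^ (n * n) * b n) =
  tsum (fun n : nat => c (Z.of_nat n) * / (qfac (q ^ 2) n * evenp q n) * q ^ (n * n)).
Proof.
  intros Hq Hc Hb H0 Hn. pose proof (sq_lt1 q Hq) as Hp.
  pose proof (bailey_val b q Hq Hb H0) as Hv.
  rewrite tsum_nat_Z.
  - apply tsum_ext. intros n. rewrite Hv, <- Nat2Z.inj_mul, powerRZ_of_nat. ring.
  - apply summable_ext with (fun n => (c n * b n) * q ^^ (n * n)); [intros; ring|].
    apply summable_gauss; [easy|]. apply expb_mult; [easy|].
    apply expb_bounded with (/ qinf (q ^ 2)). intros n. pose proof (qinf_pos _ Hp) as HQ.
    pose proof (Rinv_0_lt_compat _ HQ).
    destruct (Z_lt_le_dec n 0).
    + rewrite Hn, Rabs_R0 by easy. lra.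
    + replace n with (Z.of_nat (Z.to_nat n)) by lia. rewrite Hv.
      pose proof (qfac_pos _ (Z.to_nat n) Hp). pose proof (evenp_ge1 q (Z.to_nat n) Hq).
      pose proof (qinf_le _ (Z.to_nat n) Hp).
      rewrite Rabs_pos_eq; [apply Rinv_le_contravar; nra | apply Rlt_le, Rinv_0_lt_compat; nra].
  - intros n Hlt. rewrite Hn by easy. ring.
Qed.

(** Bailey's lemma as an exchange of summation in one double series: summing over j first gives the
    q-series through [bailey0], summing over n first gives a theta series because [conj0] is a
    constant times q^(j^2). *)
Lemma cfs0_eval q : 0 < q < 1 -> cfs q 0 = conj0 q 0 * phi (q ^ 3).
Proof.
  intros Hq. pose proof (sq_lt1 q Hq) as Hp.
  set (F := fun n j => oddz q n * ((-1) ^^ j * (iqfac (q ^ 2) (n - j) * iqfac (q ^ 2) (n + j))) *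
    (q ^^ (n * n) * (q ^ 2) ^^ (j * j))).
  assert (HF : summable (fun x => F (fst x) (snd x))).
  { unfold F. apply summable_gauss2; try easy. apply expb_mult; [apply expb_fst, expb_oddz, Hq|].
    apply expb_mult; [apply expb_snd, expb_sgn|]. apply expb_mult; now apply expb_iqfac. }
  pose proof (tsum_swap F HF) as E.
  transitivity (tsum (fun n => tsum (fun j => F n j))).
  - rewrite (tsum_ext (fun n => tsum (fun j => F n j)) (fun n => oddz q n * q ^^ (n * n) * bailey0 (q ^ 2) n)).
    2: { intros n. unfold bailey0. rewrite <- tsum_scal by (apply summable_gauss; [easy | expb_ip_tac]).
         apply tsum_ext. intros j. unfold F. ring. }
    rewrite (bailey_sum (bailey0 (q ^ 2)) (oddz q) q Hq (expb_oddz q Hq)).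
    + change (cfs q 0) with (cfe q 0). unfold cfe. apply tsum_ext. intros n.
      unfold cfc, oddz. rewrite Nat2Z.id, Nat.add_0_r.
      simpl (2 * 0 * n)%nat. simpl (oddp q 0). simpl (q ^ 0).
      pose proof (qfac_pos _ n Hp). pose proof (evenp_ge1 q n Hq). field. lra.
    + intros; now apply bailey0_rec.
    + now apply bailey0_0.
    + intros; now apply bailey0_neg.
  - rewrite E. rewrite (tsum_ext _ (fun j => conj0 q 0 * ((-1) ^^ j * (q ^ 3) ^^ (j * j)))).
    + rewrite tsum_scal; [easy|]. apply summable_phi; [apply pow_lt1; [easy | lia] | apply expb_sgn].
    + intros j.
      transitivity ((-1) ^^ j * (q ^ 2) ^^ (j * j) * conj0 q j).
      * unfold conj0. rewrite <- tsum_scal.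
        -- apply tsum_ext. intros n. unfold F. ring.
        -- apply (summable_conj0 q (- j) j Hq).
      * rewrite conj0_val, !powerRZ_powl by easy. ring.
Qed.

Definition thetaN_half (q : R) (j : Z) : R :=
  (-1) ^^ j * q ^^ (3 * (j * j) + 2 * j) / (1 + q * q ^^ j ^ 2).

Lemma thetaN_half_den q j : 0 < q -> 0 < q ^^ j /\ 0 < q * q ^^ j ^ 2.
Proof.
  intros Hq. assert (0 < q ^^ j) by now apply powerRZ_lt. split; [easy|].
  apply Rmult_lt_0_compat; [lra | now apply pow_lt].
Qed.

Lemma summable_thetaN_half q : 0 < q < 1 -> summable (thetaN_half q).
Proof.
  intros Hq. apply summable_ext with (fun j => ((-1) ^^ j * / (1 + q * q ^^ j ^ 2)) *
    q ^^ (Z.of_nat 3 * (j * j) + 2 * j)).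
  { intros j. unfold thetaN_half, Rdiv. simpl Z.of_nat. ring. }
  apply summable_gauss_lin; [easy| |lia]. apply expb_mult; [apply expb_sgn|].
  apply expb_bounded with 1. intros j. destruct (thetaN_half_den q j ltac:(lra)).
  rewrite Rabs_pos_eq by (apply Rlt_le, Rinv_0_lt_compat; lra).
  rewrite <- Rinv_1. apply Rinv_le_contravar; lra.
Qed.

(* Symmetrising under [j -> -1 - j] cancels the denominator [1 + q^(2j+1)]. *)
Lemma tsum_thetaN_half q : 0 < q < 1 -> tsum (thetaN_half q) = thetaN q.
Proof.
  intros Hq. set (f := thetaN_half q). pose proof (summable_thetaN_half q Hq : summable f) as Hf.
  set (g := fun j => (-1) ^^ j * q ^^ (3 * (j * j) + 2 * j)).
  assert (Hg : summable g).
  { apply (summable_gauss_lin (powerRZ (-1)) q 3 2 Hq expb_sgn). lia. }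
  change (thetaN q) with (tsum g).
  pose proof (tsum_Z_reflect f (-1) Hf) as H1. pose proof (tsum_Z_reflect g (-1) Hg) as H2.
  assert (E : tsum (fun j => f j + f (-1 - j)%Z) = tsum (fun j => g j + g (-1 - j)%Z)).
  { apply tsum_ext. intros j. unfold f, g, thetaN_half. destruct (thetaN_half_den q j ltac:(lra)).
    pw (-1) (-1 - j)%Z (- (j + 1))%Z. rewrite powerRZ_m1_opp, (powerRZ_add (-1)), powerRZ_1r by lra.
    pw q (3 * ((-1 - j) * (-1 - j)) + 2 * (-1 - j))%Z (3 * (j * j) + 2 * j + j + j + 1)%Z.
    pw q (-1 - j)%Z (- (1) + - j)%Z.
    rewrite (powerRZ_add q (3 * (j * j) + 2 * j + j + j)), (powerRZ_add q (3 * (j * j) + 2 * j + j)),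
      (powerRZ_add q (3 * (j * j) + 2 * j)), (powerRZ_add q (- (1))), !(powerRZ_neg' q), !powerRZ_1r by lra.
    field. repeat split; try lra; nra. }
  rewrite !tsum_plus in E by (easy || now apply summable_Z_reflect). lra.
Qed.

(** The same exchange with [bailey1] and [conj1]. The factor 1/(1 + q^(2j+1)) left by [conj1_val] is
    the denominator of [thetaN_half]. *)
Lemma cfs1_eval q : 0 < q < 1 -> cfs q 1 = conj0 q 0 * thetaN q.
Proof.
  intros Hq. pose proof (sq_lt1 q Hq) as Hp. pose proof (pow_S_lt1 q 2 Hq) as H3.
  assert (Hexp : expb Z.abs_nat (fun n => oddz q n * q ^^ n ^ 2)).
  { apply expb_mult; [now apply expb_oddz|].
    apply expb_ext with (fun n => q ^^ n * q ^^ n); [intros; ring | expb_ip_tac]. }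
  set (F := fun n j => (oddz q n * q ^^ n ^ 2) * ((-1) ^^ j *
    (iqfac (q ^ 2) (n - j) * iqfac (q ^ 2) (n + j + 1))) * (q ^^ (n * n) * (q ^ 2) ^^ (j * j))).
  assert (HF : summable (fun x => F (fst x) (snd x))).
  { unfold F. apply summable_gauss2; try easy. apply expb_mult.
    - now apply (expb_fst (fun n => oddz q n * q ^^ n ^ 2)).
    - apply expb_mult; [apply expb_snd, expb_sgn|]. apply expb_mult; now apply expb_iqfac. }
  pose proof (tsum_swap F HF) as E.
  transitivity (tsum (fun n => tsum (fun j => F n j))).
  - rewrite (tsum_ext (fun n => tsum (fun j => F n j))
      (fun n => oddz q n * q ^^ n ^ 2 * q ^^ (n * n) * bailey1 (q ^ 2) n)).
    2: { intros n. unfold bailey1. rewrite <- tsum_scal by (apply summable_gauss; [easy | expb_ip_tac]).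
         apply tsum_ext. intros j. unfold F. ring. }
    rewrite (bailey_sum (bailey1 (q ^ 2)) (fun n => oddz q n * q ^^ n ^ 2) q Hq Hexp).
    + change (cfs q 1) with (cfo q 0). unfold cfo. apply tsum_ext. intros n.
      unfold cfc, oddz. rewrite Nat2Z.id, Nat.add_0_r, powerRZ_of_nat.
      replace (2 * 1 * n)%nat with (2 * n)%nat by lia. rewrite pow_mulr. simpl (oddp q 0).
      pose proof (qfac_pos _ n Hp). pose proof (evenp_ge1 q n Hq). field. lra.
    + intros; now apply bailey1_rec.
    + now apply bailey1_0.
    + intros; now apply bailey1_neg.
  - rewrite E, <- tsum_thetaN_half by easy.
    rewrite <- tsum_scal.
    + apply tsum_ext. intros j. unfold thetaN_half.
      destruct (thetaN_half_den q j ltac:(lra)) as [Hz Hd].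
      transitivity ((-1) ^^ j * (q ^ 2) ^^ (j * j) * conj1 q j).
      * unfold conj1. rewrite <- tsum_scal.
        -- apply tsum_ext. intros n. unfold F. ring.
        -- apply (summable_ext (fun n => oddz q n * q ^^ n ^ 2 *
             (iqfac (q ^ 2) (n + - j) * iqfac (q ^ 2) (n + (j + 1))) * q ^^ (n * n)));
             [intros n; now rewrite Z.add_assoc | now apply summable_conj1].
      * pose proof (conj1_val q j Hq) as HV. rewrite <- conj01 in HV by easy.
        replace (conj1 q j) with (q ^^ (j * j + 2 * j) * conj0 q 0 / (1 + q * q ^^ j ^ 2)).
        2: { rewrite <- HV. field. lra. }
        rewrite powerRZ_powl. pw q (j * j + 2 * j)%Z (j * j + j + j)%Z.
        pw q (3 * (j * j) + 2 * j)%Z (j * j + j * j + j * j + j + j)%Z. pw_expand q. field. lra.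
    + now apply summable_thetaN_half.
Qed.

(** The defining series alternates; positivity is inherited from [cfs q 0] and [cfs q 1], whose
    terms are positive and which share the factor [conj0 q 0]. *)
Lemma thetaN_pos q : 0 < q < 1 -> 0 < thetaN q.
Proof.
  intros Hq. pose proof (cfs_pos q 0 Hq) as H0. pose proof (cfs_pos q 1 Hq) as H1.
  rewrite cfs0_eval in H0 by easy. rewrite cfs1_eval in H1 by easy.
  pose proof (phi_pos (q ^ 3) (pow_S_lt1 q 2 Hq)).
  assert (0 < conj0 q 0) by nra. nra.
Qed.

Lemma cf_tail_theta q : 0 < q < 1 -> is_lim_seq (fun n => cf_tail q n 1) (phi (q ^ 3) / thetaN q).
Proof.
  intros Hq. pose proof (thetaN_pos q Hq) as HN. pose proof (cf_tail_limit q Hq) as H.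
  pose proof (cfs_pos q 1 Hq) as H1. rewrite cfs0_eval, cfs1_eval in H by easy.
  rewrite cfs1_eval in H1 by easy.
  replace (phi (q ^ 3) / thetaN q) with (conj0 q 0 * phi (q ^ 3) / (conj0 q 0 * thetaN q)); [easy|].
  field. split; nra.
Qed.

(** * The cubic quotient as a function of the sixth root *)

Ltac eqR := match goal with |- ?a = ?b => change (@eq R a b) end.

Lemma rphi_phi t : 0 < t < 1 -> rphi (- t) = phi t.
Proof.
  intros Ht. set (a := fun n : nat => (-1) ^^ (Z.of_nat n) * t ^^ (Z.of_nat n * Z.of_nat n)).
  assert (HS : summable (fun n => (-1) ^^ n * t ^^ (n * n)))
    by (apply summable_phi; [easy | apply expb_sgn]).
  assert (Ha : summable a).
  { apply (summable_comp Z.of_nat) in HS; [exact HS | intros; lia]. }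
  unfold phi. rewrite tsum_Z by easy. fold a.
  rewrite (tsum_ext (fun n => (-1) ^^ (-1 - Z.of_nat n) * _) (fun n => a (S n))).
  2: { intros n. unfold a. rewrite Nat2Z.inj_succ.
       pw (-1) (-1 - Z.of_nat n)%Z (- Z.succ (Z.of_nat n))%Z. rewrite powerRZ_m1_opp. do 2 f_equal. ring. }
  pose proof (tsum_nat_S a Ha) as E.
  replace (tsum (fun n => a (S n))) with (tsum a - a 0%nat) by lra.
  rewrite tsum_Series by easy. unfold rphi.
  rewrite (Series_ext a (fun n => (- t) ^ (n * n))).
  - unfold a; simpl. ring.
  - intros n. unfold a. rewrite <- Nat2Z.inj_mul, !powerRZ_of_nat.
    replace (- t) with (-1 * t) by ring. rewrite Rpow_mult_distr. f_equal.
    destruct (Nat.Even_or_Odd n) as [[k ->]|[k ->]].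
    + replace (2 * k * (2 * k))%nat with (2 * (2 * k * k))%nat by lia. now rewrite !pow_1_even.
    + replace ((2 * k + 1) * (2 * k + 1))%nat with (S (2 * (2 * k * k + 2 * k))) by lia.
      replace (2 * k + 1)%nat with (S (2 * k)) by lia. now rewrite !pow_1_odd.
Qed.

Lemma tri_double n : (2 * (n * (n + 1) / 2) = n * n + n)%nat.
Proof.
  replace (n * n + n)%nat with (n * (n + 1))%nat by lia. symmetry. apply Nat.Div0.div_exact.
  apply Nat.Div0.mod_divides. destruct (Nat.Even_or_Odd n) as [[k ->]|[k ->]].
  - exists (k * (2 * k + 1))%nat. lia.
  - exists ((2 * k + 1) * (k + 1))%nat. lia.
Qed.

Lemma rpsi_thetaB w : 0 < w < 1 -> rpsi (w ^ 2) = thetaB w / 2.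
Proof.
  intros Hw. set (a := fun n : nat => w ^^ (Z.of_nat n * Z.of_nat n + Z.of_nat n)).
  assert (HS : summable (fun n => w ^^ (n * n + n))).
  { apply summable_ext with (fun n => 1 * w ^^ (n * n + n)); [intros; ring|].
    apply summable_thetaB; [easy | apply expb_one]. }
  assert (Ha : summable a).
  { apply (summable_comp Z.of_nat) in HS; [exact HS | intros; lia]. }
  unfold thetaB. rewrite tsum_Z by easy. fold a.
  rewrite (tsum_ext (fun n : nat => w ^^ ((-1 - Z.of_nat n) * _ + _)) a).
  2: { intros n. unfold a. f_equal. ring. }
  rewrite tsum_Series by easy. unfold rpsi.
  rewrite (Series_ext a (fun n => (w ^ 2) ^ (n * (n + 1) / 2))); [field|].
  intros n. unfold a. rewrite <- pow_mult, tri_double, <- powerRZ_of_nat. f_equal. lia.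
Qed.

(** The link with [thetaB] covers positive arguments only, while the second integral starts at 0;
    hence a separate argument, with the geometric majorant given by n(n+1)/2 >= n. *)
Lemma continuous_rpsi t : -1 < t < 1 -> continuous rpsi t.
Proof.
  intros Ht. assert (Hat : Rabs t < 1) by now apply Rabs_def1.
  set (rho := (1 + Rabs t) / 2). assert (Hr : Rabs t < rho < 1) by (unfold rho; lra).
  pose proof (Rabs_pos t) as Hp.
  assert (HT : forall n, (n <= n * (n + 1) / 2)%nat).
  { intros n. pose proof (tri_double n). destruct n; [lia|]. nia. }
  assert (Hb : summable (fun n => rho ^ n)).
  { apply summable_ex_series. exists (/ (1 - rho)).
    apply is_series_ext with (fun n => rho ^ n).
    - intros n. rewrite Rabs_pos_eq; [easy | apply pow_le; lra].
    - apply is_series_geom. rewrite Rabs_pos_eq; lra. }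
  assert (Hdom : forall x, Rabs x < rho -> forall n, Rabs (x ^ (n * (n + 1) / 2)) <= rho ^ n).
  { intros x Hx n. rewrite <- RPow_abs. pose proof (Rabs_pos x).
    apply Rle_trans with (rho ^ (n * (n + 1) / 2)); [apply pow_incr; lra|].
    specialize (HT n). replace (n * (n + 1) / 2)%nat with (n + (n * (n + 1) / 2 - n))%nat by lia.
    rewrite pow_add. pose proof (pow_lt rho n ltac:(lra)).
    assert (rho ^ (n * (n + 1) / 2 - n) <= 1) by (rewrite <- (pow1 (n * (n + 1) / 2 - n)); apply pow_incr; lra).
    nra. }
  assert (Heq : forall x, Rabs x < rho -> rpsi x = tsum (fun n => x ^ (n * (n + 1) / 2))).
  { intros x Hx. symmetry. apply tsum_Series. apply summable_dom with (fun n => rho ^ n); auto. }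
  assert (Hd : 0 < rho - Rabs t) by lra.
  assert (Hloc : locally t (fun x => Rabs x < rho)).
  { exists (mkposreal _ Hd). intros x Hx. unfold ball in Hx; simpl in Hx.
    unfold AbsRing_ball, abs, minus, plus, opp in Hx; simpl in Hx.
    change (Rabs (x - t) < rho - Rabs t) in Hx. pose proof (Rabs_triang_inv x t). lra. }
  unfold continuous. rewrite (Heq t) by lra.
  apply filterlim_ext_loc with (fun x => tsum (fun n => x ^ (n * (n + 1) / 2))).
  { revert Hloc. apply filter_imp. intros x Hx. symmetry. now apply Heq. }
  apply (tannery (locally t) _ _ (fun n => rho ^ n)).
  - easy.
  - revert Hloc. apply filter_imp. intros x Hx. now apply Hdom.
  - intros n. apply (ex_derive_continuous (fun x => x ^ (n * (n + 1) / 2)) t).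
    auto_derive. easy.
Qed.

(** The variable is u = q^(1/6): V contains q^(1/3) = u^2, and psi(u^2) is [thetaB u / 2], so that
    all exponents are integers. *)
Definition Vu (u : R) : R := u ^ 2 * thetaN (u ^ 6) / phi (u ^ 18).

Lemma Vu_phi u : 0 < u < 1 -> 1 - 2 * Vu u = phi (u ^ 2) / phi (u ^ 18).
Proof.
  intros Hu. pose proof (phi_dissection (u ^ 2) (sq_lt1 u Hu)) as H.
  rewrite <- !pow_mult in H. cbn [Nat.mul Nat.add] in H.
  pose proof (phi_pos (u ^ 18) (pow_S_lt1 u 17 Hu)).
  rewrite H. unfold Vu. field. lra.
Qed.

Lemma Vu_pos u : 0 < u < 1 -> 0 < Vu u.
Proof.
  intros Hu. pose proof (phi_pos (u ^ 18) (pow_S_lt1 u 17 Hu)).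
  pose proof (thetaN_pos (u ^ 6) (pow_S_lt1 u 5 Hu)). pose proof (sq_lt1 u Hu).
  unfold Vu. apply Rdiv_lt_0_compat; [apply Rmult_lt_0_compat|]; lra.
Qed.

Lemma Vu_lt u : 0 < u < 1 -> Vu u < / 2.
Proof.
  intros Hu. pose proof (Vu_phi u Hu).
  pose proof (phi_pos (u ^ 18) (pow_S_lt1 u 17 Hu)). pose proof (phi_pos _ (sq_lt1 u Hu)).
  assert (0 < phi (u ^ 2) / phi (u ^ 18)) by now apply Rdiv_lt_0_compat. lra.
Qed.

Lemma Vu_thetaB u : 0 < u < 1 -> 1 + / Vu u = thetaB u / (u ^ 2 * thetaB (u ^ 9)).
Proof.
  intros Hu. pose proof (thetaB_dissection u Hu) as H. pose proof (thetaN_thetaC (u ^ 3) (pow_S_lt1 u 2 Hu)) as H'.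
  rewrite <- !pow_mult in H'. rewrite <- !pow_mult in H. cbn [Nat.mul Nat.add] in H, H'.
  pose proof (phi_pos (u ^ 18) (pow_S_lt1 u 17 Hu)).
  pose proof (thetaN_pos (u ^ 6) (pow_S_lt1 u 5 Hu)).
  pose proof (thetaB_pos (u ^ 9) (pow_S_lt1 u 8 Hu)).
  rewrite H. unfold Vu.
  replace (2 * thetaC (u ^ 3)) with (phi (u ^ 18) * thetaB (u ^ 9) / thetaN (u ^ 6)).
  - field. repeat split; lra.
  - rewrite <- H'. field. lra.
Qed.

Lemma is_derive_phi_pow k x : 0 < x < 1 -> (0 < k)%nat ->
  is_derive (fun y => phi (y ^ k)) x (INR k * dphi (x ^ k) / x).
Proof.
  intros Hx Hk. pose proof (pow_lt1 x k Hx Hk) as Hxk.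
  assert (H : is_derive (fun y => y ^ k) x (INR k * x ^ pred k)).
  { apply is_derive_Reals, derivable_pt_lim_pow. }
  pose proof (is_derive_comp phi _ x _ _ (is_derive_phi _ Hxk) H) as Hc.
  evar_last; [exact Hc|]. unfold scal; simpl; unfold mult; simpl.
  destruct k; [lia|]. simpl pred. rewrite <- (tech_pow_Rmult x k) at 2.
  assert (0 < x ^ k) by (apply pow_lt; lra). field. lra.
Qed.

Lemma is_derive_thetaB_pow k x : 0 < x < 1 -> (0 < k)%nat ->
  is_derive (fun y => thetaB (y ^ k)) x (INR k * dthetaB (x ^ k) / x).
Proof.
  intros Hx Hk. pose proof (pow_lt1 x k Hx Hk) as Hxk.
  assert (H : is_derive (fun y => y ^ k) x (INR k * x ^ pred k)).
  { apply is_derive_Reals, derivable_pt_lim_pow. }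
  pose proof (is_derive_comp thetaB _ x _ _ (is_derive_thetaB _ Hxk) H) as Hc.
  evar_last; [exact Hc|]. unfold scal; simpl; unfold mult; simpl.
  destruct k; [lia|]. simpl pred. rewrite <- (tech_pow_Rmult x k) at 2.
  assert (0 < x ^ k) by (apply pow_lt; lra). field. lra.
Qed.

Lemma locally_01 u : 0 < u < 1 -> locally u (fun x => 0 < x < 1).
Proof.
  intros Hu. apply (open_and (fun x => 0 < x) (fun x => x < 1)); [apply open_gt | apply open_lt | easy].
Qed.

Definition Ku (u : R) : R := u ^ 6 * thetaB (u ^ 3) ^ 2 * thetaB (u ^ 9) ^ 2.

Lemma is_derive_Vu u : 0 < u < 1 ->
  is_derive Vu u (Ku u * (1 - 8 * Vu u ^ 3) / (8 * Vu u ^ 2 * u)).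
Proof.
  intros Hu. apply is_derive_ext_loc with (fun x => (1 - phi (x ^ 2) / phi (x ^ 18)) / 2).
  { generalize (locally_01 u Hu). apply filter_imp. intros x Hx. rewrite <- Vu_phi by easy. eqR. field. }
  pose proof (phi_pos (u ^ 18) (pow_S_lt1 u 17 Hu)) as P18.
  pose proof (phi_pos (u ^ 6) (pow_S_lt1 u 5 Hu)) as P6.
  pose proof (phi_pos _ (sq_lt1 u Hu)) as P2.
  pose proof (is_derive_phi_pow 2 u Hu ltac:(lia)) as D2.
  pose proof (is_derive_phi_pow 18 u Hu ltac:(lia)) as D18.
  assert (HD : is_derive (fun x => (1 - phi (x ^ 2) / phi (x ^ 18)) / 2) u
    (- (2 * (dphi (u ^ 2) / phi (u ^ 2)) - 18 * (dphi (u ^ 18) / phi (u ^ 18))) / u *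
      (phi (u ^ 2) / phi (u ^ 18)) / 2)).
  { pose proof (is_derive_div _ _ u _ _ D2 D18 ltac:(lra)) as Hq.
    pose proof (is_derive_minus (fun _ => 1) _ u _ _ (is_derive_const 1 u) Hq) as Hm.
    pose proof (is_derive_scal _ u (/ 2) _ Hm) as Hs.
    apply is_derive_ext with (f := fun x => / 2 * minus 1 (phi (x ^ 2) / phi (x ^ 18))).
    { intros x. unfold minus, plus, opp; simpl. change ((/ 2) * (1 - phi (x ^ 2) / phi (x ^ 18)) =
        (1 - phi (x ^ 2) / phi (x ^ 18)) / 2). unfold Rdiv. ring. }
    evar_last; [exact Hs|]. clear - P2 P18 Hu. revert P2 P18. cbv beta.
    generalize (phi (u ^ 2)) (phi (u ^ 18)) (dphi (u ^ 2)) (dphi (u ^ 18)). intros a b c d Ha Hb.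
    unfold minus, plus, opp, zero; simpl. field. lra. }
  evar_last; [exact HD|].
  pose proof (dlog_phi u (u ^ 2) Hu eq_refl) as E1.
  pose proof (dlog_phi (u ^ 3) (u ^ 6) (pow_S_lt1 u 2 Hu) ltac:(ring)) as E2.
  rewrite <- !pow_mult in E1. rewrite <- !pow_mult in E2. cbn [Nat.mul Nat.add] in E1, E2.
  (* The logarithmic derivatives of [phi (u ^ 6)] cancel in this regrouping, which leaves one
     Wronskian quotient at u^2 and one at u^6. *)
  replace (2 * (dphi (u ^ 2) / phi (u ^ 2)) - 18 * (dphi (u ^ 18) / phi (u ^ 18))) with
    (2 * (dphi (u ^ 2) / phi (u ^ 2) - 3 * (dphi (u ^ 6) / phi (u ^ 6))) +
     6 * (dphi (u ^ 6) / phi (u ^ 6) - 3 * (dphi (u ^ 18) / phi (u ^ 18)))) by ring.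
  rewrite E1, E2, <- Vu_phi by easy.
  pose proof (Vu_thetaB u Hu) as EB. pose proof (thetaB_pos (u ^ 9) (pow_S_lt1 u 8 Hu)) as B9.
  pose proof (Vu_pos u Hu) as HV. pose proof (sq_lt1 u Hu).
  (* The dissection of psi eliminates [thetaB u]: both contributions become multiples of [Ku u],
     with total coefficient proportional to (1 + 1/v)^2 + 3. *)
  assert (EB' : thetaB u = (1 + / Vu u) * (u ^ 2 * thetaB (u ^ 9))).
  { rewrite EB. field. split; lra. }
  rewrite EB'. unfold Ku. field. lra.
Qed.

Definition Phu (u : R) : R := phi (u ^ 6) ^ 2 * phi (u ^ 18) ^ 2.

Lemma is_derive_invVu u : 0 < u < 1 ->
  is_derive (fun x => / Vu x) u (- 2 * Phu u * (1 + Vu u ^ 3) / (Vu u * u)).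
Proof.
  intros Hu.
  apply is_derive_ext_loc with (fun x => thetaB x / (x ^ 2 * thetaB (x ^ 9)) - 1).
  { generalize (locally_01 u Hu). apply filter_imp. intros x Hx. rewrite <- Vu_thetaB by easy. eqR. ring. }
  pose proof (thetaB_pos (u ^ 9) (pow_S_lt1 u 8 Hu)) as B9.
  pose proof (thetaB_pos (u ^ 3) (pow_S_lt1 u 2 Hu)) as B3.
  pose proof (thetaB_pos u Hu) as B1. pose proof (sq_lt1 u Hu) as Hu2.
  pose proof (is_derive_thetaB u Hu) as D1.
  pose proof (is_derive_thetaB_pow 9 u Hu ltac:(lia)) as D9.
  assert (Dp : is_derive (fun x => x ^ 2) u (INR 2 * u ^ 1)).
  { apply is_derive_Reals, (derivable_pt_lim_pow u 2). }
  assert (HD : is_derive (fun x => thetaB x / (x ^ 2 * thetaB (x ^ 9)) - 1) u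
    ((dthetaB u / thetaB u - 2 - 9 * (dthetaB (u ^ 9) / thetaB (u ^ 9))) / u *
      (thetaB u / (u ^ 2 * thetaB (u ^ 9))))).
  { pose proof (is_derive_mult _ _ u _ _ Dp D9 Rmult_comm) as Hm.
    assert (Hne : mult (u ^ 2) (thetaB (u ^ 9)) <> 0).
    { unfold mult; simpl. apply Rgt_not_eq. apply Rmult_gt_0_compat; simpl in *; lra. }
    pose proof (is_derive_div _ _ u _ _ D1 Hm Hne) as Hq.
    pose proof (is_derive_minus _ (fun _ => 1) u _ _ Hq (is_derive_const 1 u)) as Hs.
    evar_last; [exact Hs|]. clear - B1 B9 Hu Hu2. revert B1 B9. cbv beta.
    generalize (thetaB u) (thetaB (u ^ 9)) (dthetaB u) (dthetaB (u ^ 9)). intros a b c d Ha Hb.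
    unfold minus, plus, opp, zero, mult; simpl. field. repeat split; lra. }
  evar_last; [exact HD|].
  pose proof (dlog_thetaB u (u ^ 2) Hu eq_refl) as E1.
  pose proof (dlog_thetaB (u ^ 3) (u ^ 6) (pow_S_lt1 u 2 Hu) ltac:(ring)) as E2.
  rewrite <- !pow_mult in E1. rewrite <- !pow_mult in E2. cbn [Nat.mul Nat.add] in E1, E2.
  (* The -2 stems from u^2 in the denominator and cancels the constants 1/2 and 3/2 of the two uses
     of [dlog_thetaB]. Afterwards the dissection of phi eliminates [phi (u ^ 2)]. *)
  replace (dthetaB u / thetaB u - 2 - 9 * (dthetaB (u ^ 9) / thetaB (u ^ 9))) with
    ((dthetaB u / thetaB u - 3 * (dthetaB (u ^ 3) / thetaB (u ^ 3))) +
     3 * (dthetaB (u ^ 3) / thetaB (u ^ 3) - 3 * (dthetaB (u ^ 9) / thetaB (u ^ 9))) - 2) by ring.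
  rewrite E1, E2, <- Vu_thetaB by easy.
  pose proof (phi_pos (u ^ 18) (pow_S_lt1 u 17 Hu)) as P18.
  pose proof (Vu_pos u Hu) as HV.
  assert (EP : phi (u ^ 2) = (1 - 2 * Vu u) * phi (u ^ 18)).
  { rewrite Vu_phi by easy. field. lra. }
  rewrite EP. unfold Phu. field. lra.
Qed.

(** * Logarithmic derivatives and the limit at 1 *)

Definition r6 (q : R) : R := Rpower q (1 / 6).

Lemma r6_bounds q : 0 < q < 1 -> 0 < r6 q < 1.
Proof.
  intros Hq. unfold r6, Rpower. split; [apply exp_pos|].
  apply Rlt_le_trans with (exp 0); [|rewrite exp_0; lra]. apply exp_increasing.
  assert (ln q < 0) by (rewrite <- ln_1; apply ln_increasing; lra). lra.
Qed.

Lemma r6_pow q n : r6 q ^ n = Rpower q (INR n / 6).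
Proof.
  rewrite <- Rpower_pow by apply exp_pos. unfold r6. rewrite Rpower_mult. f_equal. field.
Qed.

Lemma r6_6 q : 0 < q -> r6 q ^ 6 = q.
Proof.
  intros Hq. rewrite r6_pow. replace (INR 6 / 6) with 1 by (simpl; field). now apply Rpower_1.
Qed.

Lemma cbrt_r6 q : 0 < q -> cbrt q = r6 q ^ 2.
Proof.
  intros Hq. unfold cbrt. destruct (Rlt_dec 0 q); [|lra]. rewrite r6_pow. f_equal. simpl; field.
Qed.

Lemma is_derive_r6 q : 0 < q -> is_derive r6 q (r6 q / (6 * q)).
Proof.
  intros Hq. unfold r6, Rpower. auto_derive; [easy|]. field. lra.
Qed.

Lemma cbrt_cube x : 0 < x -> cbrt (x ^ 3) = x.
Proof.
  intros Hx. unfold cbrt. destruct (Rlt_dec 0 (x ^ 3)) as [H|H].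
  - rewrite <- (Rpower_pow 3 x Hx), Rpower_mult. replace (INR 3 * (1 / 3)) with 1 by (simpl; field).
    now apply Rpower_1.
  - exfalso. apply H. now apply pow_lt.
Qed.

Definition V (q : R) : R := Vu (r6 q).

Lemma V_bounds q : 0 < q < 1 -> 0 < V q < / 2.
Proof. intros Hq. split; [apply Vu_pos | apply Vu_lt]; now apply r6_bounds. Qed.

Lemma V_cube_bounds q : 0 < q < 1 -> 0 < V q ^ 3 /\ 8 * V q ^ 3 < 1.
Proof.
  intros Hq. pose proof (V_bounds q Hq). split; [now apply pow_lt|].
  assert (V q ^ 2 < / 4) by (simpl; nra). replace (V q ^ 3) with (V q * V q ^ 2) by ring. nra.
Qed.

Definition lnA (q : R) : R := ln (1 - 8 * V q ^ 3).
Definition lnB (q : R) : R := ln (1 + / V q ^ 3).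

Lemma is_derive_ln_one_minus_cube (v : R -> R) q d : is_derive v q d -> 0 < 1 - 8 * v q ^ 3 ->
  is_derive (fun x => ln (1 - 8 * v x ^ 3)) q (- 24 * v q ^ 2 * d / (1 - 8 * v q ^ 3)).
Proof.
  intros Hd Hp.
  assert (H3 : is_derive (fun x => 1 - 8 * v x ^ 3) q (- 24 * v q ^ 2 * d)).
  { auto_derive; [now exists d|].
    replace (Derive (fun x => v x) q) with d by (symmetry; now apply is_derive_unique). simpl; ring. }
  assert (HL : is_derive ln (1 - 8 * v q ^ 3) (/ (1 - 8 * v q ^ 3))).
  { apply is_derive_Reals. now apply derivable_pt_lim_ln. }
  pose proof (is_derive_comp ln _ q _ _ HL H3) as Hc.
  evar_last; [exact Hc|]. unfold scal; simpl; unfold mult; simpl. field. simpl in Hp. lra.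
Qed.

Lemma is_derive_ln_one_plus_cube (w : R -> R) q d : is_derive w q d -> 0 < 1 + w q ^ 3 ->
  is_derive (fun x => ln (1 + w x ^ 3)) q (3 * w q ^ 2 * d / (1 + w q ^ 3)).
Proof.
  intros Hd Hp.
  assert (H3 : is_derive (fun x => 1 + w x ^ 3) q (3 * w q ^ 2 * d)).
  { auto_derive; [now exists d|].
    replace (Derive (fun x => w x) q) with d by (symmetry; now apply is_derive_unique). simpl; ring. }
  assert (HL : is_derive ln (1 + w q ^ 3) (/ (1 + w q ^ 3))).
  { apply is_derive_Reals. now apply derivable_pt_lim_ln. }
  pose proof (is_derive_comp ln _ q _ _ HL H3) as Hc.
  evar_last; [exact Hc|]. unfold scal; simpl; unfold mult; simpl. field. simpl in Hp. lra.
Qed.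

Lemma is_derive_lnA q : 0 < q < 1 ->
  is_derive lnA q (-8 * ((rpsi q) ^ 2 * (rpsi (q ^ 3)) ^ 2)).
Proof.
  intros Hq. pose proof (r6_bounds q Hq) as Hu. pose proof (V_cube_bounds q Hq) as HV3.
  pose proof (V_bounds q Hq) as HV.
  pose proof (is_derive_comp Vu r6 q _ _ (is_derive_Vu _ Hu) (is_derive_r6 q ltac:(lra))) as HD.
  change (fun x => Vu (r6 x)) with V in HD.
  assert (E1 : rpsi q = thetaB (r6 q ^ 3) / 2).
  { rewrite <- rpsi_thetaB by (apply pow_lt1; [easy | lia]). rewrite <- pow_mult. cbn [Nat.mul Nat.add].
    now rewrite r6_6 by lra. }
  assert (E3 : rpsi (q ^ 3) = thetaB (r6 q ^ 9) / 2).
  { rewrite <- rpsi_thetaB by (apply pow_lt1; [easy | lia]). rewrite <- pow_mult.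
    rewrite <- (r6_6 q) at 1 by lra. now rewrite <- pow_mult. }
  rewrite E1, E3. evar_last; [apply (is_derive_ln_one_minus_cube V q _ HD); lra|].
  unfold Ku. rewrite r6_6 by lra. change (Vu (r6 q)) with (V q).
  generalize (thetaB (r6 q ^ 3)) (thetaB (r6 q ^ 9)). intros a b.
  revert HV HV3. generalize (V q). intros v HV HV3.
  unfold scal; cbn [ModuleSpace.scal]. change mult with Rmult.
  change (- 24 * v ^ 2 * ((r6 q / (6 * q)) * (q * a ^ 2 * b ^ 2 * (1 - 8 * v ^ 3) / (8 * v ^ 2 * r6 q))) /
    (1 - 8 * v ^ 3) = -8 * ((a / 2) ^ 2 * (b / 2) ^ 2)).
  field. repeat split; lra.
Qed.

Lemma is_derive_lnB q : 0 < q < 1 ->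
  is_derive lnB q (- ((rphi (- q)) ^ 2 * (rphi (- q ^ 3)) ^ 2 / q)).
Proof.
  intros Hq. pose proof (r6_bounds q Hq) as Hu. pose proof (V_bounds q Hq) as HV.
  pose proof (is_derive_comp (fun x => / Vu x) r6 q _ _ (is_derive_invVu _ Hu)
    (is_derive_r6 q ltac:(lra))) as HD.
  change (fun x => / Vu (r6 x)) with (fun x => / V x) in HD.
  rewrite !rphi_phi by (easy || (apply pow_lt1; [easy | lia])).
  assert (HV3 : 0 < (/ V q) ^ 3) by (apply pow_lt, Rinv_0_lt_compat; lra).
  apply is_derive_ext with (fun x => ln (1 + (/ V x) ^ 3)).
  { intros x. unfold lnB. now rewrite pow_inv. }
  evar_last; [apply (is_derive_ln_one_plus_cube (fun x => / V x) q _ HD); lra|].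
  cbv beta. unfold Phu. change (Vu (r6 q)) with (V q).
  assert (E18 : r6 q ^ 18 = q ^ 3).
  { rewrite <- (r6_6 q) at 2 by lra. now rewrite <- pow_mult. }
  rewrite E18, r6_6 by lra.
  generalize (phi q) (phi (q ^ 3)). intros a b.
  revert HV. clear HV3. generalize (V q). intros v HV.
  change (3 * (/ v) ^ 2 * ((r6 q / (6 * q)) * (- 2 * (a ^ 2 * b ^ 2) * (1 + v ^ 3) / (v * r6 q))) /
    (1 + (/ v) ^ 3) = - (a ^ 2 * b ^ 2 / q)).
  assert (0 < v ^ 3) by (apply pow_lt; lra).
  field. repeat split; try lra.
Qed.

(** * The limit of V at 1 by comparison of products *)

Lemma phi_jtp_lim x : 0 < x < 1 -> is_lim_seq (jtp x (- x)) (phi x / qinf (x ^ 2)).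
Proof.
  intros Hx. pose proof (jacobi_triple_product x (- x) Hx ltac:(lra)) as H.
  replace (phi x / qinf (x ^ 2)) with
    (/ qinf (x ^ 2) * tsum (fun j => x ^^ (j * j - j) * (- x) ^^ j)); [easy|].
  unfold Rdiv. rewrite Rmult_comm. f_equal. apply tsum_ext. intros j.
  rewrite powerRZ_opp. pw x (j * j - j)%Z (j * j + - j)%Z. pw_expand x. field. nz.
Qed.

(** At z = -x the k-th pair of factors is (1 - x^(2k+1))^2, which decreases in x. *)
Lemma jtp_phi_antitone x y n : 0 < x -> x <= y -> y < 1 -> 0 <= jtp y (- y) n <= jtp x (- x) n.
Proof.
  intros Hx Hxy Hy. induction n; [simpl; lra|]. rewrite !jtp_S.
  assert (Hf : forall z, 0 < z -> (1 + - z * (z ^ 2) ^ n) * (1 + z ^ 2 * (z ^ 2) ^ n / - z) =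
    (1 - z ^ S (2 * n)) ^ 2).
  { intros z Hz. rewrite <- pow_mult, <- (tech_pow_Rmult z (2 * n)). field. lra. }
  rewrite !Hf by lra.
  assert (x ^ S (2 * n) <= y ^ S (2 * n)) by (apply pow_incr; lra).
  pose proof (pow_lt1 y (S (2 * n)) ltac:(lra) ltac:(lia)).
  assert (0 <= (1 - y ^ S (2 * n)) ^ 2 <= (1 - x ^ S (2 * n)) ^ 2).
  { split; [apply pow_le; lra | apply pow_incr; lra]. }
  split; [apply Rmult_le_pos; lra | apply Rmult_le_compat; lra].
Qed.

(** For 0 < z < 1 the inequality 1 - z <= (2/3)(1 - z^2) holds exactly when z >= 1/2; since z^9 <=
    z^2, each of the first K factors gains 2/3. *)
Lemma qfac_ratio y K : 0 < y < 1 -> / 2 <= y ^ K -> qfac y K <= (2 / 3) ^ K * qfac (y ^ 9) K.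
Proof.
  intros Hy HK. pose proof (pow_S_lt1 y 8 Hy) as H9.
  assert (H : forall n, (n <= K)%nat -> qfac y n <= (2 / 3) ^ n * qfac (y ^ 9) n).
  { induction n; intros Hn; [simpl; lra|]. specialize (IHn ltac:(lia)).
    change (qfac y (S n)) with (qfac y n * (1 - y ^ S n)).
    change (qfac (y ^ 9) (S n)) with (qfac (y ^ 9) n * (1 - (y ^ 9) ^ S n)).
    rewrite (pow_powl y 9), <- (tech_pow_Rmult (2 / 3)).
    pose proof (pow_S_lt1 y n Hy) as Hz.
    assert (Hz2 : / 2 <= y ^ S n).
    { eapply Rle_trans; [exact HK|]. replace K with (S n + (K - S n))%nat by lia. rewrite pow_add.
      pose proof (pow_bounds y (K - S n) Hy). nra. }
    generalize dependent (y ^ S n). intros z Hz Hz2.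
    pose proof (qfac_pos y n Hy). pose proof (qfac_pos _ n H9).
    assert (1 - z <= 2 / 3 * (1 - z ^ 9)).
    { assert (z ^ 2 <= z) by (simpl; nra). assert (z ^ 9 <= z ^ 2).
      { replace (z ^ 9) with (z ^ 2 * z ^ 7) by ring. pose proof (pow_bounds z 7 Hz).
        assert (0 < z ^ 2) by (apply pow_lt; lra). nra. }
      assert (1 - z <= 2 / 3 * (1 - z ^ 2)) by (simpl; nra). nra. }
    replace (2 / 3 * (2 / 3) ^ n * (qfac (y ^ 9) n * (1 - z ^ 9))) with
      (((2 / 3) ^ n * qfac (y ^ 9) n) * (2 / 3 * (1 - z ^ 9))) by ring.
    apply Rmult_le_compat; lra. }
  now apply H.
Qed.

(** Beyond the first K factors the trivial comparison 1 - y^n <= 1 - y^(9n) suffices. *)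
Lemma qinf_ratio y K : 0 < y < 1 -> / 2 <= y ^ K -> qinf y <= (2 / 3) ^ K * qinf (y ^ 9).
Proof.
  intros Hy HK. pose proof (pow_S_lt1 y 8 Hy) as H9.
  pose proof (qfac_ratio y K Hy HK) as H0.
  assert (H : forall n, qfac y (n + K) <= (2 / 3) ^ K * qfac (y ^ 9) (n + K)).
  { induction n; [easy|].
    change (qfac y (S n + K)) with (qfac y (n + K) * (1 - y ^ S (n + K))).
    change (qfac (y ^ 9) (S n + K)) with (qfac (y ^ 9) (n + K) * (1 - (y ^ 9) ^ S (n + K))).
    pose proof (pow_S_lt1 y (n + K) Hy). pose proof (pow_S_lt1 _ (n + K) H9).
    assert ((y ^ 9) ^ S (n + K) <= y ^ S (n + K)).
    { apply pow_incr. split; [lra|]. replace (y ^ 9) with (y * y ^ 8) by ring.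
      pose proof (pow_bounds y 8 Hy). nra. }
    pose proof (qfac_pos y (n + K) Hy). rewrite <- Rmult_assoc. apply Rmult_le_compat; lra. }
  apply (is_lim_seq_le (fun n => qfac y (n + K)) (fun n => (2 / 3) ^ K * qfac (y ^ 9) (n + K))
    (qinf y) ((2 / 3) ^ K * qinf (y ^ 9))); [exact H | |].
  - apply (is_lim_seq_incr_n (qfac y)). now apply qinf_lim.
  - apply is_lim_seq_mult'; [apply is_lim_seq_const|].
    apply (is_lim_seq_incr_n (qfac (y ^ 9))). now apply qinf_lim.
Qed.

(** The theta value is its odd-exponent product, which is antitone, times the Euler product at s^2,
    which supplies the gain (2/3)^K. With s = u^2 the left quotient is 1 - 2V, and K may be taken
    arbitrarily large near 1. *)
Lemma phi_ratio s K : 0 < s < 1 -> / 2 <= (s ^ 2) ^ K -> phi s <= (2 / 3) ^ K * phi (s ^ 9).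
Proof.
  intros Hs HK. pose proof (sq_lt1 s Hs) as H2. pose proof (pow_S_lt1 s 8 Hs) as H9.
  pose proof (qinf_ratio _ K H2 HK) as HQ. rewrite (pow_powl s 2 9) in HQ.
  pose proof (qinf_pos _ H2) as HQ2. pose proof (qinf_pos _ (sq_lt1 _ H9)) as HQ9.
  assert (Hle : phi s / qinf (s ^ 2) <= phi (s ^ 9) / qinf ((s ^ 9) ^ 2)).
  { apply (is_lim_seq_le (jtp s (- s)) (jtp (s ^ 9) (- s ^ 9)) (phi s / qinf (s ^ 2))
      (phi (s ^ 9) / qinf ((s ^ 9) ^ 2))); try now apply phi_jtp_lim.
    intros n. apply jtp_phi_antitone; try lra. replace (s ^ 9) with (s * s ^ 8) by ring.
    pose proof (pow_bounds s 8 Hs). nra. }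
  pose proof (phi_pos _ H9) as P9. pose proof (phi_pos _ Hs) as P1.
  apply Rle_trans with (phi (s ^ 9) / qinf ((s ^ 9) ^ 2) * qinf (s ^ 2)).
  - apply Rle_trans with (phi s / qinf (s ^ 2) * qinf (s ^ 2)); [right; field; lra|].
    apply Rmult_le_compat_r; lra.
  - apply Rle_trans with (phi (s ^ 9) / qinf ((s ^ 9) ^ 2) * ((2 / 3) ^ K * qinf ((s ^ 9) ^ 2))).
    + apply Rmult_le_compat_l; [apply Rlt_le, Rdiv_lt_0_compat; lra | lra].
    + right. field. lra.
Qed.

Lemma V_lim1 : filterlim V (at_left 1) (locally (/ 2)).
Proof.
  intros P [eps HP].
  assert (HL : is_lim_seq (fun K => (2 / 3) ^ K) 0) by (apply is_lim_seq_geom; rewrite Rabs_pos_eq; lra).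
  apply is_lim_seq_spec in HL. destruct (HL eps) as [K HK]. specialize (HK K (le_n _)).
  rewrite Rminus_0_r, Rabs_pos_eq in HK by (apply pow_le; lra).
  assert (Hc : continuous (fun q => ((r6 q ^ 2) ^ 2) ^ K) 1).
  { apply (ex_derive_continuous (fun q => ((r6 q ^ 2) ^ 2) ^ K)). auto_derive.
    eexists; apply is_derive_r6; lra. }
  assert (E1 : r6 1 = 1) by (unfold r6, Rpower; rewrite ln_1, Rmult_0_r; apply exp_0).
  assert (Hloc : locally 1 (fun q => / 2 < ((r6 q ^ 2) ^ 2) ^ K)).
  { apply (Hc (fun y => / 2 < y)). rewrite E1, !pow1. apply open_gt. lra. }
  destruct Hloc as [d Hd].
  assert (H01 : 0 < Rmin d 1) by (apply Rmin_pos; [apply cond_pos | lra]).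
  exists (mkposreal _ H01). intros q Hball Hq1. apply HP.
  unfold ball in *; simpl in *; unfold AbsRing_ball, abs, minus, plus, opp in *; simpl in *.
  assert (Hq : 0 < q < 1).
  { pose proof (Rmin_r d 1). apply Rabs_def2 in Hball. lra. }
  specialize (Hd q (Rlt_le_trans _ _ _ Hball (Rmin_l d 1))).
  pose proof (r6_bounds q Hq) as Hu.
  pose proof (phi_ratio _ K (sq_lt1 _ Hu) (Rlt_le _ _ Hd)) as HR.
  rewrite <- pow_mult in HR. cbn [Nat.mul Nat.add] in HR.
  pose proof (Vu_phi _ Hu) as HVp. fold (V q) in HVp. pose proof (V_bounds q Hq) as HV.
  pose proof (phi_pos (r6 q ^ 18) (pow_S_lt1 _ 17 Hu)) as P18.
  assert (phi (r6 q ^ 2) / phi (r6 q ^ 18) <= (2 / 3) ^ K).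
  { apply Rmult_le_reg_r with (phi (r6 q ^ 18)); [easy|].
    unfold Rdiv at 1. rewrite Rmult_assoc, Rinv_l, Rmult_1_r by lra. easy. }
  apply Rabs_def1; lra.
Qed.

(** * The two integrals *)

Lemma cubic_cf_limit q : 0 < q < 1 -> is_lim_seq (cubic_cf_convergent q) (V q).
Proof.
  intros Hq. pose proof (r6_bounds q Hq) as Hu. pose proof (thetaN_pos q Hq) as HN.
  pose proof (phi_pos (q ^ 3) (pow_S_lt1 q 2 Hq)) as HP.
  assert (E : V q = cbrt q / (phi (q ^ 3) / thetaN q)).
  { unfold V, Vu. rewrite cbrt_r6 by lra. replace (r6 q ^ 18) with (q ^ 3).
    - rewrite r6_6 by lra. field. lra.
    - rewrite <- (r6_6 q) at 1 by lra. now rewrite <- pow_mult. }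
  rewrite E. unfold cubic_cf_convergent.
  apply is_lim_seq_quot; [apply is_lim_seq_const | now apply cf_tail_theta | now apply Rdiv_lt_0_compat].
Qed.

(** All tails are at least 1, so every convergent is at most q^(1/3). This is the control of V at 0
    that the second integral needs. *)
Lemma V_cube_le q : 0 < q < 1 -> V q ^ 3 <= q.
Proof.
  intros Hq. pose proof (r6_bounds q Hq) as Hu. pose proof (V_bounds q Hq) as HV.
  assert (H : V q <= r6 q ^ 2).
  { rewrite <- cbrt_r6 by lra.
    apply (is_lim_seq_le (cubic_cf_convergent q) (fun _ => cbrt q) (V q) (cbrt q));
      [|now apply cubic_cf_limit | apply is_lim_seq_const].
    intros n. unfold cubic_cf_convergent. pose proof (cf_tail_ge1 q n 1 ltac:(lra)).
    assert (0 < cbrt q) by (rewrite cbrt_r6 by lra; apply pow_lt; lra).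
    apply Rmult_le_reg_r with (cf_tail q n 1); [lra|]. unfold Rdiv.
    rewrite Rmult_assoc, Rinv_l, Rmult_1_r by lra. nra. }
  rewrite <- (r6_6 q) at 2 by lra. replace (r6 q ^ 6) with ((r6 q ^ 2) ^ 3) by ring.
  apply pow_incr. lra.
Qed.

Lemma continuous_integrand2 t : -1 < t < 1 -> continuous (fun t => (rpsi t) ^ 2 * (rpsi (t ^ 3)) ^ 2) t.
Proof.
  intros Ht.
  assert (H3 : -1 < t ^ 3 < 1).
  { replace (t ^ 3) with (t * (t * t)) by ring. assert (0 <= t * t < 1) by nra. nra. }
  assert (Hc : continuous (fun x => rpsi (x ^ 3)) t).
  { apply (continuous_comp (fun x => x ^ 3) rpsi); [|now apply continuous_rpsi].
    apply (ex_derive_continuous (fun x => x ^ 3)). auto_derive. easy. }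
  assert (Hsq : forall f : R -> R, continuous f t -> continuous (fun x => f x ^ 2) t).
  { intros f Hf. apply (continuous_comp f (fun x => x ^ 2)); [easy|].
    apply (ex_derive_continuous (fun x => x ^ 2)). auto_derive. easy. }
  apply (continuous_mult (fun t => rpsi t ^ 2) (fun t => rpsi (t ^ 3) ^ 2));
    apply Hsq; [now apply continuous_rpsi | exact Hc].
Qed.

(** The derivative of [lnA] is known on the open interval only, so the fundamental theorem is
    applied on [x, q] and x tends to 0 along q / 2^(n+1). *)
Lemma is_RInt_psi q : 0 < q < 1 ->
  is_RInt (fun t => (rpsi t) ^ 2 * (rpsi (t ^ 3)) ^ 2) 0 q (- lnA q / 8).
Proof.
  intros Hq. set (F := fun t => (rpsi t) ^ 2 * (rpsi (t ^ 3)) ^ 2).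
  assert (Hex : forall a b, -1 < a < 1 -> -1 < b < 1 -> ex_RInt F a b).
  { intros a b Ha Hb. apply (ex_RInt_continuous F). intros z Hz. apply continuous_integrand2.
    split; [eapply Rlt_le_trans; [|apply Hz]; apply Rmin_glb_lt | eapply Rle_lt_trans; [apply Hz|]; apply Rmax_lub_lt]; lra. }
  assert (HF : forall x, 0 < x < q -> is_RInt F x q (- lnA q / 8 - - lnA x / 8)).
  { intros x Hx. apply (is_RInt_derive (fun x => - lnA x / 8) F).
    - intros z Hz. rewrite Rmin_left, Rmax_right in Hz by lra.
      pose proof (is_derive_scal lnA z (- / 8) _ (is_derive_lnA z ltac:(lra))) as Hd.
      apply is_derive_ext with (fun x => - / 8 * lnA x); [intros; eqR; field|].
      evar_last; [exact Hd|]. unfold F. eqR. field.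
    - intros z Hz. rewrite Rmin_left, Rmax_right in Hz by lra. apply continuous_integrand2. lra. }
  pose proof (Hex 0 q ltac:(lra) ltac:(lra)) as Hq0.
  assert (E : RInt F 0 q = - lnA q / 8).
  { set (x := fun n : nat => q * (/ 2) ^ S n).
    assert (Hx : forall n, 0 < x n < q).
    { intros n. unfold x. pose proof (pow_lt1 (/ 2) (S n) ltac:(lra) ltac:(lia)). nra. }
    assert (Lx : is_lim_seq x 0).
    { replace (Finite 0) with (Finite (q * 0)) by (f_equal; ring).
      apply is_lim_seq_mult'; [apply is_lim_seq_const|].
      apply (is_lim_seq_incr_1 (fun n => (/ 2) ^ n)), is_lim_seq_geom. rewrite Rabs_pos_eq; lra. }
    assert (L1 : is_lim_seq (fun n => RInt F 0 (x n)) 0).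
    { assert (Hc : continuous (fun y => RInt F 0 y) 0).
      { apply (ex_derive_continuous (fun y => RInt F 0 y)). exists (F 0).
        apply (is_derive_RInt F (fun y => RInt F 0 y) 0 0).
        - exists (mkposreal 1 Rlt_0_1). intros y Hy. apply (@RInt_correct R_CompleteNormedModule F 0 y), Hex; [lra|].
          unball Hy.
          apply Rabs_def2 in Hy. lra.
        - apply continuous_integrand2. lra. }
      pose proof (filterlim_comp _ _ _ x (fun y => RInt F 0 y) _ _ _ Lx Hc) as HL.
      rewrite RInt_point in HL. exact HL. }
    assert (L2 : is_lim_seq (fun n => lnA (x n)) 0).
    { apply is_lim_seq_le_le_loc with (u := fun n => ln (1 - 8 * x n)) (w := fun _ => 0).
      (* The squeeze ln(1 - 8x) <= lnA x <= 0 comes from V^3 <= x; the lower bound makes sense once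
         x < 1/8. *)
      - assert (Hs : eventually (fun n => x n < / 8)).
        { apply is_lim_seq_spec in Lx. destruct (Lx (mkposreal (/ 8) ltac:(lra))) as [n0 Hn0].
          exists n0. intros n Hn. specialize (Hn0 n Hn). simpl in Hn0. apply Rabs_def2 in Hn0. lra. }
        revert Hs. apply filter_imp. intros n Hn. specialize (Hx n).
        pose proof (V_cube_le (x n) ltac:(lra)). pose proof (V_cube_bounds (x n) ltac:(lra)). unfold lnA.
        split.
        + destruct (Req_dec (1 - 8 * x n) (1 - 8 * V (x n) ^ 3)) as [->|]; [lra|].
          apply Rlt_le, ln_increasing; lra.
        + rewrite <- ln_1. apply Rlt_le, ln_increasing; lra.
      - replace (Finite 0) with (Finite (ln (1 - 8 * 0))) by (f_equal; rewrite Rmult_0_r, Rminus_0_r; apply ln_1).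
        apply (filterlim_comp _ _ _ x (fun y => ln (1 - 8 * y)) eventually (locally 0)); [exact Lx|].
        apply (ex_derive_continuous (fun y => ln (1 - 8 * y))). auto_derive. lra.
      - apply is_lim_seq_const. }
    assert (L3 : is_lim_seq (fun n => RInt F 0 (x n) + (- lnA q / 8 - - lnA (x n) / 8))
      (0 + (- lnA q / 8 - - 0 / 8))).
    { apply is_lim_seq_plus'; [exact L1|]. apply is_lim_seq_minus'; [apply is_lim_seq_const|].
      apply is_lim_seq_quot; [|apply is_lim_seq_const|lra].
      apply (is_lim_seq_opp _ 0). exact L2. }
    assert (L4 : is_lim_seq (fun n => RInt F 0 (x n) + (- lnA q / 8 - - lnA (x n) / 8)) (RInt F 0 q)).
    { apply is_lim_seq_ext with (fun _ => RInt F 0 q); [|apply is_lim_seq_const].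
      intros n. specialize (Hx n). rewrite <- (is_RInt_unique _ _ _ _ (HF (x n) Hx)).
      symmetry. apply (RInt_Chasles F 0 (x n) q); apply Hex; lra. }
    apply is_lim_seq_unique in L3. apply is_lim_seq_unique in L4. rewrite L3 in L4.
    apply (f_equal real) in L4. unfold real in L4. lra. }
  rewrite <- E. now apply (@RInt_correct R_CompleteNormedModule F 0 q).
Qed.

Lemma continuous_integrand1 t : 0 < t < 1 ->
  continuous (fun t => (rphi (- t)) ^ 2 * (rphi (- t ^ 3)) ^ 2 / t) t.
Proof.
  intros Ht. pose proof (pow_S_lt1 t 2 Ht) as H3.
  apply continuous_ext_loc with (fun t => phi t ^ 2 * phi (t ^ 3) ^ 2 / t).
  { generalize (locally_01 t Ht). apply filter_imp. intros x Hx.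
    now rewrite !rphi_phi by (easy || (apply pow_lt1; [easy | lia])). }
  apply (ex_derive_continuous (fun t => phi t ^ 2 * phi (t ^ 3) ^ 2 / t)).
  assert (D1 : ex_derive phi t) by (eexists; now apply is_derive_phi).
  assert (D3 : ex_derive (fun t => phi (t ^ 3)) t) by (eexists; apply (is_derive_phi_pow 3); [easy | lia]).
  apply ex_derive_div; [|auto_derive; easy | lra].
  apply ex_derive_mult; apply ex_derive_pow; assumption.
Qed.

Lemma is_RInt_gen_phi q : 0 < q < 1 ->
  is_RInt_gen (fun t => (rphi (- t)) ^ 2 * (rphi (- t ^ 3)) ^ 2 / t)
    (at_point q) (at_left 1) (lnB q - ln 9).
Proof.
  intros Hq. set (F := fun t => _).
  assert (HF : forall b, q < b < 1 -> is_RInt F q b (- lnB b - - lnB q)).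
  { intros b Hb. apply (is_RInt_derive (fun x => - lnB x) F).
    - intros z Hz. rewrite Rmin_left, Rmax_right in Hz by lra.
      pose proof (is_derive_opp lnB z _ (is_derive_lnB z ltac:(lra))) as Hd.
      evar_last; [exact Hd|]. apply Ropp_involutive.
    - intros z Hz. rewrite Rmin_left, Rmax_right in Hz by lra. apply continuous_integrand1. lra. }
  assert (HL : filterlim lnB (at_left 1) (locally (ln 9))).
  (* The 9 of the first formula is 1 + 1/V^3 at the limiting value V = 1/2. *)
  { replace 9 with (1 + / (/ 2) ^ 3) by field.
    apply (filterlim_comp _ _ _ V (fun v => ln (1 + / v ^ 3)) (at_left 1) (locally (/ 2)));
      [apply V_lim1|].
    apply (ex_derive_continuous (fun v => ln (1 + / v ^ 3))). auto_derive.
    repeat split; lra. }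
  assert (HL' : filterlim (fun b => - lnB b - - lnB q) (at_left 1) (locally (lnB q - ln 9))).
  { replace (lnB q - ln 9) with (- ln 9 - - lnB q) by ring.
    apply (filterlim_comp _ _ _ lnB (fun y => - y - - lnB q) (at_left 1) (locally (ln 9))); [easy|].
    apply (ex_derive_continuous (fun y => - y - - lnB q)). auto_derive. easy. }
  intros P HP. specialize (HL' P HP). unfold filtermapi.
  apply (Filter_prod _ _ _ (fun a => a = q) (fun b => q < b < 1 /\ P (- lnB b - - lnB q))).
  - easy.
  - apply filter_and; [|exact HL'].
    assert (Hd : 0 < 1 - q) by lra. exists (mkposreal _ Hd). intros y Hy Hy1.
    unball Hy.
    apply Rabs_def2 in Hy. lra.
  - intros a b -> [Hb HPb]. exists (- lnB b - - lnB q). split; [now apply HF | easy].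
Qed.

Theorem theorem2p1 :
  forall q : R, 0 < q < 1 ->
  exists I1 I2 : R,
    is_RInt_gen (fun t => (rphi (- t))^2 * (rphi (- t^3))^2 / t)
      (at_point q) (at_left 1) I1 /\
    is_RInt (fun t => (rpsi t)^2 * (rpsi (t^3))^2) 0 q I2 /\
    is_lim_seq (cubic_cf_convergent q)
      (1 / cbrt (-1 + 9 * exp I1)) /\
    1 / cbrt (-1 + 9 * exp I1) = / 2 * cbrt (1 - exp (-8 * I2)).
Proof.
  intros q Hq. pose proof (V_bounds q Hq) as HV. pose proof (V_cube_bounds q Hq) as HV3.
  assert (HiV : 0 < / V q ^ 3) by (apply Rinv_0_lt_compat; lra).
  assert (E1 : 1 / cbrt (-1 + 9 * exp (lnB q - ln 9)) = V q).
  { unfold Rminus. rewrite exp_plus, exp_Ropp, exp_ln by lra. unfold lnB. rewrite exp_ln by lra.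
    replace (-1 + 9 * ((1 + / V q ^ 3) * / 9)) with ((/ V q) ^ 3) by (field; lra).
    rewrite cbrt_cube by (apply Rinv_0_lt_compat; lra). field. lra. }
  assert (E2 : / 2 * cbrt (1 - exp (-8 * (- lnA q / 8))) = V q).
  { replace (-8 * (- lnA q / 8)) with (lnA q) by field. unfold lnA. rewrite exp_ln by lra.
    replace (1 - (1 - 8 * V q ^ 3)) with ((2 * V q) ^ 3) by ring.
    rewrite cbrt_cube by lra. field. }
  exists (lnB q - ln 9), (- lnA q / 8). repeat split.
  - now apply is_RInt_gen_phi.
  - now apply is_RInt_psi.
  - rewrite E1. now apply cubic_cf_limit.
  - now rewrite E1, E2.
Qed.
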